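(* Let $\Gamma=\mathbb{Z}_2^3\cdot PSL(2;7)$. The joint spectral measure (over $\mathbb{T}^2$) for both non-conjugate embeddings of $\Gamma$ into the fundamental representations of $G_2$ is given by $$\mathrm{d}\varepsilon = \frac{1}{768\pi^4} J^2 \, \mathrm{d}_8 \times \mathrm{d}_8 + \frac{1}{672\pi^4} J^2 \, \mathrm{d}_7 \times \mathrm{d}_7 + \frac{1}{1152\pi^4} J^2 \, \mathrm{d}_6 \times \mathrm{d}_6 + \frac{1}{12} \, \mathrm{d}_4 \times \mathrm{d}_4 + \frac{1}{4} \, \mathrm{d}_3 \times \mathrm{d}_3 + \frac{5}{72} \, \mathrm{d}_2 \times \mathrm{d}_2 - \frac{11}{504} \, \mathrm{d}_1 \times \mathrm{d}_1 - \frac{1}{12} \, \mathrm{d}^{(1)}.$$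
   Context: $G_2$ is the compact simply connected simple Lie group of dimension 14, with fundamental representations $\rho_1$, $\rho_2$ of dimensions 7 and 14. Its maximal torus is identified with $\mathbb{T}^2$ so that, for $(\omega_1,\omega_2)=(e^{2\pi i\theta_1},e^{2\pi i\theta_2})\in\mathbb{T}^2$, $$\chi_{\rho_1} = 1 + \omega_1 + \omega_1^{-1} + \omega_2 + \omega_2^{-1} + \omega_1\omega_2^{-1} + \omega_1^{-1}\omega_2,$$ $$\chi_{\rho_2} = \chi_{\rho_1} + 1 + \omega_1\omega_2 + \omega_1^{-1}\omega_2^{-1} + \omega_1^2\omega_2^{-1} + \omega_1^{-2}\omega_2 + \omega_1\omega_2^{-2} + \omega_1^{-1}\omega_2^2 .$$ The Weyl group $D_{12}$ of $G_2$ (dihedral of order 12) is the subgroup of $GL(2,\mathbb{Z})$ generated by $T_2=\begin{pmatrix}0&-1\\-1&0\end{pmatrix}$ and $T_6=\begin{pmatrix}0&1\\-1&1\end{pmatrix}$, acting on $\mathbb{T}^2$ by $T(\omega_1,\omega_2)=(\omega_1^{a_{11}}\omega_2^{a_{12}},\omega_1^{a_{21}}\omega_2^{a_{22}})$ for $T=(a_{il})$. An embedding of a finite group $\Gamma$ in $G_2$ is an injective homomorphism $\iota:\Gamma\to G_2$; put $\varrho_j=\rho_j\circ\iota$, $j=1,2$. Let $\Delta_j$ be the adjacency matrix of the McKay graph of $\varrho_j$ (the matrix of tensoring with $\varrho_j$ on the irreducible representations of $\Gamma$), and $e_{\ast}$ the basis vector of the trivial representation. The joint spectral measure over $\mathbb{T}^2$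 of the embedding is the unique $D_{12}$-invariant probability measure $\varepsilon$ on $\mathbb{T}^2$ such that for all integers $m,n\geq 0$ $$\int_{\mathbb{T}^2}\chi_{\rho_1}^m\chi_{\rho_2}^n\,\mathrm{d}\varepsilon=\langle\Delta_1^m\Delta_2^n e_\ast,e_\ast\rangle=\sum_C\frac{|C|}{|\Gamma|}\chi_{\varrho_1}(C)^m\chi_{\varrho_2}(C)^n,$$ the sum being over the conjugacy classes $C$ of $\Gamma$. Notation for measures on $\mathbb{T}^2$: $\mathrm{d}_k$ is the uniform probability measure on the $k$-th roots of unity; $\mathrm{d}^{(n)}$ is the uniform probability measure on $\{(e^{2\pi i q_1/3n},e^{2\pi i q_2/3n}) : q_1,q_2\in\{0,1,\ldots,3n-1\},\ q_1+q_2\equiv 0 \bmod 3\}$. A function multiplying a measure is a density, and functions on $\mathbb{T}^2$ are written in the coordinates $\theta_1,\theta_2$. The function $J$ is $$J = 8\pi^2\big(\cos 2\pi(2\theta_1+\theta_2)+\cos 2\pi(\theta_1-3\theta_2)+\cos 2\pi(3\theta_1-2\theta_2)-\cos 2\pi(\theta_1+2\theta_2)-\cos 2\pi(3\theta_1-\theta_2)-\cos 2\pi(2\theta_1-3\theta_2)\big).$$ $\mathbb{Z}_2^3\cdot PSL(2;7)$ is the nonsplit extension of order 1344 with normal subgroup $\mathbb{Z}_2^3$ and quotient $PSL(2;7)\cong GL(3;2)$ acting on $\mathbb{Z}_2^3$ as $GL(3;2)$. It has eleven irreducible representations; exactly two of its seven-dimensional representations are faithful, both are irreducible, and these give the two embeddings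 in $G_2$ up to conjugacy in $G_2$. *)

(* Defs.v *)
From HB Require Import structures.
From mathcomp Require Import all_boot all_order all_algebra all_fingroup.
From mathcomp Require Import all_solvable all_field all_character.
From mathcomp Require Import all_classical all_reals all_analysis.
From mathcomp Require Import complex ring.

Set Implicit Arguments.
Unset Strict Implicit.
Unset Printing Implicit Defensive.

Import Order.TTheory GRing.Theory Num.Theory.
Import numFieldNormedType.Exports.

Local Open Scope complex_scope.
Local Open Scope classical_set_scope.
Local Open Scope ring_scope.

Local Notation Re := complex.Re.
Local Notation Im := complex.Im.

(******************************************************************************)
(* The compact Lie group G_2 is realized as the stabilizer in GL_7(R) of the  *)
(* associative 3-form                                                         *)
(*   phi3 = \sum_(i mod 7) e^i /\ e^(i+1) /\ e^(i+3),                         *)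
(* phi3 x y z = <x y, z> for the product of imaginary octonions with          *)
(* e_i e_(i+1) = e_(i+3).  As in mxrepresentation, matrices act on row        *)
(* vectors on the right.                                                      *)
(******************************************************************************)

Section ThreeForm.
Variable F : fieldType.
Implicit Types (x y z : 'rV[F]_7) (X : 'M[F]_7).

Definition minor3 (i j k : 'I_7) x y z : F :=
  x 0 i * (y 0 j * z 0 k - y 0 k * z 0 j)
  - x 0 j * (y 0 i * z 0 k - y 0 k * z 0 i)
  + x 0 k * (y 0 i * z 0 j - y 0 j * z 0 i).

(* Indices are added in 'I_7, that is, modulo 7. *)
Definition phi3 x y z : F := \sum_(i : 'I_7) minor3 i (i + 1) (i + 3%:R) x y z.

(* X . phi3, as the family of its values on the basis vectors. *)
Definition dphi3 X : 'M[F]_(7, 7 * 7) :=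
  let e i : 'rV[F]_7 := delta_mx 0 i in
  \matrix_i mxvec (\matrix_(j, k)
    (phi3 (e i *m X) (e j) (e k) + phi3 (e i) (e j *m X) (e k)
     + phi3 (e i) (e j) (e k *m X))).

(* The Lie algebra g_2 (over F) of the stabilizer of phi3: the row space of   *)
(* this matrix consists of the mxvec X such that X . phi3 = 0.                *)
Definition g2mx : 'M[F]_(7 * 7) := kermx (lin_mx dphi3).

Lemma phi3Dl a x x' y z :
  phi3 (a *: x + x') y z = a * phi3 x y z + phi3 x' y z.
Proof.
rewrite /phi3 mulr_sumr -big_split; apply: eq_bigr => i _ /=.
by rewrite /minor3 !mxE; ring.
Qed.

Lemma phi3C12 x y z : phi3 x y z = - phi3 y x z.
Proof.
rewrite /phi3 -sumrN; apply: eq_bigr => i _ /=.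
by rewrite /minor3; ring.
Qed.

Lemma phi3C23 x y z : phi3 x y z = - phi3 x z y.
Proof.
rewrite /phi3 -sumrN; apply: eq_bigr => i _ /=.
by rewrite /minor3; ring.
Qed.

Lemma phi3Dm a x y y' z :
  phi3 x (a *: y + y') z = a * phi3 x y z + phi3 x y' z.
Proof. by rewrite phi3C12 phi3Dl (phi3C12 y) (phi3C12 y'); ring. Qed.

Lemma phi3Dr a x y z z' :
  phi3 x y (a *: z + z') = a * phi3 x y z + phi3 x y z'.
Proof. by rewrite phi3C23 phi3Dm (phi3C23 _ z) (phi3C23 _ z'); ring. Qed.

Let lin3 (f : 'rV[F]_7 -> 'rV[F]_7 -> 'rV[F]_7 -> F) :=
  [/\ forall a x x' y z, f (a *: x + x') y z = a * f x y z + f x' y z,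
      forall a x y y' z, f x (a *: y + y') z = a * f x y z + f x y' z &
      forall a x y z z', f x y (a *: z + z') = a * f x y z + f x y z'].

Let lin_ext (f g : 'rV[F]_7 -> F) :
    (forall a x y, f (a *: x + y) = a * f x + f y) ->
    (forall a x y, g (a *: x + y) = a * g x + g y) ->
  (forall i, f (delta_mx 0 i) = g (delta_mx 0 i)) -> f =1 g.
Proof.
move=> hf hg hfg x; rewrite (row_sum_delta x).
have f0 h : (forall a x y, h (a *: x + y) = a * h x + h y) ->
    h (0 : 'rV[F]_7) = 0 :> F.
  move=> hh; have := hh 1 0 0; rewrite scale1r addr0 mul1r => /eqP.
  by rewrite -subr_eq subrr eq_sym => /eqP.
have e1 : forall s : seq 'I_7,
    f (\sum_(j <- s) x 0 j *: delta_mx 0 j)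
    = g (\sum_(j <- s) x 0 j *: delta_mx 0 j).
  elim=> [|i s IH]; first by rewrite big_nil !f0.
  by rewrite big_cons hf hg hfg IH.
exact: e1.
Qed.

Let lin3_ext f g : lin3 f -> lin3 g ->
    (forall i j k, f (delta_mx 0 i) (delta_mx 0 j) (delta_mx 0 k)
                   = g (delta_mx 0 i) (delta_mx 0 j) (delta_mx 0 k)) ->
  forall x y z, f x y z = g x y z.
Proof.
move=> [f1 f2 f3] [g1 g2 g3] fg x y z.
apply: (lin_ext (f := f x y) (g := g x y)) => // k.
apply: (lin_ext (f := fun y => f x y _) (g := fun y => g x y _)) => // j.
exact: (lin_ext (f := fun x => f x _ _) (g := fun x => g x _ _)).
Qed.

Lemma phi3_ext (g : 'M[F]_7) :
    (forall i j k, phi3 (delta_mx 0 i *m g) (delta_mx 0 j *m g)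
                     (delta_mx 0 k *m g)
                   = phi3 (delta_mx 0 i) (delta_mx 0 j) (delta_mx 0 k)) ->
  forall x y z, phi3 (x *m g) (y *m g) (z *m g) = phi3 x y z.
Proof.
apply: (lin3_ext (f := fun x y z => phi3 (x *m g) (y *m g) (z *m g))
                 (g := phi3)); split=> *;
by rewrite ?mulmxDl -?scalemxAl ?phi3Dl ?phi3Dm ?phi3Dr.
Qed.

Let dphi3_is_linear : linear dphi3.
Proof.
move=> a X Y; apply/matrixP => i jk.
case/mxvec_indexP: jk => j k.
rewrite !mxE !mxvecE !mxE !mulmxDr -!scalemxAr phi3Dl phi3Dm phi3Dr.
ring.
Qed.
HB.instance Definition _ :=
  GRing.isSemilinear.Build F _ _ _ dphi3
    (GRing.semilinear_linear dphi3_is_linear).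

Lemma g2mxP X :
  reflect (forall x y z, phi3 (x *m X) y z + phi3 x (y *m X) z
                         + phi3 x y (z *m X) = 0)
          (mxvec X <= g2mx)%MS.
Proof.
apply: (iffP sub_kermxP); rewrite mul_vec_lin /=.
  move/eqP; rewrite mxvec_eq0 => /eqP h.
  apply: (lin3_ext (f := fun x y z => phi3 (x *m X) y z
      + phi3 x (y *m X) z + phi3 x y (z *m X)) (g := fun _ _ _ => 0)).
  - by split=> *; rewrite ?mulmxDl -?scalemxAl ?phi3Dl ?phi3Dm ?phi3Dr; ring.
  - by split=> *; rewrite mulr0 addr0.
  move=> i j k; have /matrixP/(_ i (mxvec_index j k)) := h.
  by rewrite !mxE mxvecE !mxE.
move=> h; apply/eqP; rewrite mxvec_eq0; apply/eqP/matrixP => i jk.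
by case/mxvec_indexP: jk => j k; rewrite !mxE mxvecE !mxE h.
Qed.

End ThreeForm.

Lemma invmxM (F : fieldType) n (A B : 'M[F]_n) :
  A \in unitmx -> B \in unitmx -> invmx (A *m B) = invmx B *m invmx A.
Proof.
move=> uA uB; have uAB : A *m B \in unitmx by rewrite unitmx_mul uA.
rewrite -[RHS](mulmxK uAB) -(mulmxA (invmx B)) (mulmxA (invmx A)).
by rewrite (mulVmx uA) mul1mx (mulVmx uB) mul1mx.
Qed.

Lemma restr_mxM (F : fieldType) n (U A B : 'M[F]_n) : (U *m A <= U)%MS ->
  let v1 := val_submod (1%:M : 'M[F]_(\rank U)) in
  in_submod U (v1 *m (A *m B)) = in_submod U (v1 *m A) *m in_submod U (v1 *m B).
Proof.
move=> sUA v1; have sv1 : (v1 *m A <= U)%MS.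
  by apply: submx_trans sUA; rewrite submxMr // (val_submod1 U).
rewrite mulmxA; move: (v1 *m A) sv1 => W sWU.
rewrite -[in LHS](in_submodK sWU); move: (in_submod U W) => Z.
rewrite (val_submodE Z) -/v1 -mulmxA.
by rewrite (in_submodE U (Z *m _)) (in_submodE U (v1 *m B)) mulmxA.
Qed.

Lemma conj_mxM (F : fieldType) n (A B : 'M[F]_n) :
    A \in unitmx -> B \in unitmx ->
  lin_mulmx (invmx (A *m B)) *m lin_mulmxr (A *m B) =
  (lin_mulmx (invmx A) *m lin_mulmxr A) *m (lin_mulmx (invmx B) *m lin_mulmxr B).
Proof.
move=> uA uB; apply/row_matrixP => i; rewrite !rowE.
move: (delta_mx 0 i) => v; rewrite -[v]vec_mxK; move: (vec_mx v) => X.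
rewrite !mulmxA !mul_vec_lin /=; congr mxvec.
by rewrite invmxM // !mulmxA.
Qed.

Section G2.
Variable R : realType.
Implicit Types g h : 'M[R]_7.

Definition G2_pred g : bool :=
  (g \in unitmx) &&
  `[< forall x y z : 'rV[R]_7, phi3 (x *m g) (y *m g) (z *m g) = phi3 x y z >].

Definition G2 := {g : 'M[R]_7 | G2_pred g}.
HB.instance Definition _ := Choice.on G2.

Let G2_1 : G2_pred 1%:M.
Proof. by rewrite /G2_pred unitmx1; apply/asboolP => x y z; rewrite !mulmx1. Qed.

Let G2_M g h : G2_pred g -> G2_pred h -> G2_pred (g *m h).
Proof.
move=> /andP[ug /asboolP hg] /andP[uh /asboolP hh].
rewrite /G2_pred unitmx_mul ug uh; apply/asboolP => x y z.
by rewrite !mulmxA hh hg.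
Qed.

Let G2_V g : G2_pred g -> G2_pred (invmx g).
Proof.
move=> /andP[ug /asboolP hg]; rewrite /G2_pred unitmx_inv ug.
by apply/asboolP => x y z; rewrite -hg !mulmxKV.
Qed.

Definition G2_one : G2 := exist (fun g => G2_pred g) _ G2_1.
Definition G2_mul (a b : G2) : G2 := exist (fun g => G2_pred g) _ (G2_M (valP a) (valP b)).
Definition G2_inv (a : G2) : G2 := exist (fun g => G2_pred g) _ (G2_V (valP a)).

Let G2_unit (a : G2) : val a \in unitmx.
Proof. by have /andP[] := valP a. Qed.

Let G2_mulA : associative G2_mul.
Proof. by move=> a b c; apply: val_inj; rewrite /= mulmxA. Qed.
Let G2_mul1 : left_id G2_one G2_mul.
Proof. by move=> a; apply: val_inj; rewrite /= mul1mx. Qed.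
Let G2_1mul : right_id G2_one G2_mul.
Proof. by move=> a; apply: val_inj; rewrite /= mulmx1. Qed.
Let G2_mulV : left_inverse G2_one G2_inv G2_mul.
Proof. by move=> a; apply: val_inj; exact: mulVmx (G2_unit a). Qed.
Let G2_Vmul : right_inverse G2_one G2_inv G2_mul.
Proof. by move=> a; apply: val_inj; exact: mulmxV (G2_unit a). Qed.

HB.instance Definition _ :=
  isGroup.Build G2 G2_mulA G2_mul1 G2_1mul G2_mulV G2_Vmul.

(* The fundamental representations of G_2: the complexified natural one, and  *)
(* the complexified adjoint one, a acting on g_2 by X |-> a^-1 X a (a right   *)
(* action), in the basis row_base g2mx of g_2.  The rank of g2mx is 14.       *)
Definition rho1 (a : G2) : 'M[R[i]]_7 := map_mx (real_complex R) (val a).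

Definition rho2 (a : G2) : 'M[R[i]]_(\rank (g2mx R[i])) :=
  in_submod (g2mx R[i]) (val_submod 1%:M *m
    (lin_mulmx (invmx (rho1 a)) *m lin_mulmxr (rho1 a))).

Lemma rho1_1 : rho1 1%g = 1%:M.
Proof. by rewrite /rho1 /= map_mx1. Qed.

Lemma rho1M a b : rho1 (a * b)%g = rho1 a *m rho1 b.
Proof. by rewrite /rho1 /= map_mxM. Qed.

Lemma rho1_unit a : rho1 a \in unitmx.
Proof. by rewrite /rho1 map_unitmx. Qed.

Lemma rho1_phi3 a x y z :
  phi3 (x *m rho1 a) (y *m rho1 a) (z *m rho1 a) = phi3 x y z.
Proof.
have rphi (u v w : 'rV[R]_7) :
    phi3 (map_mx (real_complex R) u) (map_mx (real_complex R) v)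
      (map_mx (real_complex R) w) = (phi3 u v w)%:C.
  rewrite /phi3 rmorph_sum; apply: eq_bigr => i _ /=.
  by rewrite /minor3 !mxE !(rmorphD, rmorphN, rmorphM).
apply: phi3_ext => i j k.
rewrite -!(map_delta_mx (real_complex R)) -!map_mxM !rphi.
by have /andP[_ /asboolP ->] := valP a.
Qed.

Let Ad (a : G2) : 'M[R[i]]_(7 * 7) :=
  lin_mulmx (invmx (rho1 a)) *m lin_mulmxr (rho1 a).

Let rho2E a :
  rho2 a = in_submod (g2mx R[i]) (@val_submod _ _ (g2mx R[i]) _ 1%:M *m Ad a).
Proof. by []. Qed.

Let vec_Ad (X : 'M[R[i]]_7) a :
  mxvec X *m Ad a = mxvec (invmx (rho1 a) *m X *m rho1 a).
Proof. by rewrite /Ad mulmxA !mul_vec_lin. Qed.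

Let Ad_stable a : (g2mx R[i] *m Ad a <= g2mx R[i])%MS.
Proof.
apply/row_subP => i; rewrite row_mul -[row i _]vec_mxK.
set X := vec_mx _; have /g2mxP hX : (mxvec X <= g2mx R[i])%MS.
  by rewrite /X vec_mxK row_sub.
rewrite vec_Ad; apply/g2mxP => x y z.
pose V := invmx (rho1 a); rewrite !mulmxA -/V.
have := hX (x *m V) (y *m V) (z *m V).
rewrite -(rho1_phi3 a (_ *m X)) -(rho1_phi3 a _ (_ *m X)).
by rewrite -(rho1_phi3 a _ _ (_ *m X)) !(mulmxKV (rho1_unit a)).
Qed.

Lemma rho2_1 : rho2 1%g = 1%:M.
Proof.
have e : Ad 1%g = 1%:M.
  apply/row_matrixP => i.
  rewrite !rowE mulmx1 -[delta_mx 0 i]vec_mxK vec_Ad.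
  by rewrite rho1_1 invmx1 mul1mx mulmx1.
by rewrite rho2E e mulmx1 val_submodK.
Qed.

Lemma rho2M a b : rho2 (a * b)%g = rho2 a *m rho2 b.
Proof.
have e : Ad (a * b)%g = Ad a *m Ad b.
  by rewrite /Ad (rho1M a b); apply: conj_mxM; exact: rho1_unit.
by rewrite !rho2E e; apply: restr_mxM; exact: Ad_stable.
Qed.

End G2.

Section Embedding.
Variables (R : realType) (gT : finGroupType).
Variable iota : {multiplicative gT -> G2 R}.

Local Notation C := R[i].
Local Notation Gam := [set: gT]%G.

Let iotaM x y : iota (x * y)%g = (iota x * iota y)%g.
Proof. exact: gmulfM. Qed.

Let iota1 : iota 1%g = 1%g.
Proof. by apply: (mulgI (iota 1%g)); rewrite -iotaM !mulg1. Qed.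

Let varrho1_repr : mx_repr Gam (fun x => rho1 (iota x)).
Proof. by split=> [|x y _ _]; rewrite ?iota1 ?rho1_1 // iotaM rho1M. Qed.

Let varrho2_repr : mx_repr Gam (fun x => rho2 (iota x)).
Proof. by split=> [|x y _ _]; rewrite ?iota1 ?rho2_1 // iotaM rho2M. Qed.

Definition varrho1 : mx_representation C Gam 7 := MxRepresentation varrho1_repr.
Definition varrho2 : mx_representation C Gam _ := MxRepresentation varrho2_repr.

End Embedding.

Section McKay.
Variables (R : realType) (gT : finGroupType) (G : {group gT}).

Local Notation C := R[i].

Definition irrIdx : irrType C G := DecSocleType (regular_repr C G).

(* The multiplicity of irr_repr i in rG: the isotypic components of rG are    *)
(* indexed by its socle type.                                                 *)
Definition mult_in n (rG : mx_representation C G n) (i : irrIdx) : nat :=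
  \sum_(W : DecSocleType rG | irr_comp irrIdx (socle_repr W) == i) socle_mult W.

Definition McKay n (rG : mx_representation C G n) : 'M[R]_#|irrIdx| :=
  \matrix_(s, t)
     (mult_in (prod_repr rG (irr_repr (enum_val s))) (enum_val t))%:R.

Definition e_star : 'cV[R]_#|irrIdx| :=
  delta_mx (enum_rank (principal_comp irrIdx)) 0.

Definition McKay_moment n1 (rG1 : mx_representation C G n1)
    n2 (rG2 : mx_representation C G n2) (m n : nat) : R :=
  (e_star^T *m (McKay rG1 ^+ m *m McKay rG2 ^+ n *m e_star)) 0 0.

Definition class_moment n1 (rG1 : mx_representation C G n1)
    n2 (rG2 : mx_representation C G n2) (m n : nat) : C :=
  \sum_(K in classes G)
    #|K|%:R / #|G|%:R * \tr (rG1 (repr K)) ^+ m * \tr (rG2 (repr K)) ^+ n.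

End McKay.

Section Torus.
Variable R : realType.
Local Notation C := R[i].

Definition circle := {z : C | `|z| == 1}.
HB.instance Definition _ := Choice.on circle.

Let norm1 : `|1 : C| == 1. Proof. by rewrite normr1. Qed.
HB.instance Definition _ :=
  isPointed.Build circle (exist (fun z : C => `|z| == 1) 1 norm1).

Definition circle_coord (w : circle) : R * R := (Re (val w), Im (val w)).

(* The Borel sigma-algebra of the circle is induced from that of R * R. *)
HB.instance Definition _ :=
  Measurable.copy circle (g_sigma_algebra_preimageType circle_coord).

Definition torus : Type := (circle * circle)%type.
HB.instance Definition _ := Measurable.on torus.

Let expi_norm t : `|cos (2 * pi * t) +i* sin (2 * pi * t) : C| == 1.
Proof. by rewrite normc_def /= cos2Dsin2 sqrtr1. Qed.

(* expi t = e^(2 pi i t) *)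
Definition expi (t : R) : circle :=
  exist (fun z : C => `|z| == 1) _ (expi_norm t).

Definition mono (a b : int) (w : torus) : C := val w.1 ^ a * val w.2 ^ b.

Let mono_norm a b w : `|mono a b w| == 1.
Proof.
have h (z : circle) (c : int) : `|val z ^ c| = 1.
  have /eqP nz := valP z; case: c => n; first by rewrite normrX nz expr1n.
  by rewrite normfV normrX nz expr1n invr1.
by rewrite normrM !h mulr1.
Qed.

Definition torus_act (T : 'M[int]_2) (w : torus) : torus :=
  let c (i : 'I_2) : circle :=
    exist (fun z : C => `|z| == 1) _ (mono_norm (T i 0) (T i 1) w) in
  (c 0, c 1).

Definition chi1 (w : torus) : C :=
  1 + mono 1 0 w + mono (-1) 0 w + mono 0 1 w + mono 0 (-1) w
    + mono 1 (-1) w + mono (-1) 1 w.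

Definition chi2 (w : torus) : C :=
  chi1 w + 1 + mono 1 1 w + mono (-1) (-1) w + mono 2 (-1) w + mono (-2) 1 w
    + mono 1 (-2) w + mono (-1) 2 w.

(* cos (2 pi (a theta_1 + b theta_2)) is the real part of w_1^a w_2^b at      *)
(* w = (expi theta_1, expi theta_2); see J_expi below.                        *)
Definition J (w : torus) : R :=
  8 * pi ^+ 2 *
  (Re (mono 2 1 w) + Re (mono 1 (-3) w) + Re (mono 3 (-2) w)
   - Re (mono 1 2 w) - Re (mono 3 (-1) w) - Re (mono 2 (-3) w)).

Lemma expiD s t : val (expi (s + t)) = val (expi s) * val (expi t).
Proof.
apply/eqP; rewrite eq_complex /= mulrDr cosD sinD eqxx /=.
by apply/eqP; ring.
Qed.

Lemma expi0 : val (expi 0) = 1.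
Proof. by rewrite /= mulr0 cos0 sin0. Qed.

Lemma expiN t : val (expi (- t)) = (val (expi t))^-1.
Proof.
have e : val (expi t) * val (expi (- t)) = 1 by rewrite -expiD subrr expi0.
have nz : val (expi t) != 0.
  by apply/eqP => z0; move/eqP: e; rewrite z0 mul0r eq_sym oner_eq0.
by apply: (mulfI nz); rewrite e divff.
Qed.

Lemma exprz_expi t (a : int) : val (expi t) ^ a = val (expi (a%:~R * t)).
Proof.
have hX (n : nat) : val (expi t) ^+ n = val (expi (n%:R * t)).
  elim: n => [|n IH]; first by rewrite expr0 mul0r expi0.
  by rewrite exprS IH -expiD -nat1r mulrDl mul1r.
case: a => n; first exact: hX.
have -> : val (expi t) ^ Negz n = (val (expi t) ^+ n.+1)^-1 by [].
by rewrite hX -expiN NegzE rmorphN /= mulNr.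
Qed.

Lemma mono_expi (a b : int) t1 t2 :
  mono a b (expi t1, expi t2) = val (expi (a%:~R * t1 + b%:~R * t2)).
Proof. by rewrite /mono !exprz_expi expiD. Qed.

Lemma J_expi t1 t2 : J (expi t1, expi t2) =
  8 * pi ^+ 2 *
  (cos (2 * pi * (2 * t1 + t2)) + cos (2 * pi * (t1 - 3 * t2))
   + cos (2 * pi * (3 * t1 - 2 * t2)) - cos (2 * pi * (t1 + 2 * t2))
   - cos (2 * pi * (3 * t1 - t2)) - cos (2 * pi * (2 * t1 - 3 * t2))).
Proof. by rewrite /J !mono_expi /= !mulrNz !mulNr !mul1r. Qed.

Lemma monoN (a b : int) w : mono (- a) (- b) w = (mono a b w)^*.
Proof.
have h (z : circle) : (val z)^-1 = (val z)^*.
  case: z => -[x y] /=; rewrite normc_def => /eqP[] /= e.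
  have {}e : x ^+ 2 + y ^+ 2 = 1.
    by rewrite -[LHS]sqr_sqrtr ?e ?expr1n // addr_ge0 ?sqr_ge0.
  by apply/eqP; rewrite eq_complex /= e !divr1 !eqxx.
by rewrite /mono -!exprz_inv !h rmorphM /= !(fmorphXz conjc).
Qed.

Lemma chi_real w : (Im (chi1 w) = 0) /\ (Im (chi2 w) = 0).
Proof.
have hN (a b : int) : Im (mono (- a) (- b) w) = - Im (mono a b w).
  by rewrite monoN; case: (mono a b w).
have ImD (x y : C) : Im (x + y) = Im x + Im y by case: x y => ? ? [].
have c1 : Im (chi1 w) = 0.
  rewrite /chi1 !ImD (hN 1 0) (hN 0 1) (hN 1 (-1)) /=; ring.
split=> //; rewrite /chi2; move: (chi1 w) c1 => z c1.
rewrite !ImD c1 (hN 1 1) (hN 2 (-1)) (hN 1 (-2)) /=; ring.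
Qed.

End Torus.

(* The Weyl group of G_2, as a subgroup of GL(2, Z). *)
Definition T2 : 'M[int]_2 :=
  \matrix_(i, j) if i == j then 0 else -1.
Definition T6 : 'M[int]_2 :=
  \matrix_(i, j) if i == 0 then (if j == 0 then 0 else 1)
                 else (if j == 0 then -1 else 1).

Inductive D12 : 'M[int]_2 -> Prop :=
  | D12_T2 : D12 T2
  | D12_T6 : D12 T6
  | D12_1 : D12 1%:M
  | D12_M S T : D12 S -> D12 T -> D12 (S *m T)
  | D12_V T : D12 T -> D12 (invmx T).

Section Measures.
Variable R : realType.

Section Unif.
Context d (T : measurableType d).
Variable s : seq T.

(* The uniform probability measure on a finite set, given as a nonempty       *)
(* duplicate-free sequence.                                                   *)
Definition unif : set T -> \bar R :=
  mscale ((size s)%:R^-1)%:nng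
    (msum (fun i => \d_(nth point s i) : {measure set T -> \bar R}) (size s)).

HB.instance Definition _ := Measure.on unif.

Let unif_fin : fin_num_fun unif.
Proof.
move=> A mA; rewrite /unif /mscale /= fin_numM // /msum.
apply/sum_fin_numP => i _ _.
exact: (fin_num_measure \d_(nth point s i)).
Qed.

HB.instance Definition _ := @Measure_isFinite.Build _ T R unif unif_fin.
End Unif.

Definition d_roots (k : nat) : set (circle R) -> \bar R :=
  unif [seq expi (q%:R / k%:R) | q <- iota 0 k].
HB.instance Definition _ k := FiniteMeasure.on (d_roots k).

(* d^(n): uniform on the pairs (e^(2 pi i q1 / 3n), e^(2 pi i q2 / 3n)) with   *)
(* q1 + q2 = 0 mod 3.                                                         *)
Definition d_par (n : nat) : set (torus R) -> \bar R :=
  unif [seq ((expi (q.1%:R / (3 * n)%:R), expi (q.2%:R / (3 * n)%:R)) : torus R)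
       | q <- [seq (q1, q2) | q1 <- iota 0 (3 * n), q2 <- iota 0 (3 * n)]
       & (3 %| q.1 + q.2)%N].
HB.instance Definition _ n := FiniteMeasure.on (d_par n).

(* chi1 and chi2 are real-valued on the torus (chi_real), hence the real part *)
(* in the integrand.                                                          *)
Definition joint_spectral_measure (gT : finGroupType)
    (iota : {multiplicative gT -> G2 R})
    (eps : probability (torus R) R) : Prop :=
  (forall T A, D12 T -> measurable A -> eps (torus_act T @^-1` A) = eps A)
  /\
  forall m n : nat,
    (\int[eps]_w (Re (chi1 w ^+ m * chi2 w ^+ n))%:E
       = (McKay_moment (varrho1 iota) (varrho2 iota) m n)%:E)%E
    /\ (McKay_moment (varrho1 iota) (varrho2 iota) m n)%:C
       = class_moment (varrho1 iota) (varrho2 iota) m n.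

End Measures.

Section Groups.

Definition SL (n p : nat) : {set {'GL_n(p)}} :=
  [set g | \det (GLval g) == 1].

Lemma SL_group_set n p : group_set (SL n p).
Proof.
apply/group_setP; split=> [|g h]; rewrite !inE ?GL_1E ?det1 //.
move=> /eqP dg /eqP dh.
by rewrite GL_ME det_mulmx dg dh mulr1.
Qed.
Canonical SL_group n p := Group (@SL_group_set n p).

Local Open Scope group_scope.

Definition PSL (n p : nat) := SL n p / 'Z(SL n p).

(* gT is a nonsplit extension Z_2^3 . PSL(2;7), the quotient acting on Z_2^3  *)
(* by conjugation as its full automorphism group GL(3;2).                     *)
Definition is_nonsplit_2_3_PSL27 (gT : finGroupType) : Prop :=
  let G := [set: gT]%G in
  exists N : {group gT},
    [/\ normal N G /\ ~~ [splits G, over N],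
        2.-abelem N /\ #|N| = 8,
        G / N \isog PSL 2 7 &
        'C_G(N) = N /\ conj_aut N @* G = Aut N].

End Groups.

(* Main.v *)
From HB Require Import structures.
Require Import Defs.
From mathcomp Require Import all_boot all_order all_algebra all_fingroup.
From mathcomp Require Import all_solvable all_field all_character.
From mathcomp Require Import all_classical all_reals all_analysis.
From mathcomp Require Import measurable_realfun complex ring lra.

Set Implicit Arguments.
Unset Strict Implicit.
Unset Printing Implicit Defensive.

Import Order.TTheory GRing.Theory Num.Theory.
Import numFieldNormedType.Exports.

Local Open Scope ring_scope.

(** Write t1(x), t2(x) for the traces of an element x of Gamma in the
    representations of dimensions 7 and 14.

    By orthogonality of characters the McKay moment of order (m, n) is the
    average of t1 ^ m * t2 ^ n over Gamma (McKay_momentE), so the statement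
    depends only on the joint distribution of (t1, t2) on Gamma.  This
    distribution is found without classifying representations.  Let N be the
    normal subgroup 2^3, on which Gamma acts as GL(3, 2).  An element h of
    Gamma inducing a Singer cycle (a linear map of order 7) on N permutes the
    seven nontrivial characters of N cyclically.  Since the embedding is
    injective, N has a weight vector of nontrivial weight in R^7; its seven
    translates by powers of h have distinct weights, hence form a basis.
    Invariance under N kills the 3-form phi3 on three basis vectors whose
    weights do not add up to zero, that is, outside the lines of the Fano
    plane, and invariance under h makes it constant on the lines: up to a
    scalar, phi3 has its standard coordinates again (monomial_basis).  Gamma
    permutes the weights, so it acts by monomial matrices, and preserving phi3
    forces the nonzero entries to be signs.  There are exactly 1344 signed
    permutations that preserve phi3, and Gamma has at least 8 * 168 = 1344
    elements, so Gamma acts as the group of all of them (code_perm).  Listing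
    them gives the distribution of (t1, t2), with t2 computed from the
    decomposition of the exterior square of R^7 as R^7 + g_2 (mxtrace_rho2).
    This is why both embeddings have the same measure.

    On the torus, chi1 and chi2 together separate the orbits of the Weyl group
    (chi_separation): 1 + 2 cos of three angles of sum zero determine the
    angles up to order and a common sign.  Hence a Weyl-invariant probability
    measure is determined by the law of (chi1, chi2), which has finite support
    and so is determined by its moments (integral_finite_moments).  The measure
    itself is obtained by spreading the weight of each of the nine values of
    (t1, t2) uniformly over a Weyl orbit (class_measure).  All these orbits lie
    in the group of 168-th roots of unity, and so do the supports of all the
    terms of the formula.  The square of J is 16 pi^4 times a polynomial in
    chi1 and chi2; on the points of orders 8, 7 and 6 where it does not vanish
    it takes the single values 32, 49 and 36 times 16 pi^4.  The formula
    becomes an equality of two integer weights at each point of that group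
    (class_root_weights). *)

(** * McKay moments as averages over the group *)

Section McKayMoments.
Variables (R : realType) (gT : finGroupType) (G : {group gT}).
Local Notation C := R[i].

Lemma complex_pchar' : ([pchar C]^'.-group G)%g.
Proof.
apply: sub_pgroup (pgroup_pi G) => p _; rewrite !inE negb_and -implybE.
by apply/implyP => p_pr; rewrite pnatr_eq0 -lt0n prime_gt0.
Qed.

(** By Maschke's theorem the trace is a sum over isotypic components; these are
    regrouped by isomorphism type. *)
Lemma mxtrace_mult_in n (rG : mx_representation C G n) :
  {in G, forall x, \tr (rG x) =
     \sum_(t : irrIdx R G) (mult_in rG t)%:R * \tr (irr_repr t x)}.
Proof.
move=> x Gx; pose sG := DecSocleType rG.
have S1 : (Socle sG :=: 1%:M)%MS.
  by rewrite reducible_Socle1 //; exact: mx_Maschke_pchar complex_pchar'.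
rewrite -(mxtrace_submod1 (Socle_module sG) S1) // mxtrace_Socle //.
under [RHS]eq_bigr => t _ do rewrite /mult_in natr_sum mulr_suml.
rewrite (partition_big (fun W : sG => irr_comp (irrIdx R G) (socle_repr W)) xpredT) //=.
apply: eq_bigr => t _; apply: eq_bigr => W /eqP eW.
rewrite -[LHS]mulr_natl; congr (_ * _); apply: mxtrace_rsim Gx.
rewrite -eW; apply: rsim_irr_comp_pchar; first exact: complex_pchar'.
exact: socle_irr.
Qed.

Lemma irr_repr_principal :
  {in G, forall x, irr_repr (principal_comp (irrIdx R G)) x = 1%:M}.
Proof.
move=> x Gx; apply: (@val_submod_inj _ _ (socle_base (principal_comp (irrIdx R G)))).
rewrite -[X in val_submod X]mul1mx (val_submodJ (socle_module _)) //.
move: x Gx; apply/rfix_mxP; rewrite -(irr1_rfix (irrIdx R G)).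
by rewrite val_submod1 component_mx_id //; exact: socle_simple.
Qed.

(** The operator sum of irr_repr t over G has G-invariant rows, so it vanishes
    unless t is the trivial representation. *)
Lemma sum_mxtrace_irr (t : irrIdx R G) :
  \sum_(x in G) \tr (irr_repr t x) =
    #|G|%:R * (t == principal_comp (irrIdx R G))%:R.
Proof.
have fixE (v : 'rV_(irr_degree t)) : (forall x, x \in G -> v *m irr_repr t x = v) ->
    (val_submod v <= rfix_mx (regular_repr C G) G)%MS.
  move=> vfix; apply/rfix_mxP => x Gx.
  by rewrite -(val_submodJ (socle_module t)) // -/(irr_repr t) vfix.
have [->|tN1] := eqVneq t.
  rewrite mulr1 -sumr_const; apply: eq_bigr => x Gx.
  by rewrite irr_repr_principal // mxtrace1 degree_irr1.
rewrite mulr0 -raddf_sum /=.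
suff -> : \sum_(x in G) irr_repr t x = 0 by rewrite linear0.
apply/row_matrixP => i; rewrite row0; set E := \sum_(x in G) _.
have Efix x : x \in G -> E *m irr_repr t x = E.
  move=> Gx; rewrite /E mulmx_suml [RHS](reindex_astabs 'R x) ?astabsR //=.
  by apply: eq_bigr => y Gy; rewrite repr_mxM.
have /fixE : forall x, x \in G -> row i E *m irr_repr t x = row i E.
  by move=> x Gx; rewrite -row_mul Efix.
rewrite -(irr1_rfix (irrIdx R G)) => v1.
have vt : (val_submod (row i E) <= t)%MS.
  rewrite (submx_trans (val_submodP _)) // component_mx_id //.
  exact: socle_simple.
have dx := mxdirect_sumsP (Socle_direct (irrIdx R G)) t isT.
apply: (@val_submod_inj _ _ (socle_base t)); rewrite linear0.
apply/eqP; rewrite -submx0 -dx sub_capmx vt /=.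
by rewrite (submx_trans v1) // (sumsmx_sup (principal_comp (irrIdx R G))) // eq_sym.
Qed.

(** The column of x in the character table. *)
Definition irr_col (x : gT) : 'cV[C]_#|irrIdx R G| :=
  \col_s \tr (irr_repr (enum_val s) x).

(** The columns of the character table are common eigenvectors of all McKay
    matrices, because traces multiply under tensor products. *)
Lemma McKay_eigen n (rG : mx_representation C G n) x : x \in G ->
  map_mx (real_complex R) (McKay rG) *m irr_col x = \tr (rG x) *: irr_col x.
Proof.
move=> Gx; apply/colP => s; rewrite !mxE.
transitivity (\tr (prod_repr rG (irr_repr (enum_val s)) x)); last first.
  by rewrite /prod_repr /= mxtrace_prod.
rewrite (mxtrace_mult_in _ Gx) (reindex _ (onW_bij _ (enum_val_bij (irrIdx R G)))) /=.
by apply: eq_bigr => t _; rewrite !mxE rmorph_nat.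
Qed.

Lemma McKay_eigenX n (rG : mx_representation C G n) m x : x \in G ->
  map_mx (real_complex R) (McKay rG ^+ m) *m irr_col x
    = \tr (rG x) ^+ m *: irr_col x.
Proof.
move=> Gx; elim: m => [|m IH]; first by rewrite !expr0 map_mx1 mul1mx scale1r.
by rewrite exprSr map_mxM -mulmxA McKay_eigen // -scalemxAr IH scalerA -exprS.
Qed.

(** The columns of the character table add up to #|G| times e_star, by
    sum_mxtrace_irr; in these eigenvectors the McKay matrices are diagonal. *)
Lemma McKay_momentE n1 (rG1 : mx_representation C G n1)
    n2 (rG2 : mx_representation C G n2) m n :
  (McKay_moment rG1 rG2 m n)%:C%C =
    #|G|%:R^-1 * \sum_(x in G) \tr (rG1 x) ^+ m * \tr (rG2 x) ^+ n.
Proof.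
pose M := map_mx (real_complex R) (McKay rG1 ^+ m *m McKay rG2 ^+ n).
pose s1 := enum_rank (principal_comp (irrIdx R G)).
have s1E : enum_val s1 = principal_comp (irrIdx R G) by rewrite enum_rankK.
have -> : (McKay_moment rG1 rG2 m n)%:C%C = M s1 s1.
  rewrite /M mxE; congr (_%:C%C); rewrite /McKay_moment /e_star.
  by rewrite trmx_delta -rowE -colE !mxE.
have sumX : \sum_(x in G) irr_col x = #|G|%:R *: delta_mx s1 0.
  apply/colP => s; rewrite summxE !mxE andbT -(inj_eq enum_val_inj) s1E.
  by rewrite -sum_mxtrace_irr; apply: eq_bigr => x _; rewrite mxE.
have Mx x : x \in G -> M *m irr_col x = (\tr (rG1 x) ^+ m * \tr (rG2 x) ^+ n) *: irr_col x.
  move=> Gx; rewrite /M map_mxM -mulmxA McKay_eigenX // -scalemxAr McKay_eigenX //.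
  by rewrite scalerA mulrC.
have x1 x : x \in G -> irr_col x s1 0 = 1.
  move=> Gx; rewrite mxE s1E.
  by rewrite irr_repr_principal // mxtrace1 degree_irr1.
have G0 : #|G|%:R != 0 :> C by rewrite pnatr_eq0 -lt0n cardG_gt0.
clearbody M; apply: (mulfI G0); rewrite mulVKf //.
have -> : #|G|%:R * M s1 s1 = (M *m (\sum_(x in G) irr_col x)) s1 0.
  by rewrite sumX -scalemxAr -colE 2!mxE.
rewrite mulmx_sumr summxE; apply: eq_bigr => x Gx.
by rewrite Mx // mxE x1 // mulr1.
Qed.

Lemma class_momentE n1 (rG1 : mx_representation C G n1)
    n2 (rG2 : mx_representation C G n2) m n :
  class_moment rG1 rG2 m n =
    #|G|%:R^-1 * \sum_(x in G) \tr (rG1 x) ^+ m * \tr (rG2 x) ^+ n.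
Proof.
rewrite /class_moment (sum_by_classes (F := fun x => \tr (rG1 x) ^+ m * \tr (rG2 x) ^+ n)).
  rewrite mulr_sumr; apply: eq_bigr => K _.
  by rewrite -!mulrA [in RHS]mulrCA.
have trJ k (rG : mx_representation C G k) :
    {in G &, forall x y, \tr (rG (x ^ y)%g) = \tr (rG x)}.
  move=> x y Gx Gy; rewrite conjgE !repr_mxM ?groupM ?groupV // mxtrace_mulC.
  by rewrite repr_mxK.
by move=> x y Gx Gy; rewrite !trJ.
Qed.

End McKayMoments.

(** * The 3-form in coordinates *)

(** A sum over the indices 0, ..., 6 that evaluates: identities between the
    coordinates of phi3 are checked by computation on natural numbers. *)
Definition sum7 (f : nat -> int) : int := foldr (fun i s => f i + s) 0 (iota 0 7).

Lemma sum7E (f : nat -> int) : \sum_(i < 7) f i = sum7 f.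
Proof. by rewrite -(big_mkord xpredT f) unlock. Qed.

Lemma all7P (P : pred nat) : all P (iota 0 7) -> forall i : 'I_7, P i.
Proof. by move=> /allP h i; apply: (h (val i)); rewrite mem_iota add0n ltn_ord. Qed.

Definition kron (i j : nat) : int := (i == j)%:R.

(** The coordinates of phi3 on the standard basis (see phi3_delta). *)
Definition phiz (i j k : nat) : int :=
  sum7 (fun a => let b := ((a + 1) %% 7)%N in let c := ((a + 3) %% 7)%N in
    kron a i * (kron b j * kron c k - kron c j * kron b k)
    - kron b i * (kron a j * kron c k - kron c j * kron a k)
    + kron c i * (kron a j * kron b k - kron b j * kron a k)).

Section Trilinear.
Variable F : fieldType.
Local Notation e i := (delta_mx 0 i : 'rV[F]_7).

Lemma intr_kron (i j : nat) : (kron i j)%:~R = (i == j)%:R :> F.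
Proof. by rewrite /kron; case: eqP. Qed.

Lemma phi3_delta (i j k : 'I_7) : phi3 (e i) (e j) (e k) = (phiz i j k)%:~R.
Proof.
rewrite /phi3 /phiz -sum7E rmorph_sum; apply: eq_bigr => a _ /=.
rewrite /minor3 !mxE !eqxx /= !(rmorphD, rmorphN, rmorphM) /= !intr_kron.
by rewrite -!val_eqE.
Qed.

Lemma phi3Z a b c (x y z : 'rV[F]_7) :
  phi3 (a *: x) (b *: y) (c *: z) = a * b * c * phi3 x y z.
Proof.
rewrite /phi3 mulr_sumr; apply: eq_bigr => i _.
by rewrite /minor3 !mxE; ring.
Qed.

Lemma linear_coord (f : 'rV[F]_7 -> F) :
    (forall a u v, f (a *: u + v) = a * f u + f v) ->
  forall w, f w = \sum_i w 0 i * f (e i).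
Proof.
move=> hf w; have f0 : f 0 = 0.
  have := hf 1 0 0; rewrite scale1r addr0 mul1r => /eqP.
  by rewrite -subr_eq subrr eq_sym => /eqP.
rewrite [in LHS](row_sum_delta w); elim: (index_enum _) => [|i s IH].
  by rewrite !big_nil.
by rewrite !big_cons hf IH.
Qed.

Lemma phi3_mul (P : 'M[F]_7) x y z :
  phi3 (x *m P) (y *m P) (z *m P) = \sum_i \sum_j \sum_k
    x 0 i * y 0 j * z 0 k * phi3 (row i P) (row j P) (row k P).
Proof.
have lin f : (forall a u v, f (a *: u + v) = a * f u + f v) ->
    forall w, f (w *m P) = \sum_i w 0 i * f (row i P) :> F.
  move=> hf w; rewrite (linear_coord (f := fun u => f (u *m P))) => [|a u v].
    by apply: eq_bigr => i _; rewrite -rowE.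
  by rewrite mulmxDl -scalemxAl hf.
rewrite (lin (fun x => phi3 x _ _)) => [|*]; last exact: phi3Dl.
apply: eq_bigr => i _.
rewrite (lin (fun y => phi3 _ y _)) => [|*]; last exact: phi3Dm.
rewrite mulr_sumr; apply: eq_bigr => j _.
rewrite (lin (fun z => phi3 _ _ z)) => [|*]; last exact: phi3Dr.
rewrite 2!mulr_sumr; apply: eq_bigr => k _.
by rewrite !mulrA.
Qed.

Lemma phi3_coord x y z :
  phi3 x y z = \sum_i \sum_j \sum_k
    x 0 i * y 0 j * z 0 k * phi3 (e i) (e j) (e k).
Proof.
rewrite -[in LHS](mulmx1 x) -[in LHS](mulmx1 y) -[in LHS](mulmx1 z) phi3_mul.
apply: eq_bigr => i _; apply: eq_bigr => j _; apply: eq_bigr => k _.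
by rewrite !row1.
Qed.

Lemma phi3_scale (P : 'M[F]_7) c :
    (forall i j k, phi3 (row i P) (row j P) (row k P) = c * phi3 (e i) (e j) (e k)) ->
  forall x y z, phi3 (x *m P) (y *m P) (z *m P) = c * phi3 x y z.
Proof.
move=> hP x y z; rewrite phi3_mul phi3_coord mulr_sumr; apply: eq_bigr => i _.
rewrite mulr_sumr; apply: eq_bigr => j _; rewrite mulr_sumr; apply: eq_bigr => k _.
by rewrite hP mulrCA.
Qed.
End Trilinear.

(** Up to the factor 6, the matrices of the forms phi3 e_i _ _ are orthonormal;
    they span the copy of the 7-dimensional representation inside its exterior
    square. *)
Lemma phiz_contract2 (i j : 'I_7) :
  \sum_(a < 7) \sum_(b < 7) phiz i a b * phiz j a b = 6 * kron i j.
Proof.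
rewrite (eq_bigr (fun a : 'I_7 => sum7 (fun b => phiz i a b * phiz j a b))).
  rewrite (sum7E (fun a => sum7 (fun b => phiz i a b * phiz j a b))).
  apply/eqP; move: i j.
  have h : all (fun i => all (fun j =>
      sum7 (fun a => sum7 (fun b => phiz i a b * phiz j a b)) == 6 * kron i j)
    (iota 0 7)) (iota 0 7).
    by vm_compute.
  by move=> i j; exact: (all7P (all7P h i)).
by move=> a _; rewrite -sum7E.
Qed.

(** Nested lists holding all the values of a function, so that evaluating an
    identity in many indices computes each value once. *)
Definition tab4 (f : nat -> nat -> nat -> nat -> int) :=
  [seq [seq [seq [seq f a b i j | j <- iota 0 7] | i <- iota 0 7] | b <- iota 0 7] | a <- iota 0 7].
Definition lookup4 (t : seq (seq (seq (seq int)))) a b i j : int :=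
  nth 0 (nth [::] (nth [::] (nth [::] t a) b) i) j.
Definition tab3 (f : nat -> nat -> nat -> int) :=
  [seq [seq [seq f a b i | i <- iota 0 7] | b <- iota 0 7] | a <- iota 0 7].
Definition lookup3 (t : seq (seq (seq int))) a b i : int :=
  nth 0 (nth [::] (nth [::] t a) b) i.

Lemma lookup3_tab3 f (a b i : 'I_7) : lookup3 (tab3 f) a b i = f a b i.
Proof.
by rewrite /lookup3 /tab3 !(nth_map 0%N) ?size_iota ?ltn_ord // !nth_iota ?ltn_ord.
Qed.
Lemma lookup4_tab4 f (a b i j : 'I_7) : lookup4 (tab4 f) a b i j = f a b i j.
Proof.
by rewrite /lookup4 /tab4 !(nth_map 0%N) ?size_iota ?ltn_ord // !nth_iota ?ltn_ord.
Qed.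

(** Six times the projection on g_2 of the elementary matrix with entry 1 at
    (a, b): its skew part minus its component on the matrices of the forms
    phi3 e_l _ _, which are orthogonal to g_2. *)
Definition projz (a b i j : nat) : int :=
  3 * (kron a i * kron b j - kron a j * kron b i) - sum7 (fun l => phiz l i j * phiz l a b).

(** The projection annihilates phi3, hence takes its values in g_2. *)
Lemma projz_g2 (a b i j k : 'I_7) :
  \sum_(c < 7) (projz a b i c * phiz c j k + projz a b j c * phiz i c k
                + projz a b k c * phiz i j c) = 0.
Proof.
under eq_bigr => c _ do rewrite -!(lookup3_tab3 phiz) -!(lookup4_tab4 projz).
have h : let p := lookup3 (tab3 phiz) in let q := lookup4 (tab4 projz) in
  all (fun a => all (fun b => all (fun i => all (fun j => all (fun k =>
  sum7 (fun c => q a b i c * p c j k + q a b j c * p i c k + q a b k c * p i j c) == 0)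
   (iota 0 7)) (iota 0 7)) (iota 0 7)) (iota 0 7)) (iota 0 7).
  by vm_compute.
move: h; cbv zeta; set p := lookup3 _; set q := lookup4 _ => h.
rewrite (sum7E (fun c => q a b i c * p c j k + q a b j c * p i c k + q a b k c * p i j c)).
exact/eqP/(all7P (all7P (all7P (all7P (all7P h a) b) i) j)).
Qed.

(** Two indices of the equations X . phi3 = 0 are contracted here against phi3;
    what remains is a linear system on the entries of X, used in g2mx_key. *)
Lemma phiz_key (i j a b : 'I_7) :
  \sum_(p < 7) \sum_(q < 7) phiz j p q *
     (kron a i * phiz b p q + kron a p * phiz i b q + kron a q * phiz i p b)
  = 2 * (kron a i * kron b j + kron a j * kron b i + kron i j * kron a b
         + \sum_(l < 7) phiz l i j * phiz l a b).
Proof.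
under eq_bigr => p _ do under eq_bigr => q _ do rewrite -!(lookup3_tab3 phiz).
under [in RHS]eq_bigr => l _ do rewrite -!(lookup3_tab3 phiz).
have h : let f := lookup3 (tab3 phiz) in
  all (fun i => all (fun j => all (fun a => all (fun b =>
  sum7 (fun p => sum7 (fun q => f j p q *
     (kron a i * f b p q + kron a p * f i b q + kron a q * f i p b))) ==
  2 * (kron a i * kron b j + kron a j * kron b i + kron i j * kron a b
         + sum7 (fun l => f l i j * f l a b)))
   (iota 0 7)) (iota 0 7)) (iota 0 7)) (iota 0 7).
  by vm_compute.
move: h; cbv zeta; set f := lookup3 _ => h.
rewrite (sum7E (fun l => f l i j * f l a b)).
under eq_bigr => p _.
  rewrite (sum7E (fun q => f j p q *
     (kron a i * f b p q + kron a p * f i b q + kron a q * f i p b))); over.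
rewrite (sum7E (fun p => sum7 (fun q => f j p q *
     (kron a i * f b p q + kron a p * f i b q + kron a q * f i p b)))).
exact/eqP/(all7P (all7P (all7P (all7P h i) j) a)).
Qed.

(** * The trace of the adjoint representation *)

(** The trace on a stable subspace is computed by any projection Q onto it, so
    no basis of the subspace has to be known. *)
Lemma mxtrace_restr (F : fieldType) n (U A Q : 'M[F]_n) :
    (U *m A <= U)%MS -> (Q <= U)%MS -> U *m Q = U ->
  \tr (in_submod U (val_submod (1%:M : 'M[F]_(\rank U)) *m A)) = \tr (Q *m A).
Proof.
move=> UA QU UQ; pose i1 := in_submod U (1%:M : 'M[F]_n); pose Q' := val_submod i1.
have Q'Q : Q' *m Q = Q'.
  by have /submxP[D ->] : (Q' <= U)%MS := val_submodP _; rewrite -mulmxA UQ.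
have fixQ' m (W : 'M[F]_(m, n)) : (W <= U)%MS -> W *m Q' = W.
  by move=> WU; rewrite /Q' (val_submodE i1) mulmxA -in_submodE -val_submodE in_submodK.
rewrite in_submodE -/i1 mxtrace_mulC mulmxA -val_submodE -/Q' -Q'Q.
rewrite -mulmxA mxtrace_mulC fixQ' //; apply: submx_trans UA.
exact: submxMr.
Qed.

Lemma phizC i j k : phiz i k j = - phiz i j k.
Proof. by rewrite /phiz /sum7 /=; ring. Qed.

Lemma projzE (a b i j : nat) : projz a b i j =
  3 * (kron a i * kron b j - kron a j * kron b i) - \sum_(l < 7) phiz l i j * phiz l a b.
Proof. by rewrite /projz -sum7E. Qed.

Lemma mxtrace_rotate (F : comNzRingType) n (A B C D : 'M[F]_n) :
  \tr (A *m B *m C *m D) = \tr (B *m (C *m D *m A)).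
Proof. by rewrite -!mulmxA mxtrace_mulC !mulmxA. Qed.

Lemma conj_proj_sub (F : fieldType) n (U A B Q : 'M[F]_n) :
  (Q <= U)%MS -> (U *m A <= U)%MS -> (B *m Q *m A <= U)%MS.
Proof.
move=> QU UA; rewrite -mulmxA (submx_trans (submxMl _ _)) //.
by apply: submx_trans UA; rewrite submxMr.
Qed.

Lemma conj_proj_id (F : fieldType) n (U A B Q : 'M[F]_n) :
  (U *m B <= U)%MS -> U *m Q = U -> B *m A = 1%:M -> U *m (B *m Q *m A) = U.
Proof.
move=> /submxP[D hD] UQ BA; rewrite !mulmxA hD -(mulmxA D) UQ -hD.
by rewrite -mulmxA BA mulmx1.
Qed.

Section Projection.
Variable F : numFieldType.
Local Notation e i := (delta_mx 0 i : 'rV[F]_7).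
Local Notation phi i j k := ((phiz i j k)%:~R : F) (only parsing).
Implicit Types (X g : 'M[F]_7).

(** The component of X on the matrices of the forms phi3 e_l _ _. *)
Definition cross X i j : F :=
  \sum_(l < 7) phi l i j * \sum_(a < 7) \sum_(b < 7) phi l a b * X a b.

Definition g2proj X : 'M[F]_7 :=
  \matrix_(i, j) (2^-1 * (X i j - X j i) - 6^-1 * cross X i j).

Lemma crossE X i j :
  cross X i j = \sum_(a < 7) \sum_(b < 7) X a b * \sum_(l < 7) phi l i j * phi l a b.
Proof.
rewrite /cross; under eq_bigr => l _ do rewrite mulr_sumr.
rewrite exchange_big /=; apply: eq_bigr => a _.
under eq_bigr => l _ do rewrite mulr_sumr.
rewrite exchange_big /=; apply: eq_bigr => b _.
by rewrite mulr_sumr; apply: eq_bigr => l _; ring.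
Qed.

Lemma crossC X i j : cross X j i = - cross X i j.
Proof.
rewrite /cross -sumrN; apply: eq_bigr => l _.
by rewrite phizC rmorphN mulNr.
Qed.

Lemma dphi3_sum X (i j k : 'I_7) :
  phi3 (e i *m X) (e j) (e k) + phi3 (e i) (e j *m X) (e k) + phi3 (e i) (e j) (e k *m X)
  = \sum_(c < 7) (X i c * phi c j k + X j c * phi i c k + X k c * phi i j c).
Proof.
rewrite (linear_coord (f := fun x => phi3 x _ _)) => [|*]; last exact: phi3Dl.
rewrite (linear_coord (f := fun x => phi3 _ x _)) => [|*]; last exact: phi3Dm.
rewrite (linear_coord (f := fun x => phi3 _ _ x)) => [|*]; last exact: phi3Dr.
rewrite -!big_split /=; apply: eq_bigr => c _.
by rewrite -!rowE !mxE !phi3_delta.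
Qed.

Lemma g2mx_sumP X :
  reflect (forall i j k : 'I_7, \sum_(c < 7)
     (X i c * phi c j k + X j c * phi i c k + X k c * phi i j c) = 0)
    (mxvec X <= g2mx F)%MS.
Proof.
apply: (iffP idP) => [/g2mxP h i j k|h]; first by rewrite -dphi3_sum h.
apply/sub_kermxP; rewrite mul_vec_lin /=; apply/eqP; rewrite mxvec_eq0.
apply/eqP/matrixP => i jk; case/mxvec_indexP: jk => j k.
by rewrite !mxE mxvecE !mxE dphi3_sum h.
Qed.

Lemma entryE X p q :
  X p q = \sum_(a < 7) \sum_(b < 7) X a b * (kron a p * kron b q)%:~R.
Proof.
rewrite (bigD1 p) //= (bigD1 q) //= !big1 ?addr0.
- by rewrite rmorphM /= !intr_kron !eqxx !mulr1.
- move=> a ap; rewrite big1 // => b _.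
  by rewrite rmorphM /= !intr_kron !val_eqE (negbTE ap) mul0r mulr0.
- by move=> b bq; rewrite rmorphM /= !intr_kron !val_eqE (negbTE bq) !mulr0.
Qed.

Lemma sum_entry X p (f : nat -> int) :
  \sum_(c < 7) X p c * (f c)%:~R = \sum_(a < 7) \sum_(b < 7) X a b * (kron a p * f b)%:~R.
Proof.
rewrite [RHS](bigD1 p) //= [X in _ + X]big1 ?addr0 => [|a ap].
  by apply: eq_bigr => c _; rewrite /kron eqxx mul1r.
rewrite big1 // => b _.
by rewrite rmorphM /= !intr_kron !val_eqE (negbTE ap) mul0r mulr0.
Qed.

Lemma g2proj_sub X : (mxvec (g2proj X) <= g2mx F)%MS.
Proof.
have E i j : g2proj X i j = 6^-1 * \sum_(a < 7) \sum_(b < 7) X a b * (projz a b i j)%:~R.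
  rewrite mxE crossE (entryE X i j) (entryE X j i) -sumrB !mulr_sumr -sumrB.
  apply: eq_bigr => a _; rewrite -sumrB !mulr_sumr -sumrB.
  apply: eq_bigr => b _.
  rewrite projzE rmorphB /= [(3 * _)%:~R]rmorphM rmorphB rmorph_sum /=.
  under [in RHS]eq_bigr => l _ do rewrite rmorphM.
  by field.
apply/g2mx_sumP => i j k.
transitivity (6^-1 * \sum_(a < 7) \sum_(b < 7) X a b *
    (\sum_(c < 7) (projz a b i c * phiz c j k + projz a b j c * phiz i c k
                   + projz a b k c * phiz i j c))%:~R).
  rewrite mulr_sumr; under [RHS]eq_bigr => a _.
    rewrite mulr_sumr; under eq_bigr => b _ do rewrite rmorph_sum 2!mulr_sumr.
    rewrite exchange_big; over.
  rewrite exchange_big /=; apply: eq_bigr => c _.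
  rewrite !E -!mulrA -!mulrDr !mulr_suml -!big_split mulr_sumr /=.
  apply: eq_bigr => a _; rewrite !mulr_suml -!big_split mulr_sumr /=.
  apply: eq_bigr => b _.
  move: (projz a b i c) (projz a b j c) (projz a b k c) => *.
  move: (phiz c j k) (phiz i c k) (phiz i j c) => *.
  by rewrite !rmorphD !rmorphM /=; ring.
by rewrite big1 ?mulr0 // => a _; rewrite big1 // => b _; rewrite projz_g2 mulr0.
Qed.

(** Antisymmetrizing, symmetrizing and taking traces in these equations shows
    that elements of g_2 are skew, traceless and orthogonal to the forms
    phi3 e_l _ _, that is, fixed by g2proj (see g2proj_id). *)
Lemma g2mx_key X i j : (mxvec X <= g2mx F)%MS ->
  X i j + X j i + (i == j)%:R * \tr X + cross X i j = 0.
Proof.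
move/g2mx_sumP => h; have n2 : 2 != 0 :> F by rewrite pnatr_eq0.
apply: (mulfI n2); rewrite mulr0.
transitivity (\sum_(p < 7) \sum_(q < 7) phi j p q * (\sum_(c < 7)
     (X i c * phi c p q + X p c * phi i c q + X q c * phi i p c))); last first.
  by rewrite big1 // => p _; rewrite big1 // => q _; rewrite h mulr0.
transitivity (\sum_(a < 7) \sum_(b < 7) X a b *
   (2 * (kron a i * kron b j + kron a j * kron b i + kron i j * kron a b
         + \sum_(l < 7) phiz l i j * phiz l a b))%:~R).
  have trE : (i == j)%:R * \tr X = \sum_(a < 7) \sum_(b < 7) X a b * (kron i j * kron a b)%:~R.
    rewrite mulr_sumr; apply: eq_bigr => a _; rewrite (bigD1 a) //= big1 ?addr0.
      by rewrite rmorphM /= !intr_kron eqxx mulr1 mulrC val_eqE.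
    move=> b ba; have -> : kron a b = 0 by rewrite /kron eq_sym val_eqE (negbTE ba).
    by rewrite !mulr0.
  rewrite trE crossE [in X in X + _](entryE X i j) [in X in X + _](entryE X j i).
  rewrite -!big_split mulr_sumr /=; apply: eq_bigr => a _.
  rewrite -!big_split mulr_sumr /=; apply: eq_bigr => b _.
  have -> : \sum_(l < 7) phi l i j * phi l a b = (\sum_(l < 7) phiz l i j * phiz l a b)%:~R.
    by rewrite rmorph_sum; apply: eq_bigr => l _; rewrite rmorphM.
  move: (\sum_(l < 7) _) (kron a i) (kron b j) (kron a j) (kron b i) (kron i j) (kron a b) => *.
  by rewrite !(rmorphM, rmorphD, rmorph1) /=; ring.
under eq_bigr => a _ do under eq_bigr => b _ do rewrite -phiz_key rmorph_sum mulr_sumr.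
under eq_bigr => a _ do rewrite exchange_big /=.
rewrite exchange_big /=; apply: eq_bigr => p _.
under eq_bigr => a _ do under eq_bigr => b _ do rewrite rmorph_sum mulr_sumr.
under eq_bigr => a _ do rewrite exchange_big /=.
rewrite exchange_big /=; apply: eq_bigr => q _.
rewrite !big_split /= (sum_entry X i (fun c => phiz c p q)).
rewrite (sum_entry X p (fun c => phiz i c q)) (sum_entry X q (fun c => phiz i p c)).
rewrite -!big_split mulr_sumr /=; apply: eq_bigr => a _.
rewrite -!big_split mulr_sumr /=; apply: eq_bigr => b _.
move: (phiz j p q) (phiz b p q) (phiz i b q) (phiz i p b) => *.
move: (kron a i) (kron a p) (kron a q) => *.
by rewrite !(rmorphM, rmorphD) /=; ring.
Qed.

Lemma g2proj_id X : (mxvec X <= g2mx F)%MS -> g2proj X = X.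
Proof.
move=> Xg; have key i j := g2mx_key i j Xg.
have n2 : 2 != 0 :> F by rewrite pnatr_eq0.
have tr0 : \tr X = 0.
  have n9 : 9 != 0 :> F by rewrite pnatr_eq0.
  apply: (mulfI n9); rewrite mulr0.
  have : \sum_i (X i i + X i i + (i == i)%:R * \tr X + cross X i i) = 0.
    by rewrite big1 // => i _; exact: key.
  under eq_bigr => i _.
    have -> : cross X i i = 0.
      by apply: (mulfI n2); rewrite mulr0 mulr_natl mulr2n {1}crossC addNr.
    rewrite eqxx mul1r addr0; over.
  rewrite !big_split /= -/(mxtrace X) sumr_const card_ord => <-.
  by rewrite -[in RHS]mulr_natl; ring.
have skew i j : X j i = - X i j /\ cross X i j = 0.
  have := key i j; have := key j i; rewrite tr0 !mulr0 (crossC X i j) !addr0 => k1 k2.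
  have s : X i j + X j i = 0.
    apply: (mulfI n2); rewrite mulr0 -[RHS]addr0 -{1}k1 -k2; ring.
  split; first by apply/eqP; rewrite -addr_eq0 addrC s.
  by rewrite s add0r in k2.
apply/matrixP => i j; have [s c] := skew i j.
by rewrite mxE c s; field.
Qed.

Lemma g2proj_linear : linear g2proj.
Proof.
move=> a X Y; apply/matrixP => i j; rewrite !mxE !crossE.
have -> : \sum_(a0 < 7) \sum_(b < 7) (a *: X + Y) a0 b * \sum_(l < 7) phi l i j * phi l a0 b =
  a * (\sum_(a0 < 7) \sum_(b < 7) X a0 b * \sum_(l < 7) phi l i j * phi l a0 b)
  + \sum_(a0 < 7) \sum_(b < 7) Y a0 b * \sum_(l < 7) phi l i j * phi l a0 b.
  rewrite mulr_sumr -big_split; apply: eq_bigr => p _ /=.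
  rewrite mulr_sumr -big_split; apply: eq_bigr => q _ /=.
  by rewrite !mxE mulrDl mulrA.
ring.
Qed.

HB.instance Definition _ :=
  GRing.isSemilinear.Build F _ _ _ g2proj
    (GRing.semilinear_linear g2proj_linear).

Definition g2projmx : 'M[F]_(7 * 7) := lin_mx g2proj.

Lemma g2projmx_sub : (g2projmx <= g2mx F)%MS.
Proof.
apply/row_subP => i; rewrite rowE -[delta_mx 0 i]vec_mxK mul_vec_lin.
exact: g2proj_sub.
Qed.

Lemma g2mx_proj : g2mx F *m g2projmx = g2mx F.
Proof.
apply/row_matrixP => i; rewrite row_mul -[row i _]vec_mxK mul_vec_lin /=.
by rewrite g2proj_id // vec_mxK row_sub.
Qed.

Definition conj_lin g := lin_mulmx (invmx g) *m lin_mulmxr g.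

Lemma conj_linM g h : g \in unitmx -> h \in unitmx ->
  conj_lin (g *m h) = conj_lin g *m conj_lin h.
Proof. exact: conj_mxM. Qed.

Lemma conj_lin1 : conj_lin 1%:M = 1%:M.
Proof.
apply/row_matrixP => i; rewrite !rowE mulmx1 -[delta_mx 0 i]vec_mxK.
by rewrite /conj_lin mulmxA !mul_vec_lin /= invmx1 mul1mx mulmx1.
Qed.

Lemma mxvec_conj g X : mxvec X *m conj_lin g = mxvec (invmx g *m X *m g).
Proof. by rewrite /conj_lin mulmxA !mul_vec_lin. Qed.

Lemma mxtrace_lin_vec (B : 'M[F]_(7 * 7)) :
  \tr B = \sum_i \sum_j vec_mx (mxvec (delta_mx i j) *m B) i j.
Proof.
rewrite /mxtrace pair_bigA /=.
rewrite (reindex _ (curry_mxvec_bij 7 7)) /=; apply: eq_bigr => -[i j] _ /=.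
by rewrite mxvec_delta -rowE !mxE.
Qed.

(** The exterior square is the sum of g_2 and of the span of the forms
    phi3 e_l _ _.  For an orthogonal g preserving phi3 the latter is a copy of
    the 7-dimensional representation, which gives the term - \tr g. *)
Lemma mxtrace_proj_conj g :
    g *m g^T = 1%:M ->
    (forall x y z, phi3 (x *m g) (y *m g) (z *m g) = phi3 x y z) ->
  \tr (g2projmx *m conj_lin g) = 2^-1 * (\tr g ^+ 2 - \tr (g *m g)) - \tr g.
Proof.
move=> gO gphi.
have gT : invmx g = g^T.
  have gu : g \in unitmx by apply: (proj1 (mulmx1_unit gO)).
  by rewrite -[LHS]mulmx1 -gO mulmxA mulVmx // mul1mx.
have E (i j : 'I_7) : vec_mx (mxvec (delta_mx i j) *m (g2projmx *m conj_lin g)) i j =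
   2^-1 * (g i i * g j j - g i j * g j i)
   - 6^-1 * \sum_(k < 7) \sum_(l < 7) g l k * (phi k i j * phi l i j).
  rewrite mulmxA mul_vec_lin mxvec_conj mxvecK gT /=.
  have -> : g2proj (delta_mx i j) = 2^-1 *: (delta_mx i j - delta_mx j i)
      - 6^-1 *: \sum_(l < 7) phi l i j *: \matrix_(a, b) phi l a b.
    apply/matrixP => a b; rewrite !mxE summxE; congr (_ * (_ - _) - _ * _).
      by rewrite andbC.
    rewrite /cross; apply: eq_bigr => l _; rewrite !mxE mulrC; congr (_ * _).
    rewrite (bigD1 i) //= (bigD1 j) //= !big1 ?addr0.
    - by rewrite !mxE !eqxx mulr1.
    - move=> p pi; rewrite big1 // => q _; by rewrite !mxE (negbTE pi) mulr0.
    - by move=> q qj; rewrite !mxE (negbTE qj) andbF mulr0.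
  rewrite !(mulmxBr, mulmxBl) -!(scalemxAl, scalemxAr) !(mulmxBr, mulmxBl).
  have dE p q r s : (g^T *m delta_mx p q *m g) r s = g p r * g q s.
    rewrite mxE (bigD1 q) //= big1 ?addr0 => [|t tq].
      rewrite mxE (bigD1 p) //= big1 ?addr0 => [|t tp]; last by rewrite !mxE (negbTE tp) mulr0.
      by rewrite !mxE !eqxx mulr1.
    by rewrite mxE big1 ?mul0r // => u _; rewrite !mxE (negbTE tq) andbF mulr0.
  have lc (A B D : 'M[F]_7) a b : (a *: (A - B) - b *: D) i j = a * (A i j - B i j) - b * D i j.
    by rewrite !mxE.
  rewrite lc !dE mulmx_sumr mulmx_suml summxE.
  congr (_ * (_ - _) - _ * _); first by rewrite mulrC.
  rewrite exchange_big /=; apply: eq_bigr => l _.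
  rewrite -scalemxAr -scalemxAl mxE.
  rewrite -[RHS]/(\sum_(k < 7) g l k * (phi k i j * phi l i j)).
  transitivity (phi l i j * phi3 (e l *m g) (e i) (e j)).
    congr (_ * _).
    have gTK (x : 'rV[F]_7) : x = (x *m g^T) *m g by rewrite -mulmxA (mulmx1C gO) mulmx1.
    rewrite (gTK (e i)) (gTK (e j)) gphi phi3_coord (bigD1 l) //= [X in _ = _ + X]big1 ?addr0.
      rewrite mxE exchange_big; apply: eq_bigr => a _ /=.
      rewrite mxE mulr_suml; apply: eq_bigr => b _.
      rewrite phi3_delta -!rowE !mxE !eqxx mul1r; ring.
    by move=> k kl; rewrite big1 // => a _; rewrite big1 // => b _; rewrite !mxE (negbTE kl) !mul0r.
  have -> : phi3 (e l *m g) (e i) (e j) = \sum_(k < 7) g l k * phi k i j.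
    rewrite (linear_coord (f := fun w => phi3 w (e i) (e j))) => [|*]; last exact: phi3Dl.
    by apply: eq_bigr => k _; rewrite phi3_delta -rowE mxE.
  by rewrite mulr_sumr; apply: eq_bigr => k _; ring.
rewrite mxtrace_lin_vec; under eq_bigr => i _ do under eq_bigr => j _ do rewrite E.
have phi2 (k l : 'I_7) : \sum_(i < 7) \sum_(j < 7) phi k i j * phi l i j = 6 * (k == l)%:R.
  transitivity (((6 * kron k l)%R)%:~R : F); last by rewrite rmorphM rmorph_nat /= intr_kron.
  rewrite -phiz_contract2 rmorph_sum; apply: eq_bigr => i _.
  by rewrite rmorph_sum; apply: eq_bigr => j _; rewrite rmorphM.
under eq_bigr => i _ do rewrite sumrB -!mulr_sumr sumrB.
rewrite sumrB -!mulr_sumr sumrB; congr (_ * (_ - _) - _).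
- by rewrite expr2 /mxtrace mulr_suml; apply: eq_bigr => i _; rewrite -?mulr_sumr.
- by apply: eq_bigr => i _; rewrite mxE.
under eq_bigr => i _.
  rewrite exchange_big /=; under eq_bigr => k _ do rewrite exchange_big /=; over.
rewrite exchange_big /=; apply: (canLR (mulKf _)); first by rewrite pnatr_eq0.
rewrite /mxtrace mulr_sumr; apply: eq_bigr => k _.
rewrite exchange_big /= (bigD1 k) //= [X in _ + X]big1 ?addr0 => [|l lk].
  under eq_bigr => i _ do rewrite -mulr_sumr.
  by rewrite -mulr_sumr phi2 eqxx mulr1 mulrC.
under eq_bigr => i _ do rewrite -mulr_sumr.
by rewrite -mulr_sumr phi2 eq_sym (negbTE lk) !mulr0.
Qed.

(** A matrix that scales phi3 normalizes the stabilizer of phi3, hence its Lie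
    algebra. *)
Lemma conj_lin_g2 P c : P \in unitmx -> c != 0 ->
    (forall x y z, phi3 (x *m P) (y *m P) (z *m P) = c * phi3 x y z) ->
  (g2mx F *m conj_lin P <= g2mx F)%MS.
Proof.
move=> uP c0 hP; apply/row_subP => i; rewrite row_mul -[row i _]vec_mxK.
set X := vec_mx _; have /g2mxP hX : (mxvec X <= g2mx F)%MS.
  by rewrite /X vec_mxK row_sub.
rewrite mxvec_conj; apply/g2mxP => x y z.
pose V := invmx P; rewrite !mulmxA -/V.
have E1 u v w : phi3 (u *m P) v w = c * phi3 u (v *m V) (w *m V).
  by rewrite -hP !(mulmxKV uP).
have E2 u v w : phi3 v (u *m P) w = c * phi3 (v *m V) u (w *m V).
  by rewrite -hP !(mulmxKV uP).
have E3 u v w : phi3 v w (u *m P) = c * phi3 (v *m V) (w *m V) u.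
  by rewrite -hP !(mulmxKV uP).
by rewrite E1 E2 E3 -!mulrDr hX mulr0.
Qed.

End Projection.

(** The orthogonality required by mxtrace_proj_conj will be known in a basis of
    weight vectors only, where group elements are signed permutations.  The
    change of basis P is not orthogonal but scales phi3, so it preserves g_2 and
    the trace can be computed after conjugation by P. *)
Lemma mxtrace_rho2 (R : realType) (a : G2 R) (P : 'M[R[i]]_7) (c : R[i]) :
    P \in unitmx -> c != 0 ->
    (forall x y z, phi3 (x *m P) (y *m P) (z *m P) = c * phi3 x y z) ->
    let g := P *m rho1 a *m invmx P in g *m g^T = 1%:M ->
  \tr (rho2 a) = 2^-1 * (\tr (rho1 a) ^+ 2 - \tr (rho1 a *m rho1 a)) - \tr (rho1 a).
Proof.
move=> uP c0 hP g gO.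
have uV : invmx P \in unitmx by rewrite unitmx_inv.
have hV x y z : phi3 (x *m invmx P) (y *m invmx P) (z *m invmx P) = c^-1 * phi3 x y z.
  by apply: (mulfI c0); rewrite -hP !(mulmxKV uP) mulrA divff // mul1r.
have gphi x y z : phi3 (x *m g) (y *m g) (z *m g) = phi3 x y z.
  by rewrite /g !mulmxA hV rho1_phi3 hP mulKf.
have gconj : conj_lin g = conj_lin P *m conj_lin (rho1 a) *m conj_lin (invmx P).
  have ua := rho1_unit a; have uPa : P *m rho1 a \in unitmx by rewrite unitmx_mul uP.
  by rewrite /g (conj_linM uPa uV) (conj_linM uP ua).
have aS : (g2mx R[i] *m conj_lin (rho1 a) <= g2mx R[i])%MS.
  apply: (conj_lin_g2 (c := 1)); rewrite ?rho1_unit ?oner_eq0 // => x y z.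
  by rewrite rho1_phi3 mul1r.
have PS := conj_lin_g2 uP c0 hP.
have VS : (g2mx R[i] *m conj_lin (invmx P) <= g2mx R[i])%MS.
  by apply: (conj_lin_g2 uV _ hV); rewrite invr_neq0.
have PV : conj_lin P *m conj_lin (invmx P) = 1%:M.
  by rewrite -(conj_linM uP uV) mulmxV // conj_lin1.
have VP := mulmx1C PV.
pose Q := conj_lin (invmx P) *m g2projmx _ *m conj_lin P.
rewrite /rho2 (mxtrace_restr (Q := Q) aS).
- have trC (A : 'M[R[i]]_7) : \tr (P *m A *m invmx P) = \tr A.
    by rewrite mxtrace_mulC mulmxA mulVmx // mul1mx.
  have gg : g *m g = P *m (rho1 a *m rho1 a) *m invmx P.
    by rewrite /g !mulmxA mulmxKV.
  have := mxtrace_proj_conj gO gphi; rewrite gg {2 3}/g !trC => <-.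
  rewrite gconj; exact: mxtrace_rotate.
- exact: conj_proj_sub (g2projmx_sub _) PS.
- exact: conj_proj_id VS (g2mx_proj _) VP.
Qed.

(** * The normal subgroup and its automorphisms *)

(** A parametrization of a normal subgroup 2^3 by row vectors.  The last three
    conditions say that this subgroup is self-centralizing, normal, and that
    the group induces all its linear automorphisms. *)
Definition is_frame (gT : finGroupType) (E : 'rV['F_2]_3 -> gT) : Prop :=
  [/\ injective E,
      {morph E : u v / u + v >-> (u * v)%g},
      forall x, (forall w, commute x (E w)) -> exists w, x = E w,
      forall g w, exists w', (E w ^ g)%g = E w' &
      forall A, A \in unitmx -> exists g, forall w, (E w ^ g)%g = E (w *m A)].

Lemma card_rV23 : #|{: 'rV['F_2]_3}| = 8.
Proof. by rewrite card_mx card_Fp. Qed.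

Lemma nonsplit_frame (gT : finGroupType) :
  is_nonsplit_2_3_PSL27 gT -> exists E : 'rV['F_2]_3 -> gT, is_frame E.
Proof.
case=> N [[nsN _] [abN cN] _ [CN autN]].
have : [set: 'rV['F_2]_3] \isog N.
  by rewrite (isog_abelem_card _ (mx_Fp_abelem 1 3 _)) // abN cN cardsT card_rV23.
case/isogP => f injf fN; exists f.
have fI : injective f by move=> u v /(injmP injf); apply; rewrite inE.
have fM : {morph f : u v / u + v >-> (u * v)%g}.
  by move=> u v; rewrite -morphM ?inE.
have fin w : f w \in N by rewrite -fN mem_morphim ?inE.
have fsurj x : x \in N -> exists w, x = f w.
  by rewrite -fN => /morphimP[w _ _ ->]; exists w.
have nN g : g \in 'N(N)%g by rewrite (fintype.subsetP (normal_norm nsN)) ?inE.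
split=> // [x cx|g w|A uA].
- apply: (fsurj); rewrite -CN !inE; apply/centP => y /fsurj[w ->].
  exact: cx.
- by apply: (fsurj); rewrite memJ_norm.
pose h x := f (invm injf x *m A).
have hE w : h (f w) = f (w *m A) by rewrite /h invmE ?inE.
have hM : morphic N h.
  apply/morphicP => _ _ /fsurj[u ->] /fsurj[v ->].
  by rewrite -fM !hE mulmxDl fM.
have hinj : ('injm (morphm hM))%g.
  apply/injmP => _ _ /fsurj[u ->] /fsurj[v ->].
  rewrite -[_ (f u)]/(h (f u)) -[_ (f v)]/(h (f v)) !hE => /fI.
  by move=> /(congr1 (mulmx^~ (invmx A))); rewrite !mulmxK // => ->.
have hN : (morphm hM @* N)%g = N.
  apply/eqP; rewrite eqEcard card_injm // leqnn andbT.
  apply/fintype.subsetP => _ /morphimP[_ _ /fsurj[u ->] ->].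
  by rewrite -[_ (f u)]/(h (f u)) hE.
have : aut hinj hN \in (conj_aut N @* [set: gT])%g by rewrite autN Aut_aut.
case/morphimP => g _ _ eg; exists g => w.
by rewrite -(norm_conj_autE (nN g) (fin w)) -eg autE // -[_ (f w)]/(h (f w)) hE.
Qed.

(** Multiplying the elements of 2^3 by lifts of the elements of GL(3, 2) gives
    8 * 168 distinct elements. *)
Lemma frame_card (gT : finGroupType) (E : 'rV['F_2]_3 -> gT) :
  is_frame E -> (1344 <= #|gT|)%N.
Proof.
case=> Einj EM _ _ Ereal.
have real A : exists g, forall w, (E w ^ g)%g = E (w *m GLval (A : {'GL_3['F_2]})).
  by apply: Ereal; exact: valP A.
pose gA A := sval (cid (real A)).
have gAE A w : (E w ^ gA A)%g = E (w *m GLval A) by exact: (svalP (cid (real A))).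
pose F (p : {'GL_3['F_2]} * 'rV['F_2]_3) : gT := (E p.2 * gA p.1)%g.
have Finj : injective F.
  move=> [A u] [B v]; rewrite /F /= => e.
  have AB : A = B.
    apply/val_inj/row_matrixP => i; rewrite !rowE; apply: Einj; rewrite -!gAE.
    have cE x y : (E x ^ E y)%g = E x.
      by rewrite conjgE -EM addrC EM mulKg.
    transitivity (E (delta_mx 0 i) ^ (E u * gA A))%g; first by rewrite conjgM cE.
    by rewrite e conjgM cE.
  by move: e; rewrite AB => /mulIg /Einj ->.
have := leq_card F Finj; rewrite card_prod card_rV23.
suff -> : #|{: {'GL_3['F_2]}}| = 168 by [].
rewrite -cardsT; have -> : #|[set: {'GL_3['F_2]}]| = #|'GL_3['F_2]%g| by [].
rewrite card_GL // card_Fp //.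
by rewrite big_nat_recr //= big_nat_recr //= big_nat1.
Qed.

(** * The Singer cycle and characters of the normal subgroup *)

Definition bit3 := (bool * bool * bool)%type.
Definition xor3 (x y : bit3) : bit3 :=
  (x.1.1 (+) y.1.1, x.1.2 (+) y.1.2, x.2 (+) y.2).
(** The coordinates of S ^ i on 1, S, S ^ 2 when S ^ 3 = S + 1 in characteristic
    2.  The lines {i, i + 1, i + 3} of phi3 are then the triples of powers of S
    that add up to zero, so phi3 and S carry the same Fano plane. *)
Definition singer_bits (i : nat) : bit3 :=
  nth (false, false, false)
    [:: (true, false, false); (false, true, false); (false, false, true);
        (true, true, false); (false, true, true); (true, true, true);
        (true, false, true)] i.

(** Either phi3 vanishes on (i, j, k) and the sum of the three powers of S is
    again a power of S, hence invertible, or (i, j, k) is an arrangement of a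
    line {a, a + 1, a + 3} and phi3 takes its sign as value. *)
Definition fano_case (i j k : nat) : bool :=
  if phiz i j k == 0 then
    has (fun m => xor3 (xor3 (singer_bits i) (singer_bits j)) (singer_bits k)
                  == singer_bits m) (iota 0 7)
  else has (fun a => let b := ((a + 1) %% 7)%N in let c := ((a + 3) %% 7)%N in
     [|| [&& i == a, j == b, k == c & phiz i j k == 1],
         [&& i == b, j == c, k == a & phiz i j k == 1],
         [&& i == c, j == a, k == b & phiz i j k == 1],
         [&& i == b, j == a, k == c & phiz i j k == - 1],
         [&& i == a, j == c, k == b & phiz i j k == - 1] |
         [&& i == c, j == b, k == a & phiz i j k == - 1]]) (iota 0 7).

Lemma fano_caseP (i j k : 'I_7) : fano_case i j k.
Proof.
have h : all (fun i => all (fun j => all (fun k => fano_case i j k)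
  (iota 0 7)) (iota 0 7)) (iota 0 7) by vm_compute.
exact: (all7P (all7P (all7P h i) j)).
Qed.

Lemma singer_neq (i j : 'I_7) : (i == j) || has (fun m =>
  xor3 (singer_bits i) (singer_bits j) == singer_bits m) (iota 0 7).
Proof.
have h : all (fun i => all (fun j => (i == j) || has (fun m =>
  xor3 (singer_bits i) (singer_bits j) == singer_bits m) (iota 0 7))
  (iota 0 7)) (iota 0 7) by vm_compute.
exact: (all7P (all7P h i)).
Qed.

Lemma F2_eq01 (a : 'F_2) : a = 0 \/ a = 1.
Proof.
by case: a => [[|[|//]]] p; [left|right]; apply: val_inj.
Qed.

Lemma mx2_char2 m n (A : 'M['F_2]_(m, n)) : A + A = 0.
Proof.
apply/matrixP => i j; rewrite !mxE.
by case: (F2_eq01 (A i j)) => ->; apply: val_inj.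
Qed.

Lemma singer_exists : exists S : 'M['F_2]_3, S ^+ 3 = S + 1.
Proof.
(* The companion matrix of 'X^3 - 'X - 1. *)
exists (\matrix_(i, j) ([|| (i == 0) && (j == 1), (i == 1) && (j == 2%:R)
                          | (i == 2%:R) && (j != 2%:R)])%:R).
apply/matrixP => i j; rewrite exprS exprS expr1.
case: i => [[|[|[|//]]]] pi; case: j => [[|[|[|//]]]] pj;
 rewrite !(mxE, big_ord_recl, big_ord0); apply: val_inj; by vm_compute.
Qed.

Section Singer.
Variable S : 'M['F_2]_3.
Hypothesis S3 : S ^+ 3 = S + 1.

Definition bitmx (x : bit3) : 'M['F_2]_3 :=
  1 *+ x.1.1 + S *+ x.1.2 + S ^+ 2 *+ x.2.

Lemma bitmxD x y : bitmx (xor3 x y) = bitmx x + bitmx y.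
Proof.
have b (X : 'M['F_2]_3) (a c : bool) : X *+ (a (+) c) = X *+ a + X *+ c.
  by case: a; case: c; rewrite /= ?addr0 ?add0r // mx2_char2.
by rewrite /bitmx /= !b (addrACA (1 *+ _) _ (S *+ _)); exact: addrACA.
Qed.

Lemma bitmx_exp i : (i < 7)%N -> bitmx (singer_bits i) = S ^+ i.
Proof.
have S4 : S ^+ 4 = S + S ^+ 2 by rewrite exprS S3 mulrDr mulr1 -expr2 addrC.
have S5 : S ^+ 5 = 1 + S + S ^+ 2.
  by rewrite exprS S4 mulrDr -expr2 -exprS S3 addrC [S + 1]addrC.
have S6 : S ^+ 6 = 1 + S ^+ 2.
  rewrite exprS S5 !mulrDr mulr1 -expr2 -exprS S3 addrC addrA addrC.
  by rewrite [S + 1 + S]addrAC mx2_char2 add0r addrC.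
rewrite /bitmx; case: i => [|[|[|[|[|[|[|//]]]]]]] _ /=.
- by rewrite !addr0.
- by rewrite add0r addr0.
- by rewrite !add0r.
- by rewrite addr0 S3 addrC.
- by rewrite add0r S4.
- by rewrite S5.
- by rewrite addr0 S6.
Qed.

Lemma singer_exp7 : S ^+ 7 = 1.
Proof.
rewrite exprS -(bitmx_exp (i := 6)) // /bitmx /= addr0 mulrDr mulr1 -exprS S3.
by rewrite addrA mx2_char2 add0r.
Qed.

Lemma singer_exp_neq0 n (u : 'cV['F_2]_3) : u != 0 -> S ^+ n *m u != 0.
Proof.
have SS : S ^+ 6 *m S = 1 by rewrite -[LHS]/(S ^+ 6 * S) -exprSr singer_exp7.
move=> u0; elim: n => [|n]; first by rewrite expr0 mul1mx.
apply: contraNneq; rewrite exprS -mulmxA => /(congr1 (mulmx (S ^+ 6))).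
by rewrite mulmxA SS mul1mx mulmx0 => ->.
Qed.

Lemma singer_add_neq0 (i j : 'I_7) (u : 'cV['F_2]_3) :
  u != 0 -> i != j -> S ^+ i *m u + S ^+ j *m u != 0.
Proof.
move=> u0 ij; have := singer_neq i j; rewrite (negbTE ij) orFb.
case/hasP => m; rewrite mem_iota add0n => /andP[_ m7] /eqP e.
rewrite -mulmxDl -!bitmx_exp // -bitmxD e bitmx_exp //.
exact: singer_exp_neq0.
Qed.

Lemma singer_add3_neq0 (i j k : 'I_7) (u : 'cV['F_2]_3) :
  u != 0 -> phiz i j k = 0 -> S ^+ i *m u + S ^+ j *m u + S ^+ k *m u != 0.
Proof.
move=> u0 z; have := fano_caseP i j k; rewrite /fano_case z eqxx.
case/hasP => m; rewrite mem_iota add0n => /andP[_ m7] /eqP e.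
rewrite -!mulmxDl -!bitmx_exp // -!bitmxD e bitmx_exp //.
exact: singer_exp_neq0.
Qed.

End Singer.

Section SignCharacters.
Variable R : numFieldType.

Definition sg (a : 'F_2) : R := (-1) ^+ (a : nat).

Lemma sgD a b : sg (a + b) = sg a * sg b.
Proof.
case: (F2_eq01 a) => ->; case: (F2_eq01 b) => ->;
by rewrite /sg ?addr0 ?add0r ?mulr1 ?mul1r // /= ?expr0 ?expr1 ?mulr1 ?mul1r ?mulrNN ?mulr1.
Qed.

Lemma sgK a : sg a * sg a = 1.
Proof. by rewrite -sgD; case: (F2_eq01 a) => ->. Qed.

(** Translation by x0 changes the sign of every term. *)
Lemma sum_sg (V : finZmodType) (l : V -> 'F_2) (x0 : V) :
  (forall x, l (x + x0) = l x + 1) -> \sum_x sg (l x) = 0.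
Proof.
move=> l1; have e : \sum_x sg (l x) = - \sum_x sg (l x).
  rewrite -sumrN (reindex_inj (addIr x0)); apply: eq_bigr => x _.
  by rewrite l1 sgD /sg expr1 mulrN1.
by apply/eqP; rewrite -eqNr eq_sym; apply/eqP.
Qed.

Definition pair2 (w : 'rV['F_2]_3) (u : 'cV['F_2]_3) : 'F_2 := (w *m u) 0 0.

Lemma pair2Dl w w' u : pair2 (w + w') u = pair2 w u + pair2 w' u.
Proof. by rewrite /pair2 mulmxDl mxE. Qed.
Lemma pair2Dr w u u' : pair2 w (u + u') = pair2 w u + pair2 w u'.
Proof. by rewrite /pair2 mulmxDr mxE. Qed.

Lemma pair2_witness (u : 'cV['F_2]_3) : u != 0 -> exists w, pair2 w u = 1.
Proof.
case/cV0Pn => i ui; exists (delta_mx 0 i); rewrite /pair2 -rowE mxE.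
by case: (F2_eq01 (u i 0)) ui => ->; rewrite ?eqxx.
Qed.

Lemma pair2_witnessl (w : 'rV['F_2]_3) : w != 0 -> exists u, pair2 w u = 1.
Proof.
case/rV0Pn => i wi; exists (delta_mx i 0); rewrite /pair2 -colE mxE.
by case: (F2_eq01 (w 0 i)) wi => ->; rewrite ?eqxx.
Qed.

Lemma sum_sg_row (u : 'cV['F_2]_3) :
  \sum_w sg (pair2 w u) = if u == 0 then 8 else 0.
Proof.
case: eqVneq => [->|u0].
  under eq_bigr => w _ do rewrite /pair2 mulmx0 mxE /sg expr0.
  by rewrite sumr_const cardT -cardE card_rV23.
have [w0 hw] := pair2_witness u0.
by apply: (sum_sg (x0 := w0)) => w; rewrite pair2Dl hw.
Qed.

Lemma sum_sg_col (w : 'rV['F_2]_3) :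
  \sum_u sg (pair2 w u) = if w == 0 then 8 else 0.
Proof.
case: eqVneq => [->|w0].
  under eq_bigr => u _ do rewrite /pair2 mul0mx mxE /sg expr0.
  by rewrite sumr_const cardT -cardE card_mx card_Fp.
have [u0 hu] := pair2_witnessl w0.
by apply: (sum_sg (x0 := u0)) => u; rewrite pair2Dr hu.
Qed.

End SignCharacters.

(** * A basis of weight vectors *)

Section MonomialBasis.
Variables (R : realType) (gT : finGroupType) (iota : {multiplicative gT -> G2 R}).
Variable E : 'rV['F_2]_3 -> gT.
Hypothesis hE : is_frame E.
Hypothesis iota_inj : injective iota.
Local Notation e i := (delta_mx 0 i : 'rV[R]_7).

Definition g2val (x : gT) : 'M[R]_7 := val (iota x).

Lemma g2valM x y : g2val (x * y)%g = g2val x *m g2val y.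
Proof. by rewrite /g2val gmulfM. Qed.

Lemma g2val1 : g2val 1%g = 1%:M.
Proof.
have i1 : iota 1%g = 1%g by apply: (mulgI (iota 1%g)); rewrite -gmulfM !mulg1.
by rewrite /g2val i1.
Qed.

Lemma g2val_inj : injective g2val.
Proof. by move=> x y /val_inj /iota_inj. Qed.

Lemma g2val_unit x : g2val x \in unitmx.
Proof. by have /andP[] := valP (iota x). Qed.

Lemma g2val_phi3 x u v w :
  phi3 (u *m g2val x) (v *m g2val x) (w *m g2val x) = phi3 u v w.
Proof. by have /andP[_ /asboolP h] := valP (iota x); exact: h. Qed.

Lemma frame0 : E 0 = 1%g.
Proof. by case: hE => _ EM _ _ _; apply: (mulgI (E 0)); rewrite -EM addr0 mulg1. Qed.

Local Notation rho w := (g2val (E w)).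

Lemma rhoD w w' : rho (w + w') = rho w *m rho w'.
Proof. by case: hE => _ EM _ _ _; rewrite EM g2valM. Qed.

(** v is a weight vector of the subgroup 2^3; weights are column vectors, u
    standing for the character w |-> (-1) ^ (w u). *)
Definition eigenchar (u : 'cV['F_2]_3) (v : 'rV[R]_7) : Prop :=
  forall w, v *m rho w = sg R (pair2 w u) *: v.

(** Eight times the projection on the weight space of u. *)
Definition charproj (u : 'cV['F_2]_3) : 'M[R]_7 :=
  \sum_w sg R (pair2 w u) *: rho w.

Lemma charproj_eigen u w : charproj u *m rho w = sg R (pair2 w u) *: charproj u.
Proof.
rewrite /charproj mulmx_suml scaler_sumr [RHS](reindex_inj (addIr w)).
apply: eq_bigr => w' _ /=.
by rewrite -scalemxAl -rhoD scalerA pair2Dl sgD mulrCA sgK mulr1.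
Qed.

Lemma eigenchar_proj u u' v : eigenchar u v ->
  v *m charproj u' = (if u + u' == 0 then 8 else 0) *: v.
Proof.
move=> hv; rewrite /charproj mulmx_sumr -(sum_sg_row R) scaler_suml.
apply: eq_bigr => w _.
by rewrite -scalemxAr hv scalerA pair2Dr sgD mulrC.
Qed.

(** If the only weight were 0 then the subgroup 2^3 would act trivially. *)
Lemma eigenchar_exists : exists u v, [/\ u != 0, v != 0 & eigenchar u v].
Proof.
have [/existsP[u /andP[u0 pu]]|/existsPn h] := boolP [exists u, (u != 0) && (charproj u != 0)].
  have /rowV0Pn[v] : charproj u != 0 by [].
  move=> /submxP[D ->] v0; exists u, (D *m charproj u); split=> // w.
  by rewrite -mulmxA charproj_eigen -scalemxAr.
have p0 u : u != 0 -> charproj u = 0.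
  by move=> u0; have := h u; rewrite u0 /= negbK => /eqP.
have sum8 : charproj 0 = 8%:M.
  transitivity (\sum_u charproj u).
    by rewrite (bigD1 0) //= big1 ?addr0.
  rewrite /charproj exchange_big /=.
  under eq_bigr => w _ do rewrite -scaler_suml sum_sg_col.
  rewrite (bigD1 0) //= eqxx big1 ?addr0 => [|w /negbTE ->]; last by rewrite scale0r.
  by rewrite frame0 g2val1 scalemx1.
have := charproj_eigen 0 (delta_mx 0 0).
rewrite sum8 /pair2 mulmx0 mxE /sg expr0 scale1r mul_scalar_mx -scalemx1.
have n8 : (8 : R) != 0 by rewrite pnatr_eq0.
move=> /(scalerI n8); rewrite -g2val1 => /g2val_inj; rewrite -frame0.
case: hE => Einj _ _ _ _ /Einj /rowP /(_ 0); rewrite !mxE eqxx => /eqP.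
by rewrite oner_eq0.
Qed.

(** The basis is the orbit of a weight vector v under the powers of h ^ -1, where
    h lifts a Singer cycle S; its weights S ^ n u are the seven nonzero ones.
    Off the lines of the Fano plane some element of the subgroup 2^3 changes
    the sign of phi3 on three basis vectors, which is therefore 0; on the seven
    lines phi3 takes the same value c because h permutes them cyclically.  The
    group permutes the weight spaces, which are lines, so it acts by monomial
    matrices. *)
Lemma monomial_basis : exists (P : 'M[R]_7) (c : R),
  [/\ P \in unitmx, c != 0,
      forall x y z, phi3 (x *m P) (y *m P) (z *m P) = c * phi3 x y z &
      forall (x : gT) i j j', let M := P *m g2val x *m invmx P in
        M i j != 0 -> M i j' != 0 -> j = j'].
Proof.
have [Einj EM Ecent Enorm Ereal] := hE.
have [S S3] := singer_exists.
have Su : S \in unitmx.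
  have : S ^+ 6 *m S = 1%:M by rewrite -[LHS]/(S ^+ 6 * S) -exprSr singer_exp7.
  by case/mulmx1_unit.
(* h induces a Singer cycle on the subgroup 2^3. *)
have [h hS] := Ereal S Su.
have hSn n w : (E w ^ (h ^+ n))%g = E (w *m S ^+ n).
  elim: n => [|n IH]; first by rewrite expg0 conjg1 mulmx1.
  by rewrite expgSr conjgM IH hS exprSr mulmxA.
(* h ^+ 7 centralizes 2^3, so it lies in it, and it is fixed by S, whose only
   fixed vector is 0. *)
have h7 : (h ^+ 7 = 1)%g.
  have [w0 e0] : exists w, (h ^+ 7)%g = E w.
    apply: Ecent => w; apply: esym.
    by rewrite (conjgC (E w)) hSn (singer_exp7 S3) mulmx1.
  have w0S : w0 *m S = w0.
    by apply: Einj; rewrite -hS -e0 conjgE -expgSr expgS mulKg.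
  suff w00 : w0 = 0 by rewrite e0 w00 frame0.
  have : w0 *m S ^+ 3 = w0 by rewrite !exprS expr0 mulr1 !mulmxA !w0S.
  by rewrite S3 mulmxDr w0S mulmx1 mx2_char2.
have [u [v [u0 v0 uv]]] := eigenchar_exists.
(* Matrices act on the right, so that h^-1 takes the weight u to S *m u. *)
pose g := (h^-1)%g; pose V n : 'rV[R]_7 := v *m g2val (g ^+ n)%g.
have VS n : V n.+1 = V n *m g2val g by rewrite /V expgSr g2valM mulmxA.
have Vmod n : V (n %% 7)%N = V n.
  by rewrite /V expg_mod // /g expgVn h7 invg1.
have Vneq0 n : V n != 0.
  apply: contraNneq v0 => /(congr1 (mulmx^~ (invmx (g2val (g ^+ n)%g)))).
  by rewrite mulmxK ?g2val_unit // mul0mx => ->.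
have Vchar n : eigenchar (S ^+ n *m u) (V n).
  move=> w; rewrite /V -mulmxA -g2valM.
  have -> : (g ^+ n * E w = E (w *m S ^+ n) * g ^+ n)%g.
    by rewrite -hSn conjgE /g expgVn -!mulgA mulgV mulg1.
  by rewrite g2valM mulmxA uv -scalemxAl /pair2 mulmxA.
pose P : 'M[R]_7 := \matrix_(i < 7) V i; pose c := phi3 (V 0) (V 1) (V 3).
have rP i : row i P = V i by rewrite rowK.
have Vline a : phi3 (V a) (V ((a + 1) %% 7)%N) (V ((a + 3) %% 7)%N) = c.
  rewrite !Vmod; elim: a => [|a IH] //; rewrite -IH !addSn !VS.
  exact: g2val_phi3.
have Vphi (i j k : 'I_7) : phi3 (V i) (V j) (V k) = c * (phiz i j k)%:~R.
  have := fano_caseP i j k; rewrite /fano_case; case: eqP => [z _|_].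
    have [w hw] := pair2_witness (singer_add3_neq0 S3 u0 z).
    rewrite z mulr0; apply/eqP; rewrite -eqNr; apply/eqP.
    rewrite -[RHS](g2val_phi3 (E w)) !Vchar phi3Z -!sgD -!pair2Dr hw.
    by rewrite /sg expr1 mulN1r.
  case/hasP => a _ /=.
  case/or4P => [|||/or3P[||]] /and4P[/eqP-> /eqP-> /eqP-> /eqP->].
  - by rewrite Vline mulr1.
  - by rewrite phi3C23 phi3C12 opprK Vline mulr1.
  - by rewrite phi3C12 phi3C23 opprK Vline mulr1.
  - by rewrite phi3C12 Vline mulrN1.
  - by rewrite phi3C23 Vline mulrN1.
  - by rewrite phi3C12 phi3C23 phi3C12 opprK Vline mulrN1.
have uP : P \in unitmx.
  rewrite -row_free_unit -kermx_eq0; apply/rowV0P => a /sub_kermxP aP.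
  apply/rowP => j; rewrite mxE.
  have := congr1 (mulmx^~ (charproj (S ^+ j *m u))) aP.
  rewrite /= mul0mx [a *m P]mulmx_sum_row mulmx_suml (bigD1 j) //= big1 ?addr0.
    rewrite rP -scalemxAl (eigenchar_proj _ (Vchar j)) mx2_char2 eqxx scalerA.
    move/eqP; rewrite scaler_eq0 (negbTE (Vneq0 j)) orbF mulf_eq0.
    by rewrite [8 == 0]pnatr_eq0 orbF => /eqP.
  move=> i ij; rewrite rP -scalemxAl (eigenchar_proj _ (Vchar i)).
  by rewrite (negbTE (singer_add_neq0 S3 u0 ij)) scale0r scaler0.
have phiP : forall x y z, phi3 (x *m P) (y *m P) (z *m P) = c * phi3 x y z.
  by apply: phi3_scale => i j k; rewrite !rP Vphi phi3_delta.
have c0 : c != 0.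
  have : phi3 (e 0) (e 1) (e (3%:R)) != 0.
    rewrite phi3_delta (_ : phiz _ _ _ = 1) ?oner_eq0 //; exact/eqP.
  apply: contraNneq => c0.
  by rewrite -(mulmxKV uP (e 0)) -(mulmxKV uP (e 1)) -(mulmxKV uP (e 3%:R)) phiP c0 mul0r.
exists P, c; split=> // x i j j' M Mj Mj'.
have key w : exists s, forall k, M i k * sg R (pair2 w (S ^+ k *m u)) = s * M i k.
  have [w' ew] := Enorm (x^-1)%g w.
  have xw : (x * E w = E w' * x)%g by rewrite -ew conjgE invgK !mulgA mulgKV.
  exists (sg R (pair2 w' (S ^+ i *m u))) => k.
  pose D : 'M[R]_7 := diag_mx (\row_k sg R (pair2 w (S ^+ k *m u))).
  have PD : P *m rho w = D *m P.
    apply/row_matrixP => a; rewrite !row_mul rP Vchar row_diag_mx mxE.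
    by rewrite -scalemxAl -rowE rP.
  have : row i (M *m D) = sg R (pair2 w' (S ^+ i *m u)) *: row i M.
    apply: (can_inj (mulmxK uP)).
    have MP : M *m P = P *m g2val x by rewrite /M mulmxKV.
    rewrite -scalemxAl -!row_mul -mulmxA -PD mulmxA MP.
    rewrite -(mulmxA P (g2val x) (rho w)) -g2valM xw g2valM mulmxA.
    by rewrite !row_mul rP Vchar -!scalemxAl.
  rewrite /D mul_mx_diag => /rowP /(_ k).
  by clearbody M; rewrite !mxE.
apply/eqP; apply: contraT => jj'.
have [w hw] := pair2_witness (singer_add_neq0 S3 u0 jj').
have [s hs] := key w.
have sj k : M i k != 0 -> sg R (pair2 w (S ^+ k *m u)) = s.
  by move=> Mk; apply: (mulfI Mk); rewrite hs mulrC.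
have := sgK R (pair2 w (S ^+ j *m u)); rewrite {2}(sj j) // -(sj j') // -sgD -pair2Dr hw.
by rewrite /sg expr1 => /eqP; rewrite eqNr oner_eq0.
Qed.

End MonomialBasis.

(** * Signed permutations preserving the 3-form *)

Definition sgnz (b : bool) : int := if b then -1 else 1.
(** The images of the seven basis vectors, in order; the boolean is true for the
    sign -1. *)
Definition signed_perm := seq (nat * bool).
Definition sp_img (l : signed_perm) (i : nat) : nat := (nth (0%N, false) l i).1.
Definition sp_neg (l : signed_perm) (i : nat) : bool := (nth (0%N, false) l i).2.

(** The third point, with its sign, of the oriented line of phi3 through two
    signed points.  A difference in {1, 2, 4} means that x and y follow each
    other in the cyclic order a, a + 1, a + 3. *)
Definition third (x y : nat * bool) : nat * bool :=
  let d := ((y.1 + 7 - x.1) %% 7)%N in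
  if d \in [:: 1%N; 2%N; 4%N] then (((x.1 + 3 * d) %% 7)%N, x.2 (+) y.2)
  else (((y.1 + 3 * (7 - d)) %% 7)%N, ~~ (x.2 (+) y.2)).

Definition third_ok (x y z : nat * bool) : bool := (x.1 != y.1) && (third x y == z).

Lemma phiz_third (i j k : 'I_7) b1 b2 b3 :
  phiz i j k = sgnz (b1 (+) b2 (+) b3) ->
  third_ok (val i, b1) (val j, b2) (val k, b3).
Proof.
have h : all (fun i => all (fun j => all (fun k =>
  [&& (phiz i j k == 1) ==> (i != j) && (third (i, false) (j, false) == (k, false)) &
      (phiz i j k == -1) ==> (i != j) && (third (i, false) (j, false) == (k, true))])
  (iota 0 7)) (iota 0 7)) (iota 0 7) by vm_compute.
have /andP[h1 h2] := all7P (all7P (all7P h i) j) k; clear h.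
have tE c : third (val i, false) (val j, false) = (val k, c) ->
    third (val i, b1) (val j, b2) = (val k, c (+) (b1 (+) b2)).
  by rewrite /third /=; case: ifP => _ [<- <-].
rewrite /third_ok /= => e; move: e h1 h2.
case eb: (b1 (+) b2 (+) b3) => /= -> /=.
  move=> _ /andP[-> /eqP /tE ->] /=; rewrite xpair_eqE eqxx /=.
  by case: b1 b2 b3 eb {tE} => [] [] [].
move=> /andP[-> /eqP /tE ->] _ /=; rewrite xpair_eqE eqxx /=.
by case: b1 b2 b3 eb {tE} => [] [] [].
Qed.

Definition signed_point (l : signed_perm) (i : nat) := nth (0%N, false) l i.

Definition lines_ok (l : signed_perm) : bool :=
  all (fun a => third_ok (signed_point l a) (signed_point l ((a + 1) %% 7)%N)
                  (signed_point l ((a + 3) %% 7)%N)) (iota 0 7).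

(** Three points not on a line generate the Fano plane, so a signed permutation
    that preserves phi3 is known from its values at 0, 1 and 2. *)
Definition complete_lines (x0 x1 x2 : nat * bool) : signed_perm :=
  let x3 := third x0 x1 in let x4 := third x1 x2 in
  let x5 := third x2 x3 in let x6 := third x3 x4 in
  [:: x0; x1; x2; x3; x4; x5; x6].

Definition signed_points : seq (nat * bool) :=
  [seq (p, b) | p <- iota 0 7, b <- [:: false; true]].

Lemma mem_signed_points x : (x.1 < 7)%N -> x \in signed_points.
Proof.
case: x => p b p7; apply: allpairs_f; first by rewrite mem_iota.
by move: b p7 => [] _; rewrite !inE.
Qed.

Definition signed_perms : seq signed_perm :=
  [seq l <- [seq complete_lines y.1 y.2 x2 |
      y <- [seq (x0, x1) | x0 <- signed_points, x1 <- signed_points],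
      x2 <- signed_points] | lines_ok l].

Lemma mem_signed_perms l : size l = 7%N -> all (fun x => x.1 < 7)%N l ->
  lines_ok l -> l \in signed_perms.
Proof.
case: l => [|x0 [|x1 [|x2 [|x3 [|x4 [|x5 [|x6 []]]]]]]] //= _.
case/and4P => h0 h1 h2 _ ok; rewrite mem_filter ok andTb.
have -> : [:: x0; x1; x2; x3; x4; x5; x6] = complete_lines x0 x1 x2.
  case/and5P: ok => /andP[_ /eqP e3] /andP[_ /eqP e4] /andP[_ /eqP e5] /andP[_ /eqP e6] _.
  move: e3 e4 e5 e6; rewrite /signed_point /= => e3 e4 e5 e6.
  by rewrite /complete_lines e3 e4 e5 e6.
apply/allpairsP; exists ((x0, x1), x2); split; [|exact: mem_signed_points|by []].
by apply: allpairs_f; exact: mem_signed_points.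
Qed.

(** The traces of a signed permutation matrix and of its square. *)
Definition trz (l : signed_perm) : int :=
  sum7 (fun i => if sp_img l i == i then sgnz (sp_neg l i) else 0).
Definition trz2 (l : signed_perm) : int :=
  sum7 (fun i => if sp_img l (sp_img l i) == i
               then sgnz (sp_neg l i (+) sp_neg l (sp_img l i)) else 0).

(** Each entry (t1, t2, n) gives the traces in dimensions 7 and 14, and the number
    of group elements that have them. *)
Definition char_table : seq (int * int * nat) :=
  [:: (7, 14, 1%N); (-1, -2, 91%N); (3, 2, 42%N); (-1, 2, 42%N); (1, 0, 168%N);
      (-1, 0, 168%N); (0, 0, 384%N); (1, -1, 224%N); (-1, 1, 224%N)].

Lemma signed_perms_uniq : uniq signed_perms.
Proof.
have uP : uniq signed_points by vm_compute.
have inj2 : injective (uncurry (fun x0 x1 : nat * bool => (x0, x1))).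
  by move=> [x0 x1] [y0 y1] [-> ->].
have uPP := allpairs_uniq uP uP (in2W inj2).
apply: filter_uniq.
apply: (allpairs_uniq (f := fun y x2 => complete_lines y.1 y.2 x2) uPP uP).
by move=> [[x0 x1] x2] [[y0 y1] y2] _ _ [-> -> ->].
Qed.

Lemma perm_tally_seq (T : eqType) (s : seq T) (bs : seq (T * nat)) :
  perm_eq (tally s) bs -> perm_eq s (tally_seq bs).
Proof.
move=> h; apply: perm_trans (perm_flatten (perm_map _ h)).
by rewrite perm_sym; exact: tallyK.
Qed.

(** Since 2 t2 = t1 ^ 2 - \tr (x ^ 2) - 2 t1, the pair (t1, t2) is recorded through
    the traces of x and of its square. *)
Lemma signed_perms_table :
  perm_eq [seq (trz l, trz2 l) | l <- signed_perms]
    (tally_seq [seq ((t.1.1, t.1.1 * t.1.1 - 2 * t.1.2 - 2 * t.1.1), t.2)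
               | t <- char_table]).
Proof. by apply: perm_tally_seq; vm_compute. Qed.

Lemma size_signed_perms : size signed_perms = 1344%N.
Proof. by have /perm_size := signed_perms_table; rewrite size_map. Qed.

(** A function on the Fano plane whose product over each line is 1: the product of
    the seven lines is the cube of the product T of all values, and the product
    of the three lines through a point is T times the square of its value. *)
Lemma incidence_pos (R : realFieldType) (t0 t1 t2 t3 t4 t5 t6 : R) :
  0 < t0 -> 0 < t1 -> 0 < t2 -> 0 < t3 -> 0 < t4 -> 0 < t5 -> 0 < t6 ->
  t0 * t1 * t3 = 1 -> t1 * t2 * t4 = 1 -> t2 * t3 * t5 = 1 -> t3 * t4 * t6 = 1 ->
  t4 * t5 * t0 = 1 -> t5 * t6 * t1 = 1 -> t6 * t0 * t2 = 1 -> t0 = 1.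
Proof.
move=> p0 p1 p2 p3 p4 p5 p6 l0 l1 l2 l3 l4 l5 l6.
pose T := t0 * t1 * t2 * t3 * t4 * t5 * t6.
have T0 : 0 < T by rewrite /T !mulr_gt0.
have T1 : T = 1.
  apply/eqP; rewrite -(pexpr_eq1 (n := 3)) ?ltW //.
  have -> : T ^+ 3 = (t0 * t1 * t3) * (t1 * t2 * t4) * (t2 * t3 * t5) * (t3 * t4 * t6)
    * (t4 * t5 * t0) * (t5 * t6 * t1) * (t6 * t0 * t2) by rewrite /T; ring.
  by rewrite l0 l1 l2 l3 l4 l5 l6 !mulr1.
apply/eqP; rewrite -(pexpr_eq1 (n := 2)) ?ltW //; apply/eqP.
transitivity (t0 ^+ 2 * T); first by rewrite T1 mulr1.
have -> : t0 ^+ 2 * T = (t0 * t1 * t3) * (t4 * t5 * t0) * (t6 * t0 * t2) by rewrite /T; ring.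
by rewrite l0 l4 l6 !mulr1.
Qed.

Lemma phiz_cases (i j k : 'I_7) : phiz i j k = 0 \/ phiz i j k ^+ 2 = 1.
Proof.
have := fano_caseP i j k; rewrite /fano_case; case: eqP => [->|_]; first by left.
move=> h; right; move: h => /hasP[a _].
by case/or4P => [|||/or3P[||]] /and4P[_ _ _ /eqP->].
Qed.

Lemma phiz_line (a : 'I_7) : phiz a ((a + 1) %% 7)%N ((a + 3) %% 7)%N = 1.
Proof.
have h : all (fun a => phiz a ((a + 1) %% 7)%N ((a + 3) %% 7)%N == 1) (iota 0 7).
  by vm_compute.
exact/eqP/(all7P h).
Qed.

Section MonomialRep.
Variables (R : realType) (gT : finGroupType) (iota : {multiplicative gT -> G2 R}).
Hypothesis iota_inj : injective iota.
Hypothesis cardG : (1344 <= #|gT|)%N.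
Variables (P : 'M[R]_7) (c : R).
Hypothesis uP : P \in unitmx.
Hypothesis c0 : c != 0.
Hypothesis phiP : forall x y z, phi3 (x *m P) (y *m P) (z *m P) = c * phi3 x y z.
Local Notation M x := (P *m g2val iota x *m invmx P).
Hypothesis Mrow : forall x i j j', (M x) i j != 0 -> (M x) i j' != 0 -> j = j'.
Local Notation e i := (delta_mx 0 i : 'rV[R]_7).

Lemma monM_unit x : M x \in unitmx.
Proof. by rewrite !unitmx_mul uP unitmx_inv uP g2val_unit. Qed.

Lemma monM_phi3 x u v w : phi3 (u *m M x) (v *m M x) (w *m M x) = phi3 u v w.
Proof.
by apply: (mulfI c0); rewrite -phiP !mulmxA !mulmxKV // g2val_phi3 phiP.
Qed.

(** The default value i is never taken: an invertible matrix has no zero row. *)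
Definition mon_img x (i : 'I_7) : 'I_7 := odflt i [pick j | (M x) i j != 0].
Definition mon_coef x (i : 'I_7) : R := (M x) i (mon_img x i).

Lemma mon_coef_neq0 x i : mon_coef x i != 0.
Proof.
rewrite /mon_coef /mon_img; case: pickP => [j //|h].
have : row i (M x) = 0.
  by apply/rowP => j; have := h j; rewrite !mxE => /negbFE/eqP.
rewrite rowE => /(congr1 (mulmx^~ (invmx (M x)))); rewrite mulmxK ?monM_unit // mul0mx.
by move/rowP/(_ i); rewrite !mxE !eqxx => /eqP; rewrite oner_eq0.
Qed.

Lemma monME x i j : (M x) i j = if j == mon_img x i then mon_coef x i else 0.
Proof.
case: eqP => [->//|ne]; apply/eqP; apply: contraT => Mj.
by case: ne; apply: (Mrow Mj); exact: mon_coef_neq0.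
Qed.

Lemma mon_row x i : e i *m M x = mon_coef x i *: e (mon_img x i).
Proof.
rewrite -rowE; apply/rowP => j; rewrite [LHS]mxE monME !mxE eqxx /=.
by case: eqP => _; rewrite ?mulr1 ?mulr0.
Qed.

Lemma mon_img_inj x : injective (mon_img x).
Proof.
move=> i j ij; apply/eqP; apply: contraT => ne.
have : (mon_coef x j *: e i - mon_coef x i *: e j) *m M x = 0.
  by rewrite mulmxBl -!scalemxAl !mon_row ij !scalerA mulrC subrr.
move=> /(congr1 (mulmx^~ (invmx (M x)))); rewrite mulmxK ?monM_unit // mul0mx.
move/rowP/(_ i); rewrite !mxE !eqxx (negbTE ne) /= mulr1 mulr0 subr0 => /eqP.
by rewrite (negbTE (mon_coef_neq0 x j)).
Qed.

Lemma mon_phiz x i j k :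
  mon_coef x i * mon_coef x j * mon_coef x k *
    (phiz (mon_img x i) (mon_img x j) (mon_img x k))%:~R = (phiz i j k)%:~R.
Proof.
by rewrite -!phi3_delta -(monM_phi3 x (e i)) !mon_row phi3Z.
Qed.

Definition shift7 (d : nat) (a : 'I_7) : 'I_7 := inord ((a + d) %% 7).

Lemma shift7E d a : shift7 d a = ((a + d) %% 7)%N :> nat.
Proof. by rewrite inordK // ltn_mod. Qed.

Lemma mon_line x a : (mon_coef x a * mon_coef x (shift7 1 a) * mon_coef x (shift7 3 a)) ^+ 2 = 1.
Proof.
have := mon_phiz x a (shift7 1 a) (shift7 3 a); rewrite !shift7E phiz_line.
case: (phiz_cases (mon_img x a) (mon_img x (shift7 1 a)) (mon_img x (shift7 3 a))) => [->|p2].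
  by rewrite mulr0 => /esym /eqP; rewrite oner_eq0.
by move/(congr1 (fun z => z ^+ 2)); rewrite exprMn -rmorphXn p2 mulr1 expr1n.
Qed.

(** The coefficients of a line multiply to a sign, so that incidence_pos applies
    to the squares of the coefficients. *)
Lemma mon_coef_sqr x i : mon_coef x i ^+ 2 = 1.
Proof.
pose t k := mon_coef x (shift7 k i) ^+ 2.
have p k : 0 < t k by rewrite exprn_even_gt0 // mon_coef_neq0.
have L k : t k * t (k + 1)%N * t (k + 3)%N = 1.
  have n d : shift7 (k + d) i = shift7 d (shift7 k i).
    by apply: ord_inj; rewrite !shift7E modnDml addnA.
  by rewrite -!exprMn !n mon_line.
have t7 k : t (7 + k)%N = t k.
  by congr (mon_coef x _ ^+ 2); apply: ord_inj; rewrite !shift7E addnCA modnDl.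
have -> : mon_coef x i ^+ 2 = t 0%N.
  by congr (mon_coef x _ ^+ 2); apply: ord_inj; rewrite shift7E addn0 modn_small.
have l4 : t 4 * t 5 * t 0%N = 1 by rewrite -(t7 0%N); exact: (L 4%N).
have l5 : t 5 * t 6 * t 1%N = 1 by rewrite -(t7 1%N); exact: (L 5%N).
have l6 : t 6 * t 0%N * t 2%N = 1 by rewrite -(t7 0%N) -(t7 2%N); exact: (L 6%N).
exact: incidence_pos (p 0%N) (p 1%N) (p 2%N) (p 3%N) (p 4%N) (p 5%N) (p 6%N)
  (L 0%N) (L 1%N) (L 2%N) (L 3%N) l4 l5 l6.
Qed.

Lemma mon_coef_sign x i : mon_coef x i = (sgnz (mon_coef x i < 0))%:~R.
Proof.
have /eqP := mon_coef_sqr x i; rewrite sqrf_eq1 => /orP[]/eqP ->.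
  by rewrite ltr10.
by rewrite oppr_lt0 ltr01.
Qed.

Definition mon_code x : signed_perm :=
  [seq (val (mon_img x i), mon_coef x i < 0) | i : 'I_7].

Lemma size_code x : size (mon_code x) = 7%N.
Proof. by rewrite size_map size_enum_ord. Qed.

Lemma nth_code x (i : 'I_7) :
  nth (0%N, false) (mon_code x) i = (val (mon_img x i), mon_coef x i < 0).
Proof. by rewrite (nth_map i) ?size_enum_ord // nth_ord_enum. Qed.

Lemma sp_img_code x (i : 'I_7) : sp_img (mon_code x) i = mon_img x i.
Proof. by rewrite /sp_img nth_code. Qed.
Lemma sp_neg_code x (i : 'I_7) : sp_neg (mon_code x) i = (mon_coef x i < 0).
Proof. by rewrite /sp_neg nth_code. Qed.

Lemma code_mem x : mon_code x \in signed_perms.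
Proof.
apply: mem_signed_perms; first exact: size_code.
  by apply/allP => _ /mapP[i _ ->] /=.
apply/allP => a; rewrite mem_iota add0n => /andP[_ a7].
pose i := Ordinal a7; rewrite /signed_point -[a]/(val i) -!shift7E !nth_code.
apply: phiz_third.
have := mon_phiz x i (shift7 1 i) (shift7 3 i); rewrite !shift7E phiz_line.
move: (mon_coef_sign x i) (mon_coef_sign x (shift7 1 i)) (mon_coef_sign x (shift7 3 i)).
move: (_ x i < 0) (_ x (shift7 1 i) < 0) (_ x (shift7 3 i) < 0) => b1 b2 b3 -> -> ->.
rewrite -!rmorphM /= => /eqP; rewrite eqr_int.
have -> : sgnz b1 * sgnz b2 * sgnz b3 = sgnz (b1 (+) b2 (+) b3).
  by case: b1; case: b2; case: b3.
case: (b1 (+) b2 (+) b3).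
  by rewrite -[sgnz true]/(-1) mulN1r eqr_oppLR => /eqP.
by rewrite -[sgnz false]/1 mul1r => /eqP.
Qed.

Lemma code_inj : injective mon_code.
Proof.
move=> x y xy; apply: (g2val_inj iota_inj).
have Mxy : M x = M y.
  apply/matrixP => i j; rewrite !monME -!val_eqE /= -!sp_img_code.
  by rewrite (mon_coef_sign x) (mon_coef_sign y) -!sp_neg_code xy.
have : P *m g2val iota x = P *m g2val iota y.
  by rewrite -[LHS](mulmxKV uP) Mxy mulmxKV.
by move=> /(congr1 (mulmx (invmx P))); rewrite !mulKmx.
Qed.

(** An injection from a set of at least 1344 elements into a list of length
    1344. *)
Lemma code_perm : perm_eq [seq mon_code x | x : gT] signed_perms.
Proof.
have u : uniq [seq mon_code x | x : gT].
  by rewrite map_inj_uniq ?enum_uniq //; exact: code_inj.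
have s : {subset [seq mon_code x | x : gT] <= signed_perms}.
  by move=> _ /mapP[x _ ->]; exact: code_mem.
have [|_ e] := uniq_min_size u s.
  by rewrite size_map -cardE size_signed_perms.
exact: uniq_perm u signed_perms_uniq e.
Qed.

Lemma mxtrace_code x : \tr (g2val iota x) = (trz (mon_code x))%:~R.
Proof.
have -> : \tr (g2val iota x) = \tr (M x).
  by rewrite mxtrace_mulC mulmxA mulVmx // mul1mx.
rewrite /trz -sum7E rmorph_sum; apply: eq_bigr => i _ /=.
rewrite monME sp_img_code val_eqE eq_sym sp_neg_code; case: eqP => // _.
exact: mon_coef_sign.
Qed.

Lemma mxtrace_code2 x : \tr (g2val iota x *m g2val iota x) = (trz2 (mon_code x))%:~R.
Proof.
have -> : \tr (g2val iota x *m g2val iota x) = \tr (M x *m M x).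
  have -> : M x *m M x = P *m (g2val iota x *m g2val iota x) *m invmx P.
    by rewrite !mulmxA mulmxKV.
  by rewrite [RHS]mxtrace_mulC !mulmxA mulVmx // mul1mx.
rewrite /trz2 -sum7E rmorph_sum; apply: eq_bigr => i _ /=.
rewrite mxE (bigD1 (mon_img x i)) //= big1 ?addr0 => [|j ji]; last first.
  by rewrite (monME x i) (negbTE ji) mul0r.
rewrite !monME eqxx !sp_img_code val_eqE [i == _]eq_sym !sp_neg_code.
case: eqP => _; last by rewrite mulr0.
move: (mon_coef_sign x i) (mon_coef_sign x (mon_img x i)).
move: (_ x i < 0) (_ x (mon_img x i) < 0) => b1 b2 -> ->.
by rewrite -rmorphM; case: b1; case: b2.
Qed.

Lemma mon_orth x : M x *m (M x)^T = 1%:M.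
Proof.
apply/matrixP => i j; rewrite mxE [RHS]mxE (bigD1 (mon_img x i)) //=.
rewrite big1 ?addr0 => [|k ki]; last by rewrite (monME x i) (negbTE ki) mul0r.
rewrite [_^T _ _]mxE !monME eqxx (inj_eq (@mon_img_inj x)).
have [<-|ne] := eqVneq i j; last by rewrite mulr0.
by rewrite -expr2 mon_coef_sqr.
Qed.

End MonomialRep.

(** * The joint distribution of the two characters *)

Lemma phi3_complex (R : realType) (x y z : 'rV[R]_7) :
  phi3 (map_mx (real_complex R) x) (map_mx (real_complex R) y) (map_mx (real_complex R) z)
  = (phi3 x y z)%:C%C.
Proof.
rewrite /phi3 rmorph_sum; apply: eq_bigr => i _ /=.
by rewrite /minor3 !mxE !(rmorphD, rmorphN, rmorphM).
Qed.

(** The joint distribution of the two characters: F is arbitrary, so this holds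
    for every statistic of the pair of traces. *)
Theorem sum_characters (R : realType) (gT : finGroupType)
    (iota : {multiplicative gT -> G2 R}) :
  is_nonsplit_2_3_PSL27 gT -> injective iota ->
  #|gT| = 1344%N /\
  forall (V : nmodType) (F : R[i] -> R[i] -> V),
    \sum_(x in [set: gT]) F (\tr (varrho1 iota x)) (\tr (varrho2 iota x))
    = \sum_(t <- char_table) F t.1.1%:~R t.1.2%:~R *+ t.2.
Proof.
move=> hG iotaI; have [E hE] := nonsplit_frame hG.
have [P [c [uP c0 phiP Mrow]]] := monomial_basis hE iotaI.
have cG := frame_card hE; have pC := code_perm iotaI cG uP c0 phiP Mrow.
split=> [|V F].
  by rewrite cardE -(size_map (mon_code iota P)) (perm_size pC) size_signed_perms.
pose PC := map_mx (real_complex R) P.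
have uPC : PC \in unitmx by rewrite map_unitmx.
have cC0 : c%:C%C != 0 by rewrite fmorph_eq0.
have phiPC x y z : phi3 (x *m PC) (y *m PC) (z *m PC) = c%:C%C * phi3 x y z.
  move: x y z; apply: phi3_scale => i j k.
  rewrite -!map_row phi3_complex !rowE phiP rmorphM; congr (_ * _).
  by rewrite -!(map_delta_mx (real_complex R)) phi3_complex.
pose f (p : int * int) : V := F p.1%:~R (2^-1 * (p.1%:~R ^+ 2 - p.2%:~R) - p.1%:~R).
transitivity (\sum_(x : gT) f (trz (mon_code iota P x), trz2 (mon_code iota P x))).
  apply: eq_big => [x|x _]; first by rewrite inE.
  have t1 : \tr (varrho1 iota x) = (trz (mon_code iota P x))%:~R.
    by rewrite /= /rho1 trace_map_mx (mxtrace_code uP c0 phiP Mrow) rmorph_int.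
  have t2 : \tr (rho1 (iota x) *m rho1 (iota x)) = (trz2 (mon_code iota P x))%:~R.
    rewrite /rho1 -map_mxM trace_map_mx.
    by rewrite (mxtrace_code2 uP c0 phiP Mrow) rmorph_int.
  rewrite /f /= -t1 -t2; congr F.
  apply: (mxtrace_rho2 uPC cC0 phiPC).
  rewrite /PC /rho1 -map_invmx -!map_mxM map_trmx -map_mxM.
  by rewrite (mon_orth uP c0 phiP Mrow) map_mx1.
rewrite -big_enum -(big_map (mon_code iota P) xpredT (fun l => f (trz l, trz2 l))).
rewrite (perm_big _ pC) /= -(big_map (fun l => (trz l, trz2 l)) xpredT f).
rewrite (perm_big _ signed_perms_table) /tally_seq big_flatten !big_map.
apply: eq_bigr => -[[t1 t2] n] _.
rewrite big_nseq iter_addr_0 /f /=; congr (F _ _ *+ _).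
by rewrite !rmorphB !rmorphM rmorph_nat /=; field.
Qed.

(** * The Weyl group and separation of its orbits *)

(** Integer matrices as pairs of rows, in which the Weyl group can be computed. *)
Definition mat2 := (int * int * (int * int))%type.
Definition mx_of (t : mat2) : 'M[int]_2 :=
  \matrix_(i, j) if i == 0 then (if j == 0 then t.1.1 else t.1.2)
                 else (if j == 0 then t.2.1 else t.2.2).
Definition mul2 (s t : mat2) : mat2 :=
  ((s.1.1 * t.1.1 + s.1.2 * t.2.1, s.1.1 * t.1.2 + s.1.2 * t.2.2),
   (s.2.1 * t.1.1 + s.2.2 * t.2.1, s.2.1 * t.1.2 + s.2.2 * t.2.2)).
Definition one2 : mat2 := ((1, 0), (0, 1)).
Definition refl2 : mat2 := ((0, -1), (-1, 0)).
Definition rot2 : mat2 := ((0, 1), (-1, 1)).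

Definition weyl : seq mat2 :=
  traject (mul2 rot2) one2 6 ++ traject (mul2 rot2) refl2 6.

Lemma ord2_cases (i : 'I_2) : i = 0 \/ i = 1.
Proof. by case: i => [[|[|//]]] p; [left|right]; apply: val_inj. Qed.

Lemma mx_ofM s t : mx_of s *m mx_of t = mx_of (mul2 s t).
Proof.
apply/matrixP => i j; rewrite !mxE !big_ord_recl big_ord0 !mxE /= addr0.
by case: (ord2_cases i) => ->; case: (ord2_cases j) => ->.
Qed.

Lemma mx_of1 : mx_of one2 = 1%:M.
Proof.
apply/matrixP => i j; rewrite !mxE.
by case: (ord2_cases i) => ->; case: (ord2_cases j) => ->.
Qed.

Lemma mx_of_refl : mx_of refl2 = T2.
Proof.
apply/matrixP => i j; rewrite !mxE.
by case: (ord2_cases i) => ->; case: (ord2_cases j) => ->.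
Qed.

Lemma mx_of_rot : mx_of rot2 = T6.
Proof. by []. Qed.

Lemma weyl_mulr s : s \in weyl -> perm_eq [seq mul2 t s | t <- weyl] weyl.
Proof.
have h : all (fun s => perm_eq [seq mul2 t s | t <- weyl] weyl) weyl by vm_compute.
exact: (allP h).
Qed.

Lemma weyl_mull s : s \in weyl -> perm_eq [seq mul2 s t | t <- weyl] weyl.
Proof.
have h : all (fun s => perm_eq [seq mul2 s t | t <- weyl] weyl) weyl by vm_compute.
exact: (allP h).
Qed.

Lemma weyl_inv s : s \in weyl -> exists2 t, t \in weyl & mul2 s t = one2.
Proof.
have h : all (fun s => has (fun t => mul2 s t == one2) weyl) weyl by vm_compute.
by move/(allP h) => /hasP[t wt /eqP e]; exists t.
Qed.

Lemma weyl_D12 t : t \in weyl -> D12 (mx_of t).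
Proof.
have tr n s : D12 (mx_of s) -> forall u, u \in traject (mul2 rot2) s n -> D12 (mx_of u).
  elim: n s => //= n IH s Ds u; rewrite inE => /orP[/eqP->//|].
  apply: IH; rewrite -mx_ofM mx_of_rot; apply: D12_M => //; exact: D12_T6.
rewrite mem_cat => /orP[|]; apply: tr.
  by rewrite mx_of1; exact: D12_1.
by rewrite mx_of_refl; exact: D12_T2.
Qed.

Lemma D12_weyl T : D12 T -> exists2 t, t \in weyl & T = mx_of t.
Proof.
elim => [||| S1 S2 _ [s ws ->] _ [t wt ->] | S1 _ [s ws ->]].
- by exists refl2; rewrite ?mx_of_refl.
- by exists rot2.
- by exists one2; rewrite ?mx_of1.
- exists (mul2 s t); last by rewrite mx_ofM.
  by rewrite -(perm_mem (weyl_mull ws)) map_f.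
have [t wt st] := weyl_inv ws; exists t => //.
have ST : mx_of s *m mx_of t = 1%:M by rewrite mx_ofM st mx_of1.
have [us _] := mulmx1_unit ST.
by rewrite -[LHS]mulmx1 -ST mulmxA mulVmx // mul1mx.
Qed.

Section TorusAlgebra.
Variable F : fieldType.
Implicit Types x y a b c : F.

(** The Laurent polynomials chi1 and chi2, over an arbitrary field. *)
Definition chi1f x y : F := 1 + x + x^-1 + y + y^-1 + x * y^-1 + x^-1 * y.
Definition chi2f x y : F :=
  chi1f x y + 1 + x * y + x^-1 * y^-1 + x ^+ 2 * y^-1 + (x ^+ 2)^-1 * y
     + x * (y ^+ 2)^-1 + x^-1 * y ^+ 2.

Lemma chi1f_rot x y : x != 0 -> y != 0 -> chi1f y (x^-1 * y) = chi1f x y.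
Proof. by move=> x0 y0; rewrite /chi1f; field; rewrite ?x0 ?y0 ?oner_eq0. Qed.
Lemma chi2f_rot x y : x != 0 -> y != 0 -> chi2f y (x^-1 * y) = chi2f x y.
Proof. by move=> x0 y0; rewrite /chi2f chi1f_rot //; field; rewrite ?x0 ?y0 ?oner_eq0. Qed.
Lemma chi1f_refl x y : x != 0 -> y != 0 -> chi1f y^-1 x^-1 = chi1f x y.
Proof. by move=> x0 y0; rewrite /chi1f; field; rewrite ?x0 ?y0 ?oner_eq0. Qed.
Lemma chi2f_refl x y : x != 0 -> y != 0 -> chi2f y^-1 x^-1 = chi2f x y.
Proof. by move=> x0 y0; rewrite /chi2f chi1f_refl //; field; rewrite ?x0 ?y0 ?oner_eq0. Qed.

Lemma prod3_neq0 a b c : a * b * c = 1 -> [/\ a != 0, b != 0 & c != 0].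
Proof.
move=> e; have : a * b * c != 0 by rewrite e oner_eq0.
by rewrite !mulf_eq0 !negb_or => /andP[/andP[? ?] ?].
Qed.

(** Since b c = a ^ -1, one has 1 / b = a c and 1 / c = a b, so the sum is
    (1 + a) (b + c).  It determines b + c unless a = -1, in which case the
    product determines b and c up to order and a common inversion. *)
Lemma triple_core (a b c b' c' : F) :
    a * b * c = 1 -> a * b' * c' = 1 ->
    b' + c' + b'^-1 + c'^-1 = b + c + b^-1 + c^-1 ->
    (b' + b'^-1) * (c' + c'^-1) = (b + b^-1) * (c + c^-1) ->
  [\/ b' = b, b' = c | a = a^-1 /\ (b' = b^-1 \/ b' = c^-1)].
Proof.
move=> h h' e1 e2.
have [a0 b0 c0] := prod3_neq0 h; have [_ b0' c0'] := prod3_neq0 h'.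
have Vb : b^-1 = a * c by apply: (mulfI b0); rewrite mulfV // -h; ring.
have Vc : c^-1 = a * b by apply: (mulfI c0); rewrite mulfV // -h; ring.
have Vb' : b'^-1 = a * c' by apply: (mulfI b0'); rewrite mulfV // -h'; ring.
have Vc' : c'^-1 = a * b' by apply: (mulfI c0'); rewrite mulfV // -h'; ring.
have bc : b' * c' = b * c by apply: (mulfI a0); rewrite !mulrA h h'.
have key : (1 + a) * (b' + c' - b - c) = 0.
  move: e1; rewrite Vb Vc Vb' Vc' => e1.
  transitivity (b' + c' + a * c' + a * b' - (b + c + a * c + a * b)); first by ring.
  by rewrite e1 subrr.
have [a1|a1] := eqVneq (1 + a) 0; last first.
  have s : b' + c' - b - c = 0 by apply: (mulfI a1); rewrite key mulr0.
  have : (b' - b) * (b' - c) = 0.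
    transitivity ((b' + c' - b - c) * b' - (b' * c' - b * c)); first by ring.
    by rewrite s bc mul0r !subrr.
  by move/eqP; rewrite mulf_eq0 !subr_eq0 => /orP[]/eqP->; [constructor 1|constructor 2].
have aE : a = -1 by apply/eqP; rewrite -addr_eq0 addrC a1.
move: e2; rewrite Vb Vc Vb' Vc' aE !mulN1r => e2.
have : (b' - b) * (b' + c) * ((b' - c) * (b' + b)) = 0.
  have d : (b' - c' - (b - c)) * (b' - c' + (b - c)) = 0.
    transitivity (- ((b' - c') * (c' - b')) + (b - c) * (c - b)); first by ring.
    by rewrite e2 addNr.
  transitivity ((b' * (b' - c' - (b - c)) + (b' * c' - b * c))
    * (b' * (b' - c' + (b - c)) + (b' * c' - b * c))); first by ring.
  by rewrite bc subrr !addr0 mulrACA d mulr0.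
move/eqP; rewrite !mulf_eq0 !subr_eq0 !addr_eq0.
case/orP => /orP[]/eqP e.
- by constructor 1.
- by constructor 3; split; [rewrite invrN1 | left].
- by constructor 2.
- by constructor 3; split; [rewrite invrN1 | right].
Qed.

Definition plusinv a := a + a^-1.

Lemma plusinv_eq a b : a != 0 -> b != 0 -> plusinv a = plusinv b -> a = b \/ a = b^-1.
Proof.
move=> a0 b0 e; have : (a - b) * (a - b^-1) = 0.
  transitivity (a * (plusinv a - plusinv b)).
    by rewrite /plusinv; field; rewrite ?a0 ?b0 ?oner_eq0.
  by rewrite e subrr mulr0.
by move/eqP; rewrite mulf_eq0 !subr_eq0 => /orP[]/eqP; [left|right].
Qed.

(** The orbit of (a, b) under the permutations of a, b, c and the simultaneous
    inversion. *)
Definition triple_orbit a b c a' b' : Prop :=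
  exists s : bool, let v z := if s then z^-1 else z in
  [\/ (a' = v a /\ b' = v b) \/ (a' = v a /\ b' = v c),
      (a' = v b /\ b' = v a) \/ (a' = v b /\ b' = v c) |
      (a' = v c /\ b' = v a) \/ (a' = v c /\ b' = v b)].

(** Because a b c = 1, the product of the three values a + 1 / a, b + 1 / b and
    c + 1 / c is determined by their other two symmetric functions.  So these
    values are known up to order, and triple_core applies once a' is matched. *)
Lemma triple_separation a b c a' b' c' :
    a * b * c = 1 -> a' * b' * c' = 1 ->
    plusinv a' + plusinv b' + plusinv c' = plusinv a + plusinv b + plusinv c ->
    plusinv a' * plusinv b' + plusinv a' * plusinv c' + plusinv b' * plusinv c'
      = plusinv a * plusinv b + plusinv a * plusinv c + plusinv b * plusinv c ->
  triple_orbit a b c a' b'.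
Proof.
have core_a p q r p' q' r' : p * q * r = 1 -> p' * q' * r' = 1 -> p' = p ->
    plusinv p' + plusinv q' + plusinv r' = plusinv p + plusinv q + plusinv r ->
    plusinv p' * plusinv q' + plusinv p' * plusinv r' + plusinv q' * plusinv r'
      = plusinv p * plusinv q + plusinv p * plusinv r + plusinv q * plusinv r ->
  [\/ q' = q, q' = r | p' = p^-1 /\ (q' = q^-1 \/ q' = r^-1)].
  move=> h h' pp; rewrite pp in h' *.
  have sumE (u v w v' w' : F) : u + v' + w' = u + v + w -> v' + w' = v + w.
    by rewrite -!addrA => /addrI.
  have prodE (u v w v' w' : F) : v' + w' = v + w ->
      u * v' + u * w' + v' * w' = u * v + u * w + v * w -> v' * w' = v * w.
    by move=> e; rewrite -!mulrDr e => /addrI.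
  move=> /sumE e1 /(prodE _ _ _ _ _ e1) e2.
  apply: triple_core h h' _ e2; move: e1; rewrite /plusinv => e1.
  transitivity (q' + q'^-1 + (r' + r'^-1)); first by ring.
  by rewrite e1; ring.
have core_s p q r p' q' r' : p * q * r = 1 -> p' * q' * r' = 1 -> plusinv p' = plusinv p ->
    plusinv p' + plusinv q' + plusinv r' = plusinv p + plusinv q + plusinv r ->
    plusinv p' * plusinv q' + plusinv p' * plusinv r' + plusinv q' * plusinv r'
      = plusinv p * plusinv q + plusinv p * plusinv r + plusinv q * plusinv r ->
  exists s : bool, let v z := if s then z^-1 else z in
    p' = v p /\ (q' = v q \/ q' = v r).
  move=> h h' pp e1 e2.
  have [p0 q0 r0] := prod3_neq0 h; have [p0' q0' r0'] := prod3_neq0 h'.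
  have [pE|pE] := plusinv_eq p0' p0 pp.
    have [->|->|[-> H]] := core_a _ _ _ _ _ _ h h' pE e1 e2.
    - by exists false; split=> //; left.
    - by exists false; split=> //; right.
    - by exists true.
  have hV : p^-1 * q^-1 * r^-1 = 1 by rewrite -!invfM h invr1.
  have vI z : plusinv z^-1 = plusinv z by rewrite /plusinv invrK addrC.
  have := core_a _ _ _ _ _ _ hV h' pE; rewrite !vI => /(_ e1 e2)[->|->|[-> H]].
  - by exists true; split=> //; left.
  - by exists true; split=> //; right.
  - by exists false; rewrite /= invrK; split=> //; rewrite !invrK in H.
move=> h h' e1 e2.
have [a0 b0 c0] := prod3_neq0 h; have [a0' b0' c0'] := prod3_neq0 h'.
have e3 x y z : x * y * z = 1 -> plusinv x * plusinv y * plusinv z =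
    (plusinv x + plusinv y + plusinv z) ^+ 2
    - 2 * (plusinv x * plusinv y + plusinv x * plusinv z + plusinv y * plusinv z) - 4.
  move=> xyz; have [x0 y0 z0] := prod3_neq0 xyz.
  have zE : z = (x * y)^-1.
    by apply: (mulfI (mulf_neq0 x0 y0)); rewrite xyz mulfV ?mulf_neq0.
  by rewrite zE /plusinv; field; rewrite ?x0 ?y0 ?oner_eq0.
have : (plusinv a' - plusinv a) * (plusinv a' - plusinv b) * (plusinv a' - plusinv c) = 0.
  transitivity (plusinv a' ^+ 3 - (plusinv a + plusinv b + plusinv c) * plusinv a' ^+ 2
    + (plusinv a * plusinv b + plusinv a * plusinv c + plusinv b * plusinv c) * plusinv a'
    - plusinv a * plusinv b * plusinv c); first by ring.
  rewrite (e3 _ _ _ h) -e1 -e2 -(e3 _ _ _ h'); ring.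
move/eqP; rewrite !mulf_eq0 !subr_eq0 => /orP[/orP[]|] /eqP pE.
- have [s [-> H]] := core_s _ _ _ _ _ _ h h' pE e1 e2.
  by exists s; constructor 1; case: H => ->; [left|right].
- have h2 : b * a * c = 1 by rewrite (mulrC b).
  have [||s [-> H]] := core_s _ _ _ _ _ _ h2 h' pE.
  + by rewrite e1 (addrC (plusinv a)).
  + by rewrite e2; ring.
  by exists s; constructor 2; case: H => ->; [left|right].
- have h2 : c * a * b = 1 by rewrite -h; ring.
  have [||s [-> H]] := core_s _ _ _ _ _ _ h2 h' pE.
  + by rewrite e1; ring.
  + by rewrite e2; ring.
  by exists s; constructor 3; case: H => ->; [left|right].
Qed.

Definition mono_f (x y : F) (t : int * int) : F := x ^ t.1 * y ^ t.2.

(** The first two symmetric functions of u + 1 / u, for u in the triple x, 1 / y,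
    y / x of product 1, are chi1 - 1 and chi2 - 2.  The twelve cases of
    triple_orbit are the twelve elements of the Weyl group. *)
Lemma chif_separation x y x' y' : x != 0 -> y != 0 -> x' != 0 -> y' != 0 ->
    chi1f x' y' = chi1f x y -> chi2f x' y' = chi2f x y ->
  exists2 t, t \in weyl & x' = mono_f x y t.1 /\ y' = mono_f x y t.2.
Proof.
move=> x0 y0 x0' y0' c1 c2.
have xy u v : u != 0 -> v != 0 -> u * v^-1 * (v * u^-1) = 1 :> F.
  by move=> u0 v0; field; rewrite ?u0 ?v0 ?oner_eq0.
have E1 u v : u != 0 -> v != 0 -> plusinv u + plusinv v^-1 + plusinv (v * u^-1) = chi1f u v - 1.
  by move=> u0 v0; rewrite /plusinv /chi1f; field; rewrite ?u0 ?v0 ?oner_eq0.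
have E2 u v : u != 0 -> v != 0 -> plusinv u * plusinv v^-1 + plusinv u * plusinv (v * u^-1)
   + plusinv v^-1 * plusinv (v * u^-1) = chi2f u v - 2.
  by move=> u0 v0; rewrite /plusinv /chi2f /chi1f; field; rewrite ?u0 ?v0 ?oner_eq0.
have [] := @triple_separation x y^-1 (y * x^-1) x' y'^-1 (y' * x'^-1).
- exact: xy.
- exact: xy.
- by rewrite !E1 // c1.
- by rewrite !E2 // c2.
have mem t : t \in weyl -> x' = mono_f x y t.1 -> y' = mono_f x y t.2 ->
    exists2 t, t \in weyl & x' = mono_f x y t.1 /\ y' = mono_f x y t.2.
  by move=> h1 h2 h3; exists t.
have yE z : y'^-1 = z -> y' = z^-1 by move=> <-; rewrite invrK.
move=> [] /= [[]|[]|[]] [ex /yE ey];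
  [ apply: (mem ((-1, 0), (0, -1)))
  | apply: (mem ((-1, 0), (-1, 1)))
  | apply: (mem ((0, 1), (1, 0)))
  | apply: (mem ((0, 1), (-1, 1)))
  | apply: (mem ((1, -1), (1, 0)))
  | apply: (mem ((1, -1), (0, -1)))
  | apply: (mem ((1, 0), (0, 1)))
  | apply: (mem ((1, 0), (1, -1)))
  | apply: (mem ((0, -1), (-1, 0)))
  | apply: (mem ((0, -1), (1, -1)))
  | apply: (mem ((-1, 1), (-1, 0)))
  | apply: (mem ((-1, 1), (0, 1))) ];
  rewrite // ?ex ?ey /mono_f /= ?expr1z ?expr0z ?exprN1 ?mulr1 ?mul1r;
  by rewrite ?invfM ?invrK // mulrC.
Qed.

End TorusAlgebra.

Lemma exprz_mono_comp (F : fieldType) (x y : F) (a b c d m n : int) :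
  x != 0 -> y != 0 ->
  (x ^ a * y ^ b) ^ m * (x ^ c * y ^ d) ^ n
  = x ^ (m * a + n * c) * y ^ (m * b + n * d).
Proof.
move=> x0 y0; rewrite !expfzMl !exprz_exp !expfzDr //.
by rewrite !(mulrC m) !(mulrC n) mulrACA.
Qed.

Section TorusAction.
Variable R : realType.
Local Notation C := R[i].
Implicit Types w : torus R.

Lemma circle_neq0 (z : circle R) : val z != 0.
Proof. by rewrite -normr_eq0 (eqP (valP z)) oner_eq0. Qed.

Lemma torus_ext w w' : val w.1 = val w'.1 -> val w.2 = val w'.2 -> w = w'.
Proof.
by case: w w' => [x y] [x' y'] /= h1 h2; congr pair; apply: val_inj.
Qed.

Definition wact (t : mat2) w : torus R := torus_act (mx_of t) w.

Lemma wact_fst t w : val (wact t w).1 = mono_f (val w.1) (val w.2) t.1.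
Proof. by rewrite /= !mxE. Qed.
Lemma wact_snd t w : val (wact t w).2 = mono_f (val w.1) (val w.2) t.2.
Proof. by rewrite /= !mxE. Qed.

Lemma mono_wact a b t w :
  mono a b (wact t w) = mono (a * t.1.1 + b * t.2.1) (a * t.1.2 + b * t.2.2) w.
Proof.
rewrite [LHS]/mono wact_fst wact_snd.
exact: (exprz_mono_comp _ _ _ _ _ _ (circle_neq0 _) (circle_neq0 _)).
Qed.

Lemma wactM s t w : wact (mul2 s t) w = wact s (wact t w).
Proof.
apply: torus_ext.
  by rewrite [LHS]wact_fst [RHS]wact_fst -[RHS]/(mono s.1.1 s.1.2 (wact t w)) mono_wact.
by rewrite [LHS]wact_snd [RHS]wact_snd -[RHS]/(mono s.2.1 s.2.2 (wact t w)) mono_wact.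
Qed.

Lemma mono_f1 (F : fieldType) (x y : F) : mono_f x y (1, 0) = x.
Proof. by rewrite /mono_f expr1z expr0z mulr1. Qed.
Lemma mono_f2 (F : fieldType) (x y : F) : mono_f x y (0, 1) = y.
Proof. by rewrite /mono_f expr1z expr0z mul1r. Qed.
Lemma mono_fN1 (F : fieldType) (x y : F) : mono_f x y (-1, 0) = x^-1.
Proof. by rewrite /mono_f exprN1 expr0z mulr1. Qed.
Lemma mono_fN2 (F : fieldType) (x y : F) : mono_f x y (0, -1) = y^-1.
Proof. by rewrite /mono_f exprN1 expr0z mul1r. Qed.
Lemma mono_fN12 (F : fieldType) (x y : F) : mono_f x y (-1, 1) = x^-1 * y.
Proof. by rewrite /mono_f exprN1 expr1z. Qed.

Lemma wact1 w : wact one2 w = w.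
Proof.
by apply: torus_ext; rewrite ?wact_fst ?wact_snd ?mono_f1 ?mono_f2.
Qed.

Lemma chi1fE (F : fieldType) (x y : F) : chi1f x y = 1 + x ^ 1 * y ^ 0 + x ^ (-1) * y ^ 0
  + x ^ 0 * y ^ 1 + x ^ 0 * y ^ (-1) + x ^ 1 * y ^ (-1) + x ^ (-1) * y ^ 1.
Proof. by rewrite !expr1z !expr0z !exprN1 !mulr1 !mul1r. Qed.

Lemma chi2fE (F : fieldType) (x y : F) : chi2f x y = chi1f x y + 1 + x ^ 1 * y ^ 1 +
  x ^ (-1) * y ^ (-1) + x ^ 2 * y ^ (-1) + x ^ (-2) * y ^ 1 + x ^ 1 * y ^ (-2) + x ^ (-1) * y ^ 2.
Proof. by rewrite !expr1z !exprN1. Qed.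

Lemma chi1E w : chi1 w = chi1f (val w.1) (val w.2).
Proof. by rewrite chi1fE. Qed.

Lemma chi2E w : chi2 w = chi2f (val w.1) (val w.2).
Proof. by rewrite chi2fE chi1fE. Qed.

Lemma chi_rot w : chi1 (wact rot2 w) = chi1 w /\ chi2 (wact rot2 w) = chi2 w.
Proof.
rewrite !chi1E !chi2E wact_fst wact_snd mono_f2 mono_fN12.
by rewrite chi1f_rot ?chi2f_rot ?circle_neq0.
Qed.

Lemma chi_refl w : chi1 (wact refl2 w) = chi1 w /\ chi2 (wact refl2 w) = chi2 w.
Proof.
rewrite !chi1E !chi2E wact_fst wact_snd mono_fN1 mono_fN2.
by rewrite chi1f_refl ?chi2f_refl ?circle_neq0.
Qed.

Lemma chi_weyl t w : t \in weyl -> chi1 (wact t w) = chi1 w /\ chi2 (wact t w) = chi2 w.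
Proof.
have tr n s : (forall w, chi1 (wact s w) = chi1 w /\ chi2 (wact s w) = chi2 w) ->
    forall u, u \in traject (mul2 rot2) s n ->
    forall w, chi1 (wact u w) = chi1 w /\ chi2 (wact u w) = chi2 w.
  elim: n s => [|n IH] s Ds u; first by rewrite in_nil.
  rewrite trajectS inE => /orP[/eqP->//|].
  apply: IH => w'; rewrite wactM; have [-> ->] := chi_rot (wact s w').
  exact: Ds.
rewrite mem_cat => /orP[|] tw; apply: tr tw _ => w'; first by rewrite wact1.
exact: chi_refl.
Qed.

Lemma chi_separation w w' : chi1 w' = chi1 w -> chi2 w' = chi2 w ->
  exists2 t, t \in weyl & w' = wact t w.
Proof.
rewrite !chi1E !chi2E => c1 c2.
have [t wt [h1 h2]] := chif_separation (circle_neq0 w.1) (circle_neq0 w.2)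
  (circle_neq0 w'.1) (circle_neq0 w'.2) c1 c2.
by exists t => //; apply: torus_ext; rewrite ?wact_fst ?wact_snd.
Qed.

End TorusAction.

(** * Points of the torus over the character values *)

Section RootValues.
Variable F : fieldType.
Implicit Types z : F.

(** The nine values of the pair of characters on the group, realized at points
    whose coordinates are powers of a root of unity z of order 1, 2, 3, 4, 6, 7 or
    8; each order enters through its equation. *)
Lemma chif_1 : chi1f (1 : F) 1 = 7 /\ chi2f (1 : F) 1 = 14.
Proof. by rewrite /chi2f /chi1f !expr1n !invr1; split; ring. Qed.

Lemma chif_2 : chi1f (-1 : F) 1 = -1 /\ chi2f (-1 : F) 1 = -2.
Proof. by rewrite /chi2f /chi1f sqrrN !expr1n !invrN1 !invr1; split; ring. Qed.

Lemma inv_eq z u : z * u = 1 -> z^-1 = u.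
Proof.
move=> zu; have z0 : z != 0 by apply: contra_eq_neq zu => ->; rewrite mul0r eq_sym oner_eq0.
by apply: (mulfI z0); rewrite mulfV.
Qed.

Lemma chif_4a z : z ^+ 2 = -1 -> chi1f z 1 = 3 /\ chi2f z 1 = 2.
Proof.
move=> h; have zV : z^-1 = - z by apply: inv_eq; ring: h.
by rewrite /chi2f /chi1f -!exprVn zV expr1n invr1; split; ring: h.
Qed.

Lemma chif_4b z : z ^+ 2 = -1 -> chi1f z (-1) = -1 /\ chi2f z (-1) = 2.
Proof.
move=> h; have zV : z^-1 = - z by apply: inv_eq; ring: h.
by rewrite /chi2f /chi1f -!exprVn zV invrN1; split; ring: h.
Qed.

Lemma chif_8a z : z ^+ 4 = -1 -> chi1f z (z ^+ 3) = 1 /\ chi2f z (z ^+ 3) = 0.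
Proof.
move=> h; have zV : z^-1 = - z ^+ 3 by apply: inv_eq; ring: h.
by rewrite /chi2f /chi1f -!exprVn zV; split; ring: h.
Qed.

Lemma chif_8b z : z ^+ 4 = -1 -> chi1f z (-1) = -1 /\ chi2f z (-1) = 0.
Proof.
move=> h; have zV : z^-1 = - z ^+ 3 by apply: inv_eq; ring: h.
by rewrite /chi2f /chi1f -!exprVn zV invrN1; split; ring: h.
Qed.

Lemma chif_7 z : z ^+ 6 = - (1 + z + z ^+ 2 + z ^+ 3 + z ^+ 4 + z ^+ 5) ->
  chi1f z (z ^+ 3) = 0 /\ chi2f z (z ^+ 3) = 0.
Proof.
move=> h; have zV : z^-1 = z ^+ 6 by apply: inv_eq; ring: h.
by rewrite /chi2f /chi1f -!exprVn zV; split; ring: h.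
Qed.

Lemma chif_3 z : z ^+ 2 = - (1 + z) -> chi1f z 1 = 1 /\ chi2f z 1 = -1.
Proof.
move=> h; have zV : z^-1 = z ^+ 2 by apply: inv_eq; ring: h.
by rewrite /chi2f /chi1f -!exprVn zV expr1n invr1; split; ring: h.
Qed.

Lemma chif_6 z : z ^+ 2 = z - 1 -> chi1f z (-1) = -1 /\ chi2f z (-1) = 1.
Proof.
move=> h; have zV : z^-1 = 1 - z by apply: inv_eq; ring: h.
by rewrite /chi2f /chi1f -!exprVn zV invrN1; split; ring: h.
Qed.

(** Twice the alternating sum of cosines in J. *)
Definition weyl_alt (x y : F) : F :=
  let m (a b : int) := x ^ a * y ^ b in let p a b := m a b + m (- a) (- b) in
  p 2 1 + p 1 (-3) + p 3 (-2) - p 1 2 - p 3 (-1) - p 2 (-3).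

(** The alternating sum changes sign under the reflections of the Weyl group, so
    its square is a polynomial in chi1 and chi2.  The first factor vanishes where
    a long root is 1 and the second one where a short root is 1. *)
Lemma weyl_alt_sqr x y : x != 0 -> y != 0 -> weyl_alt x y ^+ 2 =
  - (4 * chi1f x y ^+ 3 - chi1f x y ^+ 2 - 2 * chi1f x y - 10 * chi1f x y * chi2f x y
     - chi2f x y ^+ 2 - 10 * chi2f x y + 7)
  * (chi1f x y ^+ 2 + 2 * chi1f x y - 7 - 4 * chi2f x y).
Proof.
move=> x0 y0.
have e : weyl_alt x y = x ^+ 2 * y + (x ^+ 2 * y)^-1 + x * (y ^+ 3)^-1 + x^-1 * y ^+ 3
   + x ^+ 3 * (y ^+ 2)^-1 + (x ^+ 3)^-1 * y ^+ 2 - x * y ^+ 2 - (x * y ^+ 2)^-1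
   - x ^+ 3 * y^-1 - (x ^+ 3)^-1 * y - x ^+ 2 * (y ^+ 3)^-1 - (x ^+ 2)^-1 * y ^+ 3.
  rewrite /weyl_alt !opprK -[x ^ 1]/x -[y ^ 1]/y -[x ^ 2]/(x ^+ 2) -[x ^ 3]/(x ^+ 3).
  rewrite -[y ^ 2]/(y ^+ 2) -[y ^ 3]/(y ^+ 3).
  rewrite -[x ^ (- 1)]/(x^-1) -[y ^ (- 1)]/(y^-1).
  rewrite -[x ^ (- 2)]/((x ^+ 2)^-1) -[x ^ (- 3)]/((x ^+ 3)^-1).
  rewrite -[y ^ (- 2)]/((y ^+ 2)^-1) -[y ^ (- 3)]/((y ^+ 3)^-1).
  by rewrite !invfM; ring.
by rewrite e /chi2f /chi1f; field; rewrite ?x0 ?y0.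
Qed.

End RootValues.

Section GridPoints.
Variable R : realType.
Local Notation C := R[i].
Local Notation Re := complex.Re.
Local Notation Im := complex.Im.

(** The denominator 168 is the least common multiple of 3, 7 and 8: it suffices
    for all the roots of unity of the theorem. *)
Definition grid (p : int * int) : torus R :=
  (expi (p.1%:~R / 168), expi (p.2%:~R / 168)).

Definition zeta : C := val (expi (168^-1 : R)).

Lemma expi_zeta (a : int) : val (expi (a%:~R / 168 : R)) = zeta ^ a.
Proof. by rewrite /zeta exprz_expi. Qed.

Lemma grid_fst p : val (grid p).1 = zeta ^ p.1.
Proof. exact: expi_zeta. Qed.
Lemma grid_snd p : val (grid p).2 = zeta ^ p.2.
Proof. exact: expi_zeta. Qed.

Lemma expi_half : val (expi (2^-1 : R)) = -1.
Proof.
rewrite /= (_ : 2 * pi * 2^-1 = pi); last by field.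
by rewrite cospi sinpi; apply/eqP; rewrite eq_complex /= oppr0 !eqxx.
Qed.

Lemma zeta84 : zeta ^+ 84 = -1.
Proof.
rewrite exprnP -expi_zeta -expi_half; congr (val (expi _)).
by rewrite -pmulrn; field.
Qed.

Lemma zeta168 : zeta ^+ 168 = 1.
Proof. by rewrite -[168%N]/(84 * 2)%N exprM zeta84 sqrrN expr1n. Qed.

Lemma zeta_neq0 : zeta != 0.
Proof. exact: circle_neq0. Qed.

Lemma Im_zeta_gt0 n : (0 < n < 84)%N -> 0 < Im (zeta ^+ n).
Proof.
move=> /andP[n0 n84]; rewrite exprnP -expi_zeta /=.
have npos : 0 < (n%:R : R) by rewrite ltr0n.
have nlt : (n%:R : R) < 84 by rewrite (ltr_nat R n 84).
have p0 := pi_gt0 R.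
apply: sin_gt0_pi; rewrite -pmulrn.
have -> : 2 * pi * (n%:R / 168) = pi * (n%:R / 84) :> R by field.
rewrite mulr_gt0 ?divr_gt0 //= gtr_pMr // ltr_pdivrMr // mul1r nlt.
by [].
Qed.

Lemma zeta_neq1 n : (0 < n < 84)%N -> zeta ^+ n != 1 /\ zeta ^+ n != -1.
Proof.
move=> /Im_zeta_gt0 h; split; apply/eqP => e; move: h; rewrite e /= ?oppr0 ltxx //.
Qed.

Lemma grid_chi1 p : chi1 (grid p) = chi1f (zeta ^ p.1) (zeta ^ p.2).
Proof. by rewrite chi1E grid_fst grid_snd. Qed.
Lemma grid_chi2 p : chi2 (grid p) = chi2f (zeta ^ p.1) (zeta ^ p.2).
Proof. by rewrite chi2E grid_fst grid_snd. Qed.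

Definition grid_mod (p : int * int) : int * int := ((p.1 %% 168)%Z, (p.2 %% 168)%Z).

Lemma zeta_mod (a : int) : zeta ^ (a %% 168)%Z = zeta ^ a.
Proof.
have q1 q : zeta ^ (q * 168%Z) = 1.
  by rewrite mulrC -exprz_exp -exprnP zeta168 exp1rz.
by rewrite [in RHS](divz_eq a 168%Z) [RHS]expfzDr ?zeta_neq0 // q1 mul1r.
Qed.

Lemma grid_modE p : grid (grid_mod p) = grid p.
Proof. by apply: torus_ext; rewrite ?grid_fst ?grid_snd zeta_mod. Qed.

Definition mat2_app (t : mat2) (p : int * int) : int * int :=
  (t.1.1 * p.1 + t.1.2 * p.2, t.2.1 * p.1 + t.2.2 * p.2).

Lemma wact_grid t p : wact t (grid p) = grid (mat2_app t p).
Proof.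
have e (u : int * int) : mono_f (val (grid p).1) (val (grid p).2) u
   = zeta ^ (u.1 * p.1 + u.2 * p.2).
  rewrite /mono_f grid_fst grid_snd !exprz_exp -expfzDr ?zeta_neq0 //.
  by rewrite (mulrC p.1) (mulrC p.2).
apply: torus_ext; first by rewrite wact_fst [RHS]grid_fst e.
by rewrite wact_snd [RHS]grid_snd e.
Qed.

(** For each line of char_table, a point where (chi1, chi2) takes its values, in
    168-ths of a turn. *)
Definition class_reps : seq ((int * int) * (int * int) * nat) :=
  [:: ((0%Z, 0%Z), (7, 14), 1%N);
      ((84%Z, 0%Z), (-1, -2), 91%N);
      ((42%Z, 0%Z), (3, 2), 42%N);
      ((42%Z, 84%Z), (-1, 2), 42%N);
      ((21%Z, 63%Z), (1, 0), 168%N);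
      ((21%Z, 84%Z), (-1, 0), 168%N);
      ((24%Z, 72%Z), (0, 0), 384%N);
      ((56%Z, 0%Z), (1, -1), 224%N);
      ((28%Z, 84%Z), (-1, 1), 224%N)].

Lemma class_reps_table :
  [seq (r.1.2.1, r.1.2.2, r.2) | r <- class_reps] = char_table.
Proof. by []. Qed.

Lemma class_reps_chi r : r \in class_reps ->
  chi1 (grid r.1.1) = r.1.2.1%:~R /\ chi2 (grid r.1.1) = r.1.2.2%:~R.
Proof.
have z56 : (zeta ^+ 56) ^+ 2 = - (1 + zeta ^+ 56).
  have [n1 _] := @zeta_neq1 56 isT; apply/eqP; rewrite -subr_eq0 opprK.
  rewrite -subr_eq0 in n1; apply/eqP/(mulfI n1); rewrite mulr0.
  transitivity (zeta ^+ 168 - 1); first by ring.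
  by rewrite zeta168 subrr.
have z28 : (zeta ^+ 28) ^+ 2 = zeta ^+ 28 - 1.
  have [_ n1] := @zeta_neq1 28 isT; apply/eqP; rewrite -subr_eq0.
  rewrite -subr_eq0 opprK in n1; apply/eqP/(mulfI n1); rewrite mulr0.
  transitivity (zeta ^+ 84 + 1); first by ring.
  by rewrite zeta84 addNr.
have z24 : (zeta ^+ 24) ^+ 6 = - (1 + zeta ^+ 24 + (zeta ^+ 24) ^+ 2 + (zeta ^+ 24) ^+ 3
    + (zeta ^+ 24) ^+ 4 + (zeta ^+ 24) ^+ 5).
  have [n1 _] := @zeta_neq1 24 isT; apply/eqP; rewrite -subr_eq0 opprK.
  rewrite -subr_eq0 in n1; apply/eqP/(mulfI n1); rewrite mulr0.
  transitivity (zeta ^+ 168 - 1); first by ring.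
  by rewrite zeta168 subrr.
have z21 : (zeta ^+ 21) ^+ 4 = -1 by rewrite -exprM zeta84.
have z42 : (zeta ^+ 42) ^+ 2 = -1 by rewrite -exprM zeta84.
have e63 : zeta ^+ 63 = (zeta ^+ 21) ^+ 3 by rewrite -exprM.
have e72 : zeta ^+ 72 = (zeta ^+ 24) ^+ 3 by rewrite -exprM.
rewrite grid_chi1 grid_chi2 !inE => /or4P[|||/or4P[|||/or3P[]]] /eqP -> /=;
  rewrite -?exprnP ?expr0 ?zeta84 ?e63 ?e72 ?(rmorphN, rmorph_nat, rmorph1, rmorph0).
- exact: chif_1.
- exact: chif_2.
- exact: (chif_4a z42).
- exact: (chif_4b z42).
- exact: (chif_8a z21).
- exact: (chif_8b z21).
- exact: (chif_7 z24).
- exact: (chif_3 z56).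
- exact: (chif_6 z28).
Qed.

End GridPoints.

(** * The weights on the grid of 168-th roots of unity *)

(** The polynomial of weyl_alt_sqr, evaluated on integers. *)
Definition disc_poly (x y : int) : int :=
  - (4 * (x * x * x) - x * x - 2 * x - 10 * x * y - y * y - 10 * y + 7)
  * (x * x + 2 * x - 7 - 4 * y).

(** The representative in [0, 84] of a or - a modulo 168; z ^ a + z ^ - a depends
    on it only, for z of order 168. *)
Definition fold168 (a : int) : int :=
  let r := (a %% 168)%Z in if (r <= 84%Z) then r else 168%Z - r.

Definition alt_plus (p : int * int) : seq int :=
  [:: 2 * p.1 + 1 * p.2; 1 * p.1 + (-3) * p.2; 3 * p.1 + (-2) * p.2].
Definition alt_minus (p : int * int) : seq int :=
  [:: 1 * p.1 + 2 * p.2; 3 * p.1 + (-1) * p.2; 2 * p.1 + (-3) * p.2].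
(** At the other points the cosines of the two signs in J are the same up to order,
    so that J vanishes. *)
Definition regular_pt (p : int * int) : bool :=
  ~~ perm_eq (map fold168 (alt_plus p)) (map fold168 (alt_minus p)).

Definition rep_of (p : int * int) (r : (int * int) * (int * int) * nat) : bool :=
  has (fun t => grid_mod (mat2_app t r.1.1) == grid_mod p) weyl.

Definition gridk (k : nat) : seq (int * int) :=
  [seq (((168 %/ k) * q1)%N%:Z, ((168 %/ k) * q2)%N%:Z) | q1 <- iota 0 k, q2 <- iota 0 k].

(** The value of J ^ 2 at a regular point is read off a representative of its Weyl
    orbit. *)
Definition J_table_ok (k : nat) (v : int) : bool :=
  all (fun p => ~~ regular_pt p ||
      has (fun r => rep_of p r && (disc_poly r.1.2.1 r.1.2.2 == v)) class_reps)
    (gridk k).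

Lemma J_table8 : J_table_ok 8 32. Proof. by vm_compute. Qed.
Lemma J_table7 : J_table_ok 7 49. Proof. by vm_compute. Qed.
Lemma J_table6 : J_table_ok 6 36. Proof. by vm_compute. Qed.

Definition weighted := seq (int * (int * int)).

(** The two sides of the formula as integer weights on the grid, multiplied by
    16128 = 12 * 1344.  For instance
    168 = 16128 * (16 pi ^ 4 * 32) / (768 pi ^ 4 * 8 ^ 2), where 32 comes from
    J_table8. *)
Definition class_weights : weighted :=
  [seq (Posz r.2, mat2_app t r.1.1) | r <- class_reps, t <- weyl].

Definition root_weights : weighted :=
  [seq (168%Z * (regular_pt p)%:Z, p) | p <- gridk 8]
  ++ [seq (384%Z * (regular_pt p)%:Z, p) | p <- gridk 7]
  ++ [seq (224%Z * (regular_pt p)%:Z, p) | p <- gridk 6]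
  ++ [seq (84%Z, p) | p <- gridk 4] ++ [seq (448%Z, p) | p <- gridk 3]
  ++ [seq (280%Z, p) | p <- gridk 2] ++ [seq (- 352%Z, p) | p <- gridk 1]
  ++ [seq (- 448%Z, p) | p <- [:: (0%Z, 0%Z); (56%Z, 112%Z); (112%Z, 56%Z)]].

Definition weight_at (W : weighted) (u : int * int) : int :=
  foldr (fun q s => (if grid_mod q.2 == u then q.1 else 0) + s) 0 W.

Lemma class_root_weights :
  all (fun u => weight_at class_weights u == weight_at root_weights u)
    (undup [seq grid_mod q.2 | q <- class_weights ++ root_weights]).
Proof. by vm_compute. Qed.

Lemma sum_weight_at (V : comNzRingType) (W : weighted) (U : seq (int * int)) (f : int * int -> V) :
  (forall p, f (grid_mod p) = f p) -> uniq U ->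
  {subset [seq grid_mod q.2 | q <- W] <= U} ->
  \sum_(q <- W) q.1%:~R * f q.2 = \sum_(u <- U) (weight_at W u)%:~R * f u.
Proof.
move=> fmod uU; elim: W => [|q W IH] sWU.
  by rewrite big_nil big1 // => u _; rewrite mul0r.
have qU : grid_mod q.2 \in U by apply: sWU; rewrite inE eqxx.
rewrite big_cons IH => [|u uW]; last by apply: sWU; rewrite inE uW orbT.
have -> : q.1%:~R * f q.2 = \sum_(u <- U) (if grid_mod q.2 == u then q.1 else 0)%:~R * f u.
  rewrite (bigD1_seq (grid_mod q.2)) //= eqxx fmod big1 ?addr0 // => u.
  by rewrite eq_sym => /negbTE ->; rewrite mul0r.
rewrite -big_split; apply: eq_bigr => u _ /=.
by rewrite -mulrDl -rmorphD.
Qed.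

Lemma sum_class_root_weights (V : comNzRingType) (f : int * int -> V) :
  (forall p, f (grid_mod p) = f p) ->
  \sum_(q <- class_weights) q.1%:~R * f q.2 = \sum_(q <- root_weights) q.1%:~R * f q.2.
Proof.
move=> fmod; pose U := undup [seq grid_mod q.2 | q <- class_weights ++ root_weights].
have uU : uniq U by exact: undup_uniq.
have cU : {subset [seq grid_mod q.2 | q <- class_weights] <= U}.
  by move=> u uW; rewrite mem_undup map_cat mem_cat uW.
have rU : {subset [seq grid_mod q.2 | q <- root_weights] <= U}.
  by move=> u uW; rewrite mem_undup map_cat mem_cat uW orbT.
rewrite (sum_weight_at fmod uU cU) (sum_weight_at fmod uU rU).
rewrite big_seq [RHS]big_seq; apply: eq_bigr => u uU'.
by rewrite (eqP (allP class_root_weights u uU')).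
Qed.

(** * Values of the density on the grid *)

Section AlternatingSum.
Variable R : realType.
Local Notation C := R[i].
Local Notation Re := complex.Re.
Local Notation zeta := (zeta R).
Local Notation grid := (grid R).

Lemma monoDV a b (w : torus R) :
  mono a b w + mono (- a) (- b) w = (2 * Re (mono a b w))%:C%C.
Proof.
rewrite monoN; case: (mono a b w) => x y; apply/eqP.
by rewrite eq_complex /= subrr mulrDl mul1r !eqxx.
Qed.

Lemma J_weyl_alt w : (J w)%:C%C = (4 * pi ^+ 2 : R)%:C%C * weyl_alt (val w.1) (val w.2).
Proof.
have -> : weyl_alt (val w.1) (val w.2) =
    (2 * Re (mono 2 1 w))%:C%C + (2 * Re (mono 1 (-3) w))%:C%C
    + (2 * Re (mono 3 (-2) w))%:C%C - (2 * Re (mono 1 2 w))%:C%C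
    - (2 * Re (mono 3 (-1) w))%:C%C - (2 * Re (mono 2 (-3) w))%:C%C :> C.
  by rewrite -!monoDV.
by rewrite -!(rmorphD, rmorphB, rmorphM); congr (_%:C%C); rewrite /J; ring.
Qed.

Lemma J_sqr_int w (x y : int) : chi1 w = x%:~R -> chi2 w = y%:~R ->
  J w ^+ 2 = 16 * pi ^+ 4 * (disc_poly x y)%:~R :> R.
Proof.
move=> c1 c2; apply: (@complexI R).
rewrite rmorphXn /= J_weyl_alt exprMn weyl_alt_sqr ?circle_neq0 //.
rewrite -chi1E -chi2E c1 c2 [RHS]rmorphM rmorph_int -rmorphXn; congr (_ * _).
  by congr (_%:C%C); ring.
by rewrite /disc_poly; ring.
Qed.

Let pm (e : int) : C := zeta ^ e + zeta ^ (- e).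

Let pmN e : pm (- e) = pm e.
Proof. by rewrite /pm opprK addrC. Qed.

Let pm_fold e : pm (fold168 e) = pm e.
Proof.
have m a b : (a = b %[mod 168])%Z -> pm a = pm b.
  move=> h; rewrite /pm -!invr_expz -[zeta ^ a]zeta_mod h zeta_mod; by [].
have mE : pm (e %% 168)%Z = pm e by apply: m; rewrite modz_mod.
rewrite /fold168; case: ifP => // _; rewrite -[RHS]mE -[RHS]pmN; apply: m.
by rewrite modzDl.
Qed.

Lemma weyl_alt_zeta p : weyl_alt (zeta ^ p.1) (zeta ^ p.2) =
  \sum_(e <- alt_plus p) pm e - \sum_(e <- alt_minus p) pm e.
Proof.
have m a b : (zeta ^ p.1) ^ a * (zeta ^ p.2) ^ b = zeta ^ (a * p.1 + b * p.2).
  by rewrite !exprz_exp -expfzDr ?zeta_neq0 // (mulrC p.1) (mulrC p.2).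
have mN a b : zeta ^ (- a * p.1 + - b * p.2) = zeta ^ (- (a * p.1 + b * p.2)).
  by congr (zeta ^ _); ring.
rewrite /weyl_alt !m !mN !big_cons !big_nil /pm; ring.
Qed.

Lemma J_singular p : ~~ regular_pt p -> J (grid p) = 0.
Proof.
rewrite negbK => pp; apply: (@complexI R); rewrite J_weyl_alt grid_fst grid_snd.
rewrite weyl_alt_zeta.
have e s : \sum_(e <- s) pm e = \sum_(e <- map fold168 s) pm e.
  by rewrite big_map; apply: eq_bigr => i _; rewrite pm_fold.
by rewrite (e (alt_plus p)) (e (alt_minus p)) (perm_big _ pp) subrr mulr0.
Qed.

Lemma J_grid_sqr k v p : J_table_ok k v -> p \in gridk k ->
  J (grid p) ^+ 2 = 16 * pi ^+ 4 * (v * (regular_pt p)%:Z)%:~R :> R.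
Proof.
move=> /allP ok pk; have := ok p pk.
have [rp|np] := boolP (regular_pt p); last first.
  by move=> _; rewrite J_singular // mulr0 mulr0 expr0n.
case/orP => [//|/hasP[r rr /andP[rep /eqP d]]].
have /hasP[t wt /eqP e] := rep.
have [c1 c2] := class_reps_chi R rr.
have gp : grid p = wact t (grid r.1.1) by rewrite wact_grid -grid_modE -e grid_modE.
have [w1 w2] := chi_weyl (grid r.1.1) wt.
by rewrite gp (J_sqr_int (etrans w1 c1) (etrans w2 c2)) d mulr1.
Qed.

End AlternatingSum.

Local Open Scope classical_set_scope.

(** * Uniform measures and products *)

Section UniformMeasure.
Context d (T : measurableType d) (R : realType).
Implicit Types (s : seq T) (A : set T) (f : T -> R).

Definition average s f : R := (size s)%:R^-1 * \sum_(x <- s) f x.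

Lemma unifE s A : @unif R d T s A = (average s (\1_A))%:E.
Proof.
rewrite /unif /mscale /msum /average EFinM; congr (_ * _)%E.
rewrite -sumEFin (big_nth point) big_mkord; apply: eq_bigr => i _.
by rewrite /= diracE indicE.
Qed.

Lemma ge0_integral_unif s f : measurable_fun setT f -> (forall x, 0 <= f x) ->
  (\int[@unif R d T s]_x (f x)%:E = (average s f)%:E)%E.
Proof.
move=> mf f0; have mEf : measurable_fun setT (EFin \o f) by exact/measurable_EFinP.
rewrite /unif ge0_integral_mscale //=; last by move=> x _; rewrite lee_fin.
rewrite ge0_integral_measure_sum //=; last by move=> x _; rewrite lee_fin.
rewrite /average EFinM; congr (_ * _)%E.
rewrite -sumEFin (big_nth point) big_mkord; apply: eq_bigr => i _.
by rewrite integral_dirac // diracT mul1e.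
Qed.

Lemma integral_unif s f : measurable_fun setT f ->
  (\int[@unif R d T s]_x (f x)%:E = (average s f)%:E)%E.
Proof.
move=> mf; rewrite integralE.
rewrite (eq_integral (fun x => (Num.max (f x) 0)%:E)); last first.
  by move=> x _; rewrite funeposE EFin_max.
rewrite [X in (_ - X)%E](eq_integral (fun x => (Num.max (- f x) 0)%:E)); last first.
  by move=> x _; rewrite funenegE EFin_max EFinN.
rewrite !ge0_integral_unif.
- rewrite -EFinB; congr EFin; rewrite /average -mulrBr -sumrB; congr (_ * _).
  apply: eq_bigr => x _; rewrite maxEle maxEle.
  by case: (leP (f x) 0) => h; case: (leP (- f x) 0) => h2; lra.
- apply: measurable_maxr => //; exact: measurableT_comp.
- by move=> x; rewrite le_max lexx orbT.
- exact: measurable_maxr.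
- by move=> x; rewrite le_max lexx orbT.
Qed.

Lemma unif_setT s : s != [::] -> @unif R d T s setT = 1%E.
Proof.
move=> s0; rewrite unifE /average (eq_bigr (fun=> 1)) => [|x _]; last first.
  by rewrite indicE in_setT.
rewrite big_const_seq count_predT iter_addr_0 mulVf // pnatr_eq0.
by rewrite size_eq0.
Qed.

End UniformMeasure.

Section ProductUnif.
Context d1 d2 (T1 : measurableType d1) (T2 : measurableType d2) (R : realType).

Lemma unif_prod (s1 : seq T1) (s2 : seq T2) A : measurable A ->
  ((@unif R _ T1 s1 \x @unif R _ T2 s2) A
   = (average [seq (x, y) | x <- s1, y <- s2] (\1_A : _ -> R))%:E)%E.
Proof.
move=> mA; rewrite /product_measure1 /=.
under eq_integral => x _ do rewrite unifE.
rewrite integral_unif.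
  congr EFin; rewrite /average size_allpairs natrM invfM -mulrA; congr (_ * _).
  rewrite big_allpairs mulr_sumr; apply: eq_bigr => x _; congr (_ * _).
  by apply: eq_bigr => y _; rewrite !indicE mem_xsection.
apply/measurable_EFinP.
apply: (eq_measurable_fun ((@unif R _ T2 s2) \o xsection A)).
  by move=> x _; rewrite /= unifE.
exact: measurable_fun_xsection.
Qed.

End ProductUnif.

(** * Measurability on the torus *)

Section TorusMeasurable.
Variable R : realType.
Local Notation C := R[i].
Local Notation Re := complex.Re.
Local Notation Im := complex.Im.
Implicit Types f g : torus R -> C.

(** The sigma-algebra of the circle is induced by real and imaginary parts, so
    measurability of complex functions is taken componentwise. *)
Definition cmeasurable f : Prop :=
  measurable_fun setT (fun w => Re (f w)) /\ measurable_fun setT (fun w => Im (f w)).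

Lemma measurable_circle_coord : measurable_fun setT (@circle_coord R).
Proof. by move=> _ B mB; exists B. Qed.

Lemma cmeasurable_fst : cmeasurable (fun w => val w.1).
Proof.
have m : measurable_fun setT (fun w : torus R => circle_coord w.1).
  exact: (measurableT_comp measurable_circle_coord (@measurable_fst _ _ (circle R) (circle R))).
split; first exact: (measurableT_comp (@measurable_fst _ _ R R) m).
exact: (measurableT_comp (@measurable_snd _ _ R R) m).
Qed.

Lemma cmeasurable_snd : cmeasurable (fun w => val w.2).
Proof.
have m : measurable_fun setT (fun w : torus R => circle_coord w.2).
  exact: (measurableT_comp measurable_circle_coord (@measurable_snd _ _ (circle R) (circle R))).
split; first exact: (measurableT_comp (@measurable_fst _ _ R R) m).
exact: (measurableT_comp (@measurable_snd _ _ R R) m).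
Qed.

Lemma cmeasurable_cst c : cmeasurable (fun=> c).
Proof. by split; exact: measurable_cst. Qed.

Lemma cmeasurableD f g : cmeasurable f -> cmeasurable g -> cmeasurable (fun w => f w + g w).
Proof.
move=> [f1 f2] [g1 g2]; split.
  apply: (eq_measurable_fun (fun w => Re (f w) + Re (g w))); last exact: measurable_funD.
  by move=> w _; case: (f w) => ? ?; case: (g w).
apply: (eq_measurable_fun (fun w => Im (f w) + Im (g w))); last exact: measurable_funD.
by move=> w _; case: (f w) => ? ?; case: (g w).
Qed.

Lemma cmeasurableM f g : cmeasurable f -> cmeasurable g -> cmeasurable (fun w => f w * g w).
Proof.
move=> [f1 f2] [g1 g2]; split.
  apply: (eq_measurable_fun (fun w => Re (f w) * Re (g w) - Im (f w) * Im (g w))).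
    by move=> w _; case: (f w) => ? ?; case: (g w).
  by apply: measurable_funB; exact: measurable_funM.
apply: (eq_measurable_fun (fun w => Re (f w) * Im (g w) + Im (f w) * Re (g w))).
  by move=> w _; case: (f w) => ? ?; case: (g w).
by apply: measurable_funD; exact: measurable_funM.
Qed.

Lemma cmeasurableX f n : cmeasurable f -> cmeasurable (fun w => f w ^+ n).
Proof.
move=> mf; elim: n => [|n IH]; first exact: cmeasurable_cst.
have [h1 h2] := cmeasurableM mf IH.
by split; [move: h1|move: h2]; apply: eq_measurable_fun => w _; rewrite exprS.
Qed.

Lemma cmeasurable_conj f : cmeasurable f -> cmeasurable (fun w => Num.conj (f w)).
Proof.
move=> [f1 f2]; split.
  by move: f1; apply: eq_measurable_fun => w _; case: (f w).
have := measurable_funN f2.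
by apply: eq_measurable_fun => w _ /=; case: (f w).
Qed.

Lemma cmeasurable_mono a b : cmeasurable (mono a b).
Proof.
have ext f g : (forall w, f w = g w) -> cmeasurable f -> cmeasurable g.
  move=> e [h1 h2].
  by split; [move: h1|move: h2]; apply: eq_measurable_fun => w _; rewrite e.
have m0 a' b' (w : torus R) : mono a' 0 w * mono 0 b' w = mono a' b' w.
  by rewrite /mono !expr0z mulr1 mul1r.
apply: (ext _ _ (m0 a b)); apply: cmeasurableM.
  case: a => n; last first.
    apply: (ext (fun w => Num.conj (mono n.+1 0 w))); first by move=> w; rewrite -monoN oppr0 NegzE.
    apply: cmeasurable_conj; apply: (ext _ _ _ (cmeasurableX n.+1 cmeasurable_fst)) => w.
    by rewrite /mono expr0z mulr1.
  apply: (ext _ _ _ (cmeasurableX n cmeasurable_fst)) => w.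
  by rewrite /mono expr0z mulr1.
case: b => n; last first.
  apply: (ext (fun w => Num.conj (mono 0 n.+1 w))); first by move=> w; rewrite -monoN oppr0 NegzE.
  apply: cmeasurable_conj; apply: (ext _ _ _ (cmeasurableX n.+1 cmeasurable_snd)) => w.
  by rewrite /mono expr0z mul1r.
apply: (ext _ _ _ (cmeasurableX n cmeasurable_snd)) => w.
by rewrite /mono expr0z mul1r.
Qed.

Lemma cmeasurable_chi1 : cmeasurable (@chi1 R).
Proof.
rewrite /chi1; do 6 (apply: cmeasurableD; last exact: cmeasurable_mono).
exact: cmeasurable_cst.
Qed.

Lemma cmeasurable_chi2 : cmeasurable (@chi2 R).
Proof.
rewrite /chi2; do 6 (apply: cmeasurableD; last exact: cmeasurable_mono).
by apply: cmeasurableD; [exact: cmeasurable_chi1 | exact: cmeasurable_cst].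
Qed.

Lemma measurable_J : measurable_fun setT (@J R).
Proof.
rewrite /J; apply: measurable_funM; first exact: measurable_cst.
have m a b : measurable_fun setT (fun w : torus R => Re (mono a b w)).
  exact: (proj1 (cmeasurable_mono a b)).
do 3 (apply: measurable_funB; last exact: m).
by do 2 (apply: measurable_funD; last exact: m).
Qed.

Definition rchi1 (w : torus R) : R := Re (chi1 w).
Definition rchi2 (w : torus R) : R := Re (chi2 w).

Lemma measurable_rchi1 : measurable_fun setT rchi1.
Proof. exact: (proj1 cmeasurable_chi1). Qed.
Lemma measurable_rchi2 : measurable_fun setT rchi2.
Proof. exact: (proj1 cmeasurable_chi2). Qed.

Lemma complex_ReE (z : C) : Im z = 0 -> z = (Re z)%:C%C.
Proof. by case: z => x y /= ->. Qed.

Lemma rchi1E w : chi1 w = (rchi1 w)%:C%C.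
Proof. exact: complex_ReE (proj1 (chi_real w)). Qed.
Lemma rchi2E w : chi2 w = (rchi2 w)%:C%C.
Proof. exact: complex_ReE (proj2 (chi_real w)). Qed.

Lemma Re_chiX m n w : Re (chi1 w ^+ m * chi2 w ^+ n) = rchi1 w ^+ m * rchi2 w ^+ n.
Proof. by rewrite rchi1E rchi2E -!rmorphXn -rmorphM. Qed.

Lemma norm_mono a b (w : torus R) : `|mono a b w| = 1.
Proof.
have h (z : circle R) (c : int) : `|val z ^ c| = 1.
  have /eqP nz := valP z; case: c => n; first by rewrite normrX nz expr1n.
  by rewrite normfV normrX nz expr1n invr1.
by rewrite /mono normrM !h mulr1.
Qed.

Lemma norm_Re_mono a b (w : torus R) : `|Re (mono a b w)| <= 1.
Proof.
have := norm_mono a b w; case: (mono a b w) => x y; rewrite normc_def => -[] /= e.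
have e2 : x ^+ 2 + y ^+ 2 = 1.
  by rewrite -[LHS]sqr_sqrtr ?e ?expr1n // addr_ge0 ?sqr_ge0.
rewrite -(ler_pXn2r (n := 2)) ?nnegrE ?normr_ge0 // expr1n real_normK ?num_real //.
by rewrite -e2 lerDl sqr_ge0.
Qed.

Lemma norm_rchi1 w : `|rchi1 w| <= 7.
Proof.
have ReD (x y : C) : Re (x + y) = Re x + Re y by case: x y => ? ? [].
rewrite /rchi1 /chi1 !ReD.
have := norm_Re_mono 1 0 w; have := norm_Re_mono (-1) 0 w.
have := norm_Re_mono 0 1 w; have := norm_Re_mono 0 (-1) w.
have := norm_Re_mono 1 (-1) w; have := norm_Re_mono (-1) 1 w.
rewrite !ler_norml /= => /andP[? ?] /andP[? ?] /andP[? ?] /andP[? ?] /andP[? ?] /andP[? ?].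
by apply/andP; split; lra.
Qed.

Lemma norm_rchi2 w : `|rchi2 w| <= 14.
Proof.
have ReD (x y : C) : Re (x + y) = Re x + Re y by case: x y => ? ? [].
have := norm_rchi1 w; rewrite /rchi2 /chi2 /rchi1; move: (chi1 w) => z; rewrite !ReD.
have := norm_Re_mono 1 1 w; have := norm_Re_mono (-1) (-1) w.
have := norm_Re_mono 2 (-1) w; have := norm_Re_mono (-2) 1 w.
have := norm_Re_mono 1 (-2) w; have := norm_Re_mono (-1) 2 w.
rewrite !ler_norml /=.
move=> /andP[? ?] /andP[? ?] /andP[? ?] /andP[? ?] /andP[? ?] /andP[? ?] /andP[? ?].
by apply/andP; split; lra.
Qed.

End TorusMeasurable.

(** * Measures with finitely supported moments *)

Section BivariatePolynomials.
Variable R : comNzRingType.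
Implicit Types f g : R -> R -> R.

Definition bipoly f : Prop := exists s : seq (R * (nat * nat)),
  forall x y, f x y = \sum_(q <- s) q.1 * (x ^+ q.2.1 * y ^+ q.2.2).

Lemma bipoly_ext f g : (forall x y, f x y = g x y) -> bipoly f -> bipoly g.
Proof. by move=> e [s hs]; exists s => x y; rewrite -e. Qed.

Lemma bipoly_cst c : bipoly (fun _ _ => c).
Proof. by exists [:: (c, (0%N, 0%N))] => x y; rewrite big_seq1 !expr0 !mulr1. Qed.

Lemma bipoly_fst : bipoly (fun x _ => x).
Proof. by exists [:: (1, (1%N, 0%N))] => x y; rewrite big_seq1 expr0 expr1 mulr1 mul1r. Qed.

Lemma bipoly_snd : bipoly (fun _ y => y).
Proof. by exists [:: (1, (0%N, 1%N))] => x y; rewrite big_seq1 expr0 expr1 !mul1r. Qed.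

Lemma bipolyD f g : bipoly f -> bipoly g -> bipoly (fun x y => f x y + g x y).
Proof. by move=> [s hs] [t ht]; exists (s ++ t) => x y; rewrite big_cat -hs -ht. Qed.

Lemma bipolyM f g : bipoly f -> bipoly g -> bipoly (fun x y => f x y * g x y).
Proof.
move=> [s hs] [t ht].
exists [seq (p.1 * q.1, (p.2.1 + q.2.1, p.2.2 + q.2.2)%N) | p <- s, q <- t] => x y.
rewrite hs ht big_allpairs_dep mulr_suml; apply: eq_bigr => p _.
rewrite mulr_sumr; apply: eq_bigr => q _ /=.
by rewrite !exprD mulrACA; congr (_ * _); rewrite mulrACA.
Qed.

Lemma bipoly_prod (I : Type) (r : seq I) (P : pred I) (f : I -> R -> R -> R) :
  (forall i, bipoly (f i)) -> bipoly (fun x y => \prod_(i <- r | P i) f i x y).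
Proof.
move=> hf; elim: r => [|i r IH].
  by apply: bipoly_ext (bipoly_cst 1) => x y; rewrite big_nil.
apply: (@bipoly_ext (fun x y => (if P i then f i x y else 1) * \prod_(i <- r | P i) f i x y)).
  by move=> x y; rewrite big_cons; case: (P i); rewrite ?mul1r.
by apply: bipolyM => //; case: (P i) => //; exact: bipoly_cst.
Qed.

Lemma bipoly_sum (I : Type) (r : seq I) (f : I -> R -> R -> R) :
  (forall i, bipoly (f i)) -> bipoly (fun x y => \sum_(i <- r) f i x y).
Proof.
move=> hf; elim: r => [|i r IH].
  by apply: bipoly_ext (bipoly_cst 0) => x y; rewrite big_nil.
by apply: bipoly_ext (bipolyD (hf i) IH) => x y; rewrite big_cons.
Qed.

Lemma bipoly_sqdist (z : R * R) : bipoly (fun x y => (x - z.1) ^+ 2 + (y - z.2) ^+ 2).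
Proof.
have d (u : R -> R -> R) c : bipoly u -> bipoly (fun x y => (u x y - c) ^+ 2).
  move=> hu; have h := bipolyD hu (bipoly_cst (- c)).
  by apply: bipoly_ext (bipolyM h h) => x y; rewrite expr2.
by apply: bipolyD; apply: d; [exact: bipoly_fst|exact: bipoly_snd].
Qed.

End BivariatePolynomials.

Section FiniteMoments.
Context d (T : measurableType d) (R : realType) (mu : probability T R).
Variables (X Y : T -> R) (a b : R).
Hypothesis mX : measurable_fun setT X.
Hypothesis mY : measurable_fun setT Y.
Hypothesis bX : forall w, `|X w| <= a.
Hypothesis bY : forall w, `|Y w| <= b.
Variables (I : eqType) (s : seq I) (pt : I -> R * R) (wt : I -> R).
Hypothesis us : uniq s.
Hypothesis pt_inj : {in s &, injective pt}.
Hypothesis moments : forall m n,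
  (\int[mu]_w (X w ^+ m * Y w ^+ n)%:E
   = (\sum_(i <- s) wt i * ((pt i).1 ^+ m * (pt i).2 ^+ n))%:E)%E.

Let mXY m n : measurable_fun setT (fun w => X w ^+ m * Y w ^+ n).
Proof. by apply: measurable_funM; exact: measurable_funX. Qed.

Let integrable_XY m n : mu.-integrable setT (fun w => (X w ^+ m * Y w ^+ n)%:E).
Proof.
apply: measurable_bounded_integrable => //.
  by rewrite (le_lt_trans (probability_le1 mu measurableT)) // ltry.
exists (a ^+ m * b ^+ n); split; first exact: num_real.
move=> M aM w _; apply: le_trans (ltW aM).
rewrite normrM !normrX ler_pM ?exprn_ge0 //.
  by rewrite lerXn2r ?nnegrE // (le_trans _ (bX w)).
by rewrite lerXn2r ?nnegrE // (le_trans _ (bY w)).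
Qed.

Lemma integral_bipoly f : bipoly f ->
  mu.-integrable setT (fun w => (f (X w) (Y w))%:E) /\
  (\int[mu]_w (f (X w) (Y w))%:E = (\sum_(i <- s) wt i * f (pt i).1 (pt i).2)%:E)%E.
Proof.
case=> r; elim: r f => [|q r IH] f hf.
  have -> : (fun w => (f (X w) (Y w))%:E) = cst 0%E.
    by apply/funext => w; rewrite hf big_nil.
  split; first exact: integrable0.
  by rewrite integral0 big1 // => z _; rewrite hf big_nil mulr0.
pose g x y := \sum_(q <- r) q.1 * (x ^+ q.2.1 * y ^+ q.2.2).
have [ig eg] := IH g (fun _ _ => erefl).
have -> : (fun w => (f (X w) (Y w))%:E) =
  (fun w => (q.1)%:E * (X w ^+ q.2.1 * Y w ^+ q.2.2)%:E + (g (X w) (Y w))%:E)%E.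
  by apply/funext => w; rewrite hf big_cons.
have iq := integrableZl measurableT q.1 (integrable_XY q.2.1 q.2.2).
split; first exact: integrableD.
rewrite integralD // integralZl // moments eg -EFinM -EFinD; congr EFin.
rewrite mulr_sumr -big_split; apply: eq_bigr => z _ /=.
by rewrite hf big_cons mulrDr mulrCA.
Qed.

Let sqd (z : R * R) x y : R := (x - z.1) ^+ 2 + (y - z.2) ^+ 2.

Let sqd_eq0 z x y : (sqd z x y == 0) = ((x, y) == z).
Proof.
rewrite /sqd paddr_eq0 ?sqr_ge0 // !sqrf_eq0 !subr_eq0.
by case: z => z1 z2; rewrite xpair_eqE.
Qed.

(** The product of the squared distances of (X, Y) to the points pt i is a
    nonnegative polynomial of integral 0. *)
Lemma ae_in_support : {ae mu, forall w, (X w, Y w) \in [seq pt i | i <- s]}.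
Proof.
pose P0 x y := \prod_(i <- s) sqd (pt i) x y.
have bP : bipoly P0 by apply: bipoly_prod => i; exact: bipoly_sqdist.
have [/integrableP[mP _] e0] := integral_bipoly bP.
have z0 : (\int[mu]_w `|(P0 (X w) (Y w))%:E| = 0)%E.
  under eq_integral => w _.
    rewrite gee0_abs; last by rewrite lee_fin; apply: prodr_ge0 => i _; rewrite addr_ge0 ?sqr_ge0.
    over.
  rewrite e0 big_seq big1 // => i si; rewrite /P0 (bigD1_seq i) //=.
  have := eqxx (pt i); rewrite {1}[pt i]surjective_pairing -sqd_eq0 => /eqP->.
  by rewrite mul0r mulr0.
move/(ae_eq_integral_abs _ measurableT mP): z0.
apply: filterS => w /(_ Logic.I) [] /eqP.
rewrite prodf_seq_eq0 => /hasP[i si /=]; rewrite sqd_eq0 => /eqP ->.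
exact: map_f.
Qed.

(** Almost everywhere, h is the polynomial in X and Y that interpolates the values
    H i at the points pt i. *)
Theorem integral_finite_moments (h : T -> R) (H : I -> R) :
  measurable_fun setT h ->
  (forall i w, i \in s -> (X w, Y w) = pt i -> h w = H i) ->
  (\int[mu]_w (h w)%:E = (\sum_(i <- s) wt i * H i)%:E)%E.
Proof.
move=> mh hH.
pose Q i x y := \prod_(j <- s | j != i) sqd (pt j) x y.
pose g x y := \sum_(i <- s) H i * (Q i (pt i).1 (pt i).2)^-1 * Q i x y.
have bg : bipoly g.
  apply: bipoly_sum => i; apply: bipolyM; first exact: bipoly_cst.
  by apply: bipoly_prod => j; exact: bipoly_sqdist.
have Qi i : i \in s -> Q i (pt i).1 (pt i).2 != 0.
  move=> si; rewrite prodf_seq_neq0; apply/allP => j sj; apply/implyP => ji.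
  rewrite sqd_eq0 -surjective_pairing; apply: contraNneq ji => e.
  by apply/eqP; apply: pt_inj.
have Qj i j : j \in s -> j != i -> Q i (pt j).1 (pt j).2 = 0.
  move=> sj ji; apply/eqP; rewrite prodf_seq_eq0; apply/hasP; exists j => //.
  by rewrite ji sqd_eq0 -surjective_pairing /=.
have gi i : i \in s -> g (pt i).1 (pt i).2 = H i.
  move=> si; rewrite /g (bigD1_seq i) //= mulfVK ?Qi // big1 ?addr0 // => j ji.
  by rewrite (Qj j i) ?mulr0 // eq_sym.
have [/integrableP[mg _] eg] := integral_bipoly bg.
rewrite (ae_eq_integral (fun w => (g (X w) (Y w))%:E)) //.
- by rewrite eg; congr EFin; rewrite big_seq [RHS]big_seq; apply: eq_bigr => i /gi ->.
- exact/measurable_EFinP.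
- apply: filterS ae_in_support => w /mapP[i si e] _.
  by rewrite (hH i w si e) -(gi _ si) -e.
Qed.

End FiniteMoments.

(** * The measure carried by nine Weyl orbits *)

Section ClassMeasure.
Variable R : realType.
Local Notation grid := (grid R).
Implicit Types f : torus R -> R.

Lemma measurable_to_circle (f : torus R -> circle R) :
  cmeasurable (fun w => val (f w)) -> measurable_fun setT f.
Proof.
move=> [m1 m2] mT _ [B mB <-].
have := measurable_fun_pair m1 m2 mT mB.
by rewrite !setTI.
Qed.

Lemma measurable_wact t : measurable_fun setT (@wact R t).
Proof.
apply: measurable_fun_pair; apply: measurable_to_circle; exact: cmeasurable_mono.
Qed.

Definition orbit_mean f w : R := 12^-1 * \sum_(t <- weyl) f (wact t w).

Lemma orbit_mean_wact f t w : t \in weyl -> orbit_mean f (wact t w) = orbit_mean f w.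
Proof.
move=> wt; congr (_ * _); rewrite -[RHS](perm_big _ (weyl_mulr wt)) big_map.
by apply: eq_bigr => s _; rewrite wactM.
Qed.

Lemma measurable_orbit_mean f : measurable_fun setT f -> measurable_fun setT (orbit_mean f).
Proof.
move=> mf; apply: measurable_funM; first exact: measurable_cst.
apply: measurable_sum => t; exact: measurableT_comp mf (measurable_wact t).
Qed.

(** The twelve Weyl translates of each representative, repeated as many times as
    there are group elements with its character values. *)
Definition class_points : seq (torus R) :=
  flatten [seq flatten (nseq r.2 [seq wact t (grid r.1.1) | t <- weyl]) | r <- class_reps].

Lemma sum_class_points (V : nmodType) (f : torus R -> V) :
  \sum_(w <- class_points) f w =
  \sum_(r <- class_reps) (\sum_(t <- weyl) f (wact t (grid r.1.1))) *+ r.2.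
Proof.
rewrite big_flatten big_map; apply: eq_bigr => r _.
by rewrite big_flatten big_nseq iter_addr_0 big_map.
Qed.

Lemma size_class_points : size class_points = 16128%N.
Proof.
rewrite -sum1_size sum_class_points.
under eq_bigr => r _ do rewrite sum1_size.
by rewrite !big_cons big_nil.
Qed.

Lemma average_class_points f : average class_points f =
  \sum_(r <- class_reps) r.2%:R / 1344 * orbit_mean f (grid r.1.1).
Proof.
rewrite /average size_class_points sum_class_points mulr_sumr.
apply: eq_bigr => r _; rewrite /orbit_mean -mulr_natl; by field.
Qed.

Definition class_measure : set (torus R) -> \bar R := @unif R _ (torus R) class_points.
HB.instance Definition _ := Measure.on class_measure.

Let class_measureT : class_measure setT = 1%E.
Proof.
apply: unif_setT; apply/eqP => e; have := size_class_points.
by rewrite e.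
Qed.
HB.instance Definition _ :=
  Measure_isProbability.Build _ _ _ class_measure class_measureT.

Lemma class_measureE A : class_measure A =
  (\sum_(r <- class_reps) r.2%:R / 1344 * orbit_mean (\1_A) (grid r.1.1))%:E.
Proof. by rewrite /class_measure unifE average_class_points. Qed.

Lemma class_measure_wact t A : t \in weyl ->
  class_measure (wact t @^-1` A) = class_measure A.
Proof.
move=> wt; rewrite !class_measureE; congr EFin; apply: eq_bigr => r _.
congr (_ * _); congr (_ * _).
rewrite -[RHS](perm_big _ (weyl_mull wt)) big_map; apply: eq_bigr => s _.
by rewrite wactM.
Qed.

Definition chi_pair (r : (int * int) * (int * int) * nat) : R * R :=
  (r.1.2.1%:~R, r.1.2.2%:~R).

Lemma chi_pair_inj : {in class_reps &, injective chi_pair}.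
Proof.
have h : all (fun r => all (fun r' => (r.1.2 == r'.1.2) ==> (r == r')) class_reps) class_reps.
  by vm_compute.
move=> r r' rr rr' [/intr_inj e1 /intr_inj e2].
have /implyP := allP (allP h r rr) r' rr'.
by rewrite -pair_eqE /= /pair_eq e1 e2 !eqxx => /(_ isT) /eqP.
Qed.

Lemma rchi_grid r : r \in class_reps ->
  rchi1 (grid r.1.1) = (chi_pair r).1 /\ rchi2 (grid r.1.1) = (chi_pair r).2.
Proof.
move=> rr; have [c1 c2] := class_reps_chi R rr.
by split; apply: (@complexI R); rewrite -?rchi1E -?rchi2E ?c1 ?c2 rmorph_int.
Qed.

Lemma rchi_pair_orbit r w : r \in class_reps -> (rchi1 w, rchi2 w) = chi_pair r ->
  exists2 t, t \in weyl & w = wact t (grid r.1.1).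
Proof.
move=> rr [e1 e2]; have [c1 c2] := class_reps_chi R rr.
by apply: chi_separation; rewrite ?c1 ?c2 ?rchi1E ?rchi2E ?e1 ?e2 rmorph_int.
Qed.

Lemma class_measure_moments m n :
  (\int[class_measure]_w (rchi1 w ^+ m * rchi2 w ^+ n)%:E =
   (\sum_(r <- class_reps) r.2%:R / 1344 * ((chi_pair r).1 ^+ m * (chi_pair r).2 ^+ n))%:E)%E.
Proof.
rewrite integral_unif; last first.
  by apply: measurable_funM; apply: measurable_funX;
     [exact: measurable_rchi1 | exact: measurable_rchi2].
rewrite average_class_points; congr EFin; rewrite big_seq [RHS]big_seq.
apply: eq_bigr => r rr; have [<- <-] := rchi_grid rr; congr (_ * _).
rewrite /orbit_mean big_seq (eq_bigr (fun=> rchi1 (grid r.1.1) ^+ m * rchi2 (grid r.1.1) ^+ n)).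
  rewrite -big_seq big_const_seq count_predT iter_addr_0 -[size weyl]/12%N.
  by rewrite -[X in _ * X]mulr_natl mulKf // pnatr_eq0.
by move=> t wt; have [c1 c2] := chi_weyl (grid r.1.1) wt; rewrite /rchi1 /rchi2 c1 c2.
Qed.

(** By invariance, the measure of A is the integral of the mean of \1_A over Weyl
    orbits.  This mean is a function of (chi1, chi2), because they separate the
    orbits, and integral_finite_moments evaluates it. *)
Lemma measure_moments_unique (mu : probability (torus R) R) :
  (forall t A, t \in weyl -> measurable A -> mu (wact t @^-1` A) = mu A) ->
  (forall m n, \int[mu]_w (rchi1 w ^+ m * rchi2 w ^+ n)%:E =
    (\sum_(r <- class_reps) r.2%:R / 1344 * ((chi_pair r).1 ^+ m * (chi_pair r).2 ^+ n))%:E)%E ->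
  forall A, measurable A -> mu A = class_measure A.
Proof.
move=> muI muM A mA; rewrite class_measureE.
have m1 : measurable_fun setT (\1_A : torus R -> R) by exact: measurable_indic.
rewrite -(integral_finite_moments (@measurable_rchi1 R) (@measurable_rchi2 R)
  (@norm_rchi1 R) (@norm_rchi2 R) _ chi_pair_inj muM (h := orbit_mean (\1_A))) //.
- rewrite /orbit_mean; under eq_integral => w _ do rewrite EFinM -sumEFin.
  have mw t : measurable_fun setT (fun w => ((\1_A : torus R -> R) (wact t w))%:E).
    by apply/measurable_EFinP; exact: measurableT_comp m1 (measurable_wact t).
  rewrite ge0_integralZl_EFin //; last 2 first.
  - by move=> w _; apply: sume_ge0 => t _; rewrite lee_fin.
  - by apply: emeasurable_sum => t; exact: mw.
  rewrite ge0_integral_sum //.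
  have fA : mu A \is a fin_num by exact: fin_num_measure.
  rewrite big_seq (eq_bigr (fun=> (fine (mu A))%:E)) => [|t wt].
    rewrite -big_seq sumEFin big_const_seq count_predT iter_addr_0 -[size weyl]/12%N.
    by rewrite -EFinM -[X in _ * X]mulr_natl mulKf ?fineK // pnatr_eq0.
  rewrite (fineK fA) -(muI t A wt mA) -[X in mu X]setIT -integral_indic //.
  by rewrite -[X in measurable X]setTI; exact: measurable_wact.
- exact: measurable_orbit_mean.
- by move=> r w rr /(rchi_pair_orbit rr)[t wt ->]; rewrite orbit_mean_wact.
Qed.

End ClassMeasure.

(** * The measure in terms of roots of unity *)

Section RootMeasures.
Variable R : realType.
Local Notation grid := (grid R).
Implicit Types (f : torus R -> R) (A : set (torus R)).

Definition root_seq (k : nat) : seq (circle R) := [seq expi (q%:R / k%:R) | q <- iota 0 k].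
Definition root_points (k : nat) : seq (torus R) :=
  [seq (x, y) | x <- root_seq k, y <- root_seq k].

Lemma average_root_points k f : (k %| 168)%N ->
  average (root_points k) f = (k ^ 2)%:R^-1 * \sum_(p <- gridk k) f (grid p).
Proof.
move=> k168; have k0 : (k%:R : R) != 0 by rewrite pnatr_eq0; case: k k168.
have e q : expi (q%:R / k%:R) = expi ((168 %/ k * q)%N%:Z%:~R / 168) :> circle R.
  congr expi; rewrite -pmulrn natrM.
  have : 168 = (168 %/ k)%:R * k%:R :> R by rewrite -natrM divnK.
  move: (168 %/ k)%:R => m e168.
  have m0 : m != 0 by apply: contra_eq_neq e168 => ->; rewrite mul0r pnatr_eq0.
  by rewrite e168 -mulf_div divff // mul1r.
rewrite /average size_allpairs !size_map size_iota mulnn; congr (_ * _).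
rewrite /gridk big_allpairs big_allpairs_dep big_map; apply: eq_bigr => q1 _.
by rewrite big_map; apply: eq_bigr => q2 _; rewrite !e.
Qed.

Lemma prod_rootsE k A : measurable A ->
  (d_roots k \x d_roots k)%E A = @unif R _ (torus R) (root_points k) A.
Proof. by move=> mA; rewrite unifE [LHS]unif_prod. Qed.

Lemma prod_roots_grid k A : (k %| 168)%N -> measurable A ->
  (d_roots k \x d_roots k)%E A
  = ((k ^ 2)%:R^-1 * \sum_(p <- gridk k) \1_A (grid p))%:E.
Proof. by move=> k168 mA; rewrite prod_rootsE // unifE average_root_points. Qed.

Lemma integral_J_roots k v A : (k %| 168)%N -> J_table_ok k v -> measurable A ->
  (\int[d_roots k \x d_roots k]_(w in A) (J w ^+ 2)%:E
  = (16 * pi ^+ 4 * (v%:~R * (k ^ 2)%:R^-1 *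
     \sum_(p <- gridk k) (regular_pt p)%:R * \1_A (grid p)))%:E)%E.
Proof.
move=> k168 ok mA.
rewrite (eq_measure_integral (@unif R _ (torus R) (root_points k))); last first.
  by move=> B mB _; exact: prod_rootsE.
rewrite integral_mkcond (eq_integral (fun w => (J w ^+ 2 * \1_A w)%:E)); last first.
  move=> w _; rewrite patchE indicE; case: ifP => _; first by rewrite mulr1.
  by rewrite mulr0.
rewrite ge0_integral_unif; last 2 first.
- apply: measurable_funM; last exact: measurable_indic.
  by apply: measurable_funX; exact: measurable_J.
- by move=> w; rewrite mulr_ge0 ?sqr_ge0.
rewrite average_root_points //; congr EFin.
rewrite !mulr_sumr [LHS]big_seq [RHS]big_seq; apply: eq_bigr => p pk.
by rewrite (J_grid_sqr R ok pk) rmorphM /=; ring.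
Qed.

Lemma d_par1E A : measurable A -> d_par 1 A =
  (3^-1 * (\1_A (grid (0%Z, 0%Z)) + \1_A (grid (56%Z, 112%Z))
           + \1_A (grid (112%Z, 56%Z))))%:E.
Proof.
move=> mA; rewrite /d_par unifE /average.
set s := [seq q <- _ | _]; have -> : s = [:: (0, 0); (1, 2); (2, 1)]%N by [].
rewrite /= !big_cons big_nil addr0 !addrA.
have e (q : nat) p : q%:R / (3 * 1)%:R = p%:~R / 168 :> R ->
    expi (q%:R / (3 * 1)%:R) = expi (p%:~R / 168) :> circle R.
  by move=> ->.
rewrite (e 0%N 0%Z) ?(e 1%N 56%Z) ?(e 2%N 112%Z) //.
- by rewrite -!pmulrn; field.
- by rewrite -!pmulrn; field.
- by rewrite -!pmulrn; field.
Qed.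

Lemma class_measure_grid A : class_measure A =
  (16128^-1 * \sum_(q <- root_weights) q.1%:~R * \1_A (grid q.2))%:E.
Proof.
rewrite class_measureE -average_class_points /average size_class_points; congr (_ * _)%:E.
rewrite -(sum_class_root_weights (f := fun p => \1_A (grid p))); last first.
  by move=> p; rewrite grid_modE.
rewrite sum_class_points big_allpairs_dep; apply: eq_bigr => r _.
rewrite -mulr_natl mulr_sumr; apply: eq_bigr => t _.
by rewrite wact_grid.
Qed.

Theorem class_measure_roots A : measurable A ->
  class_measure A =
    ((1 / (768 * pi ^+ 4))%:E *
       \int[d_roots 8 \x d_roots 8]_(w in A) ((J w) ^+ 2)%:E
   + (1 / (672 * pi ^+ 4))%:E *
       \int[d_roots 7 \x d_roots 7]_(w in A) ((J w) ^+ 2)%:E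
   + (1 / (1152 * pi ^+ 4))%:E *
       \int[d_roots 6 \x d_roots 6]_(w in A) ((J w) ^+ 2)%:E
   + (1 / 12)%:E * (d_roots 4 \x d_roots 4) A
   + (1 / 4)%:E * (d_roots 3 \x d_roots 3) A
   + (5 / 72)%:E * (d_roots 2 \x d_roots 2) A
   - (11 / 504)%:E * (d_roots 1 \x d_roots 1) A
   - (1 / 12)%:E * d_par 1 A)%E.
Proof.
move=> mA; rewrite class_measure_grid.
rewrite (integral_J_roots _ J_table8) // (integral_J_roots _ J_table7) //.
rewrite (integral_J_roots _ J_table6) // !prod_roots_grid // d_par1E //.
rewrite -!EFinM -!EFinN -!EFinD; congr EFin.
rewrite /root_weights.
move: (gridk 8) (gridk 7) (gridk 6) (gridk 4) (gridk 3) (gridk 2) (gridk 1).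
move=> s8 sum7 s6 s4 s3 s2 s1; pose f p : R := \1_A (grid p).
have sumc (c : int) (s : seq (int * int)) :
    \sum_(q <- [seq (c, p) | p <- s]) q.1%:~R * f q.2 = c%:~R * \sum_(p <- s) f p.
  by rewrite big_map mulr_sumr.
have sumb (c : int) (b : pred (int * int)) (s : seq (int * int)) :
    \sum_(q <- [seq (c * (b p)%:Z, p) | p <- s]) q.1%:~R * f q.2
    = c%:~R * \sum_(p <- s) (b p)%:R * f p.
  by rewrite big_map mulr_sumr; apply: eq_bigr => p _; rewrite rmorphM mulrA.
rewrite !big_cat !sumc !sumb !big_cons big_nil addr0 addrA /=.
rewrite -/(f (0%Z, 0%Z)) -/(f (56%Z, 112%Z)) -/(f (112%Z, 56%Z)).
have : pi != 0 :> R by rewrite gt_eqF ?pi_gt0.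
move: (\sum_(p <- s8) _) (\sum_(p <- sum7) _) (\sum_(p <- s6) _) (\sum_(p <- s4) _).
move: (\sum_(p <- s3) _) (\sum_(p <- s2) _) (\sum_(p <- s1) _) (f _ + _).
move=> S3 S2 S1 S0 S8 S7 S6 S4; move: (@pi R) => c c0.
by field.
Qed.

End RootMeasures.

(** * The joint spectral measure *)

Section McKayValues.
Variables (R : realType) (gT : finGroupType) (iota : {multiplicative gT -> G2 R}).
Hypothesis hG : is_nonsplit_2_3_PSL27 gT.
Hypothesis iota_inj : injective iota.

Lemma McKay_moment_value m n :
  McKay_moment (varrho1 iota) (varrho2 iota) m n =
  \sum_(r <- class_reps) r.2%:R / 1344 * ((chi_pair R r).1 ^+ m * (chi_pair R r).2 ^+ n).
Proof.
have [cG sumG] := sum_characters hG iota_inj.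
apply: (@complexI R); rewrite McKay_momentE cardsT cG.
rewrite (sumG _ (fun x y => x ^+ m * y ^+ n)) -class_reps_table big_map.
rewrite mulr_sumr rmorph_sum; apply: eq_bigr => r _.
rewrite !rmorphM !rmorphXn fmorphV !rmorph_int !rmorph_nat /=.
by rewrite -[X in _ * X = _]mulr_natl !mulrA (mulrC _^-1).
Qed.

Lemma moments_value (mu : probability (torus R) R) :
  joint_spectral_measure iota mu -> forall m n,
  (\int[mu]_w (rchi1 w ^+ m * rchi2 w ^+ n)%:E =
   (\sum_(r <- class_reps) r.2%:R / 1344
      * ((chi_pair R r).1 ^+ m * (chi_pair R r).2 ^+ n))%:E)%E.
Proof.
move=> [_ hmu] m n; have [e _] := hmu m n.
rewrite -McKay_moment_value -e; apply: eq_integral => w _.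
by rewrite Re_chiX.
Qed.

Lemma class_measure_spectral :
  joint_spectral_measure iota (@class_measure R : probability (torus R) R).
Proof.
split=> [T A /D12_weyl[t wt ->] _|m n]; first exact: class_measure_wact.
split; last by rewrite McKay_momentE class_momentE.
rewrite McKay_moment_value -class_measure_moments; apply: eq_integral => w _.
by rewrite Re_chiX.
Qed.

End McKayValues.

Local Open Scope ereal_scope.

Theorem theorem4p3 (R : realType) (gT : finGroupType)
    (iota : {multiplicative gT -> G2 R}) :
  is_nonsplit_2_3_PSL27 gT -> injective iota ->
  exists eps : probability (torus R) R,
    [/\ joint_spectral_measure iota eps,
        (forall eps' : probability (torus R) R,
           joint_spectral_measure iota eps' ->
           forall A : set (torus R), measurable A -> eps' A = eps A) &
        (forall A : set (torus R), measurable A ->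
           eps A =
             (1 / (768 * pi ^+ 4))%:E *
               \int[d_roots 8 \x d_roots 8]_(w in A) ((J w) ^+ 2)%:E
           + (1 / (672 * pi ^+ 4))%:E *
               \int[d_roots 7 \x d_roots 7]_(w in A) ((J w) ^+ 2)%:E
           + (1 / (1152 * pi ^+ 4))%:E *
               \int[d_roots 6 \x d_roots 6]_(w in A) ((J w) ^+ 2)%:E
           + (1 / 12)%:E * (d_roots 4 \x d_roots 4) A
           + (1 / 4)%:E * (d_roots 3 \x d_roots 3) A
           + (5 / 72)%:E * (d_roots 2 \x d_roots 2) A
           - (11 / 504)%:E * (d_roots 1 \x d_roots 1) A
           - (1 / 12)%:E * d_par 1 A)].
Proof.
move=> hG iota_inj; exists (@class_measure R : probability (torus R) R); split.
- exact: class_measure_spectral hG iota_inj.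
- move=> eps' heps'; apply: measure_moments_unique.
    by move=> t A wt mA; apply: (proj1 heps') => //; exact: weyl_D12.
  exact: moments_value hG iota_inj eps' heps'.
- by move=> A mA; exact: class_measure_roots.
Qed.
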